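(* There is a deterministic logarithmic-space Turing machine $M$ such that for every finite ordered graph $(G,<)$, the relation $\prec$ on the vertices of $G$ defined by: $v\prec w$ iff $M$ accepts the input consisting of the canonical encoding of $(G,<)$ together with (the indices of) $v$ and $w$, is a linear order of the vertex set of $G$ which is a traversal of $G$.
   Context: A finite ordered graph $(G,<)$ is a finite undirected graph with a linear order on its vertices; its canonical encoding is the standard string encoding of the structure relative to the order $<$, vertices being referred to by their index in $<$. A linear order $\prec$ of the vertex set of a graph, listing vertices $v_1\prec\dots\prec v_n$, is a traversal if for each $i\ge2$: whenever some vertex among $v_1,\dots,v_{i-1}$ has a neighbour outside $\{v_1,\dots,v_{i-1}\}$, $v_i$ has a neighbour among $v_1,\dots,v_{i-1}$ (i.e. it is a visiting order of generic graph search). Equivalently: for all $u\prec v\prec w$, if $u$ and $w$ are adjacent then $v$ has a neighbour $x\prec v$. *)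

(* Defs.v *)
From mathcomp Require Import all_boot all_order.
Set Implicit Arguments. Unset Strict Implicit. Unset Printing Implicit Defensive.

Inductive isym := I0 | I1 | ISep.

Fixpoint bin_aux (fuel n : nat) : seq isym :=
  match fuel with
  | 0 => [::]
  | f.+1 => if n is 0 then [::] else (if odd n then I1 else I0) :: bin_aux f n./2
  end.
Definition binary (n : nat) : seq isym := bin_aux n n.

(* An ordered graph on n vertices: vertices are 'I_n, the order is the
   index order, E is the (symmetric, irreflexive) adjacency relation.
   Canonical encoding: the n x n adjacency matrix, row-major, followed by
   the two vertex indices in binary, separated by ISep. *)
Definition enc_graph (n : nat) (E : rel 'I_n) : seq isym :=
  [seq (if E i j then I1 else I0) | i <- enum 'I_n, j <- enum 'I_n].

Definition enc_input (n : nat) (E : rel 'I_n) (v w : 'I_n) : seq isym :=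
  enc_graph E ++ ISep :: binary v ++ ISep :: binary w.

Inductive dir := DL | DS | DR.

Record TM := {
  tm_Q : finType;
  tm_G : finType;
  tm_blank : tm_G;
  tm_q0 : tm_Q;
  tm_halt : pred tm_Q;
  tm_acc : pred tm_Q;
  (* input symbol read (None = end marker), work symbol read ->
     new state, written work symbol, input head move, work head move *)
  tm_delta : tm_Q -> option isym -> tm_G -> tm_Q * tm_G * dir * dir
}.

Record config (M : TM) := Config {
  c_state : tm_Q M;
  c_ihead : nat;                 (* 0 = left marker, size x + 1 = right marker *)
  c_tape : nat -> tm_G M;
  c_whead : nat
}.

Definition read_input (x : seq isym) (p : nat) : option isym :=
  if (0 < p <= size x) then Some (nth I0 x p.-1) else None.

Definition move (d : dir) (p : nat) : nat :=
  match d with DL => p.-1 | DS => p | DR => p.+1 end.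

Definition init_config (M : TM) : config M :=
  @Config M (tm_q0 M) 0 (fun _ => tm_blank M) 0.

Definition step (M : TM) (x : seq isym) (c : config M) : config M :=
  if @tm_halt M (c_state c) then c else
  let: (q', g, d1, d2) :=
    @tm_delta M (c_state c) (read_input x (c_ihead c)) (c_tape c (c_whead c)) in
  @Config M q' (minn (move d1 (c_ihead c)) (size x).+1)
         (fun i => if i == c_whead c then g else c_tape c i)
         (move d2 (c_whead c)).

Definition run (M : TM) (x : seq isym) (k : nat) : config M :=
  iter k (@step M x) (init_config M).

Definition halts (M : TM) (x : seq isym) : Prop :=
  exists k, @tm_halt M (c_state (run M x k)).

Definition accepts (M : TM) (x : seq isym) : Prop :=
  exists k, @tm_halt M (c_state (run M x k)) && @tm_acc M (c_state (run M x k)).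

Definition logspace_decider (M : TM) : Prop :=
  (forall x, halts M x) /\
  exists c : nat, forall x k,
    c_whead (run M x k) <= c * (trunc_log 2 (size x)).+1.

Definition strict_linear_order (T : Type) (prec : T -> T -> Prop) : Prop :=
  (forall v, ~ prec v v) /\
  (forall u v w, prec u v -> prec v w -> prec u w) /\
  (forall v w, v <> w -> prec v w \/ prec w v).

Definition traversal (n : nat) (E : rel 'I_n) (prec : 'I_n -> 'I_n -> Prop) : Prop :=
  forall v : 'I_n,
    (exists u y, prec u v /\ ~ prec y v /\ E u y) ->
    exists x, prec x v /\ E x v.

(* Main.v *)
(** Pairs of vertices form a rotation graph of constant degree, whose random walk
    has a spectral gap polynomial in 1/n. In the spirit of Reingold's theorem (in
    the derandomized squaring form of Rozenman and Vadhan), one passes from a level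
    to the next by grouping p + 1 steps, whose successive labels are obtained from
    one another by an expander acting on a constant size set of labels; each level
    multiplies the gap by a large constant, until it is bounded below. Hence for
    w = O(log n), from suitable initial labels for w levels, w steps of the last
    level lead from any vertex to any vertex of its component. The labels of all
    levels are stored on w tape cells and updated like an odometer.

    Trying all initial labels from each vertex, taken in index order, yields a
    sequence of vertices: the block of a vertex u consists of walks from u which
    visit exactly the component of u. The order of first visits is a traversal,
    and v precedes w when, running the enumeration, v is met before w. The machine
    is obtained from a structured program on base b registers of w digits, all of
    whose instructions are sweeps over the tape. *)
Require Import Defs.
From mathcomp Require Import all_boot all_order all_algebra.
From mathcomp Require Import ring lra.
From Stdlib Require Import FunctionalExtensionality.
Set Implicit Arguments. Unset Strict Implicit. Unset Printing Implicit Defensive.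

(** * Spectral gaps *)

Section SpectralGap.
Import Order.TTheory GRing.Theory Num.Theory.
Local Open Scope ring_scope.

Notation funext := functional_extensionality.

(** Plain powers of the rotation graph would need longer labels at each level, too long in total for
    logarithmic space. Changing labels by a fixed expander keeps the same finite label type [K] at
    every level, so that a level costs one tape cell. For this the expander has to act on tuples of
    its own labels. Translations of [F^m] along the moment curve do so, with pairs of field elements
    as labels. No eigenvalue occurs: a gap is a contraction factor for squared norms of rational
    functions. It is measured on functions of sum zero on every component, since the graph may be
    disconnected. Covering is purely existential: some labels lead to the target, and nothing tells
    which. Wrong labels are harmless, since they still describe walks inside the component, and
    along a walk every new vertex has an earlier neighbour. This replaces any memory of the visited
    vertices: a query only has to find which of two vertices comes first in one fixed sequence. *)

Definition avg (I : finType) (F : I -> rat) : rat := (\sum_i F i) / #|I|%:R.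
Definition dot (X : finType) (f g : X -> rat) : rat := \sum_x f x * g x.
Definition nrm (X : finType) (f : X -> rat) : rat := dot f f.

Section Dot.
Variable X : finType.
Implicit Types f g h : X -> rat.

Lemma dotC f g : dot f g = dot g f.
Proof. by apply: eq_bigr => x _; rewrite mulrC. Qed.

Lemma dotDl f g h : dot (fun x => f x + g x) h = dot f h + dot g h.
Proof. by rewrite -big_split; apply: eq_bigr => x _; rewrite mulrDl. Qed.

Lemma dotDr f g h : dot h (fun x => f x + g x) = dot h f + dot h g.
Proof. by rewrite dotC dotDl !(dotC h). Qed.

Lemma dotZl (c : rat) f h : dot (fun x => c * f x) h = c * dot f h.
Proof. by rewrite mulr_sumr; apply: eq_bigr => x _; rewrite mulrA. Qed.

Lemma dot0l h : dot (fun=> 0) h = 0.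
Proof. by apply: big1 => x _; rewrite mul0r. Qed.

Lemma nrm_ge0 f : 0 <= nrm f.
Proof. by apply: sumr_ge0 => x _; rewrite -expr2 sqr_ge0. Qed.

Lemma nrmZ (c : rat) f : nrm (fun x => c * f x) = c ^+ 2 * nrm f.
Proof. by rewrite /nrm dotZl dotC dotZl mulrA. Qed.

Lemma nrmD f g : nrm (fun x => f x + g x) = nrm f + nrm g + dot f g *+ 2.
Proof. by rewrite /nrm dotDl !dotDr (dotC g f) mulr2n; ring. Qed.

End Dot.

(** * Sums of commuting orthogonal projections *)

Section Projections.
Variables (W : finType) (I : eqType) (P : I -> (W -> rat) -> W -> rat).
Hypothesis PD : forall i f g, P i (fun w => f w + g w) = fun w => P i f w + P i g w.
Hypothesis PZ : forall i c f, P i (fun w => c * f w) = fun w => c * P i f w.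
Hypothesis PP : forall i f, P i (P i f) = P i f.
Hypothesis Psym : forall i f g, dot (P i f) g = dot f (P i g).
Hypothesis PC : forall i j f, P i (P j f) = P j (P i f).

Definition psum s f w := \sum_(i <- s) P i f w.
Definition pprod s f := foldr P f s.

Lemma P0 i : P i (fun=> 0) = fun=> 0.
Proof.
have := PZ i 0 (fun=> 0); rewrite (_ : (fun w => 0 * 0) = fun=> 0).
  by move=> ->; apply: funext => w; rewrite mul0r.
by apply: funext => w; rewrite mul0r.
Qed.

Lemma pprodC s i f : pprod s (P i f) = P i (pprod s f).
Proof. by elim: s => //= j s ->; rewrite PC. Qed.

Lemma pprodD s f g : pprod s (fun w => f w + g w) = fun w => pprod s f w + pprod s g w.
Proof. by elim: s => //= j s ->; rewrite PD. Qed.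

Lemma pprodZ s c f : pprod s (fun w => c * f w) = fun w => c * pprod s f w.
Proof. by elim: s => //= j s ->; rewrite PZ. Qed.

Lemma P_psum s i f : P i (psum s f) = psum s (P i f).
Proof.
elim: s => [|j s IH].
  rewrite (_ : psum [::] f = fun=> 0) ?P0; last by apply: funext => w; exact: big_nil.
  by apply: funext => w; rewrite /psum big_nil.
have e g : psum (j :: s) g = fun w => P j g w + psum s g w.
  by apply: funext => w; exact: big_cons.
by rewrite !e PD IH PC.
Qed.

(* [f] is split into [P i f] and its orthogonal complement, on which the
   remaining projections act separately. *)
Lemma psum_bound s n f : uniq s ->
  (forall t, uniq t -> {subset t <= s} -> size t = n.+1 -> pprod t f = fun=> 0) ->
  dot f (psum s f) <= n%:R * nrm f /\ nrm (psum s f) <= n%:R ^+ 2 * nrm f.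
Proof.
elim: s n f => [|i s IH] n f.
  have e : psum [::] f = fun=> 0 by apply: funext => w; exact: big_nil.
  by rewrite e dotC dot0l /nrm dot0l !mulr_ge0 ?exprn_ge0 ?ler0n ?nrm_ge0.
move=> /= /andP[is_ us] ht.
have e F : psum (i :: s) F = fun w => P i F w + psum s F w.
  by apply: funext => w; exact: big_cons.
pose g := P i f; pose h w := f w + (-1) * g w.
have ef : f = fun w => g w + h w by apply: funext => w; rewrite /h; ring.
have Pg : P i g = g by exact: PP.
have Ph : P i h = fun=> 0.
  by rewrite /h PD PZ Pg; apply: funext => w; rewrite /g; ring.
have hs : forall t, uniq t -> {subset t <= s} -> size t = n.+1 -> pprod t h = fun=> 0.
  move=> t ut st zt; rewrite /h pprodD pprodZ pprodC ht //; last first.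
    by move=> j /st; rewrite inE orbC => ->.
  by rewrite P0; apply: funext => w; ring.
have [h1 h2] := IH n h us hs.
have psum0 : psum s (fun=> 0) = fun=> 0.
  by apply: funext => w; rewrite /psum big1 // => j _; rewrite P0.
have orth u v : P i u = u -> P i v = (fun=> 0) -> dot u v = 0.
  by move=> eu ev; rewrite -eu Psym ev dotC dot0l.
have Sg : P i (psum s g) = psum s g by rewrite P_psum Pg.
have Sh : P i (psum s h) = fun=> 0 by rewrite P_psum Ph.
have psumD : psum s f = fun w => psum s g w + psum s h w.
  apply: funext => w; rewrite /psum -big_split; apply: eq_bigr => j _ /=.
  by rewrite {1}ef PD.
have nf : nrm f = nrm g + nrm h by rewrite {1}ef nrmD orth // mul0rn addr0.
(* [P i] fixes [g], so products of only [n] of the remaining projections already kill [g]: induction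
   applies with [n - 1], and the summand [g] restores the missing 1. For [n = 0] the hypothesis
   makes [g] vanish. *)
have [h3 h4] : nrm g + dot g (psum s g) <= n%:R * nrm g /\
    nrm (fun w => g w + psum s g w) <= n%:R ^+ 2 * nrm g.
  case: n ht {hs h1 h2} => [|n] ht.
    have g0 : g = fun=> 0 by apply: (ht [:: i]) => // j; rewrite !inE => ->.
    by rewrite nrmD /nrm g0 psum0 !dot0l !mulr0 mul0rn !addr0 lexx.
  have [|h3 h4] := IH n g us.
    move=> t ut st zt; rewrite /g pprodC -[P i _]/(pprod (i :: t) f) ht //=.
    - by rewrite ut andbT; apply: contra is_ => /st.
    - by move=> j; rewrite !inE => /orP[->|/st ->]; rewrite ?orbT.
    - by rewrite zt.
  have n0 : 0 <= (n%:R : rat) by exact: ler0n.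
  rewrite nrmD -natr1; split; first by rewrite mulrDl mul1r addrC lerD2r.
  by rewrite mulr2n; nra.
rewrite e psumD nf.
pose a w := g w + psum s g w.
have Pa : P i a = a by rewrite /a PD Pg Sg.
have -> : (fun w => P i f w + (psum s g w + psum s h w)) = (fun w => a w + psum s h w).
  by apply: funext => w; rewrite addrA.
split.
  have -> : dot f (fun w => a w + psum s h w) = dot g a + dot h (psum s h).
    have df u : dot f u = dot g u + dot h u by rewrite {1}ef; exact: dotDl.
    by rewrite dotDr !df (orth _ _ Pg Sh) (dotC h a) (orth _ _ Pa Ph) addr0 add0r.
  by rewrite /a dotDr -/(nrm g) mulrDr lerD.
by rewrite nrmD (orth _ _ Pa Sh) mul0rn addr0 mulrDr lerD.
Qed.

End Projections.

(** * A Cayley expander on a vector space over a finite field *)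

Section MomentCurve.
Variables (F : finFieldType) (m : nat).
Notation W := 'rV[F]_m.

(** The moment curve: points at [m] distinct parameters form a basis, by Vandermonde. *)
Definition gam (x : F) : W := \row_j x ^+ j.
(** The orthogonal projection onto the functions that are constant along the direction [gam x]. *)
Definition line (x : F) (f : W -> rat) (w : W) : rat := avg (fun y : F => f (w + y *: gam x)).

Let F0 : #|F|%:R != 0 :> rat.
Proof. by rewrite pnatr_eq0 -lt0n; apply/card_gt0P; exists 0. Qed.

Lemma line_inv x f w y : line x f (w + y *: gam x) = line x f w.
Proof.
congr (_ / _); rewrite [RHS](reindex_inj (addrI y)); apply: eq_bigr => z _.
by rewrite scalerDl addrA.
Qed.

Lemma lineD x f g : line x (fun w => f w + g w) = fun w => line x f w + line x g w.
Proof. by apply: funext => w; rewrite /line /avg big_split mulrDl. Qed.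

Lemma lineZ x c f : line x (fun w => c * f w) = fun w => c * line x f w.
Proof. by apply: funext => w; rewrite /line /avg -mulr_sumr mulrA. Qed.

Lemma line_idem x f : line x (line x f) = line x f.
Proof.
apply: funext => w; rewrite {1}/line /avg (eq_bigr (fun=> line x f w)); last first.
  by move=> y _; rewrite line_inv.
by rewrite sumr_const -(mulr_natr (line _ _ _)) mulfK.
Qed.

Lemma line_sym x f g : dot (line x f) g = dot f (line x g).
Proof.
rewrite /dot /line /avg.
under eq_bigr do rewrite mulrAC mulr_suml.
under [in RHS]eq_bigr do rewrite mulrA mulr_sumr.
rewrite -!mulr_suml; congr (_ / _); rewrite exchange_big [RHS]exchange_big /=.
rewrite [RHS](reindex_inj oppr_inj); apply: eq_bigr => y _.
rewrite [RHS](reindex_inj (addIr (y *: gam x))); apply: eq_bigr => w _.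
by rewrite scaleNr addrK.
Qed.

Lemma lineC x x' f : line x (line x' f) = line x' (line x f).
Proof.
apply: funext => w; rewrite /line /avg -!mulr_suml; congr (_ / _ / _).
rewrite exchange_big; apply: eq_bigr => y _; apply: eq_bigr => z _.
by rewrite addrAC.
Qed.

Lemma sum_line x f : \sum_w line x f w = \sum_w f w.
Proof.
rewrite /line /avg -mulr_suml exchange_big (eq_bigr (fun=> \sum_w f w)).
  by rewrite sumr_const -(mulr_natr (\sum__ _)) mulfK.
by move=> y _; rewrite [RHS](reindex_inj (addIr (y *: gam x))).
Qed.

Lemma pprod_line_inv s x f w y : x \in s -> pprod line s f (w + y *: gam x) = pprod line s f w.
Proof.
elim: s w => //= x' s IH w; rewrite inE => /orP[/eqP <-|xs]; first exact: line_inv.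
by congr (_ / _); apply: eq_bigr => z _; rewrite addrAC IH.
Qed.

(* The vectors [gam x], [x \in t], form a basis, so the iterated projection is
   invariant under all translations. *)
Lemma pprod_line0 (t : seq F) f : uniq t -> size t = m -> \sum_w f w = 0 ->
  pprod line t f = fun=> 0.
Proof.
move=> ut zt f0.
pose V : 'M[F]_m := Vandermonde m (\row_i t`_i).
have uV : V \in unitmx.
  rewrite unitmxE det_Vandermonde unitfE prodf_seq_neq0; apply/allP => i _; apply/implyP => _.
  rewrite prodf_seq_neq0; apply/allP => j _; apply/implyP => ij.
  by rewrite !mxE subr_eq0 nth_uniq ?zt // eq_sym ltn_eqF.
have inv w c : pprod line t f (w + c) = pprod line t f w.
  have -> : c = \sum_i (c *m invmx V^T) 0 i *: gam t`_i.
    rewrite -[LHS](mulmxKV (_ : V^T \in unitmx)) ?unitmx_tr //.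
    rewrite [LHS]mulmx_sum_row; apply: eq_bigr => i _; congr (_ *: _).
    by apply/rowP => j; rewrite !mxE.
  elim/big_rec: _ => [|i v _ IH]; first by rewrite addr0.
  by rewrite addrC -addrA addrC pprod_line_inv ?IH 1?addrC // mem_nth ?zt.
have c0 w : pprod line t f w = pprod line t f 0 by rewrite -[w]add0r inv.
apply: funext => w; rewrite c0; apply/eqP.
have : \sum_w pprod line t f w = 0.
  by elim: t {ut zt V uV inv c0} => //= x t; rewrite sum_line.
rewrite (eq_bigr (fun=> pprod line t f 0)) // sumr_const => /eqP.
by rewrite mulrn_eq0 => /orP[/eqP/card0_eq /(_ w)|].
Qed.

Definition moment_step (d : F * F) (w : W) : W := w + d.2 *: gam d.1.

(** The walk operator is the mean of [#|F|] commuting projections, any [m] of which annihilate a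
    function of sum zero, so [psum_bound] applies with [m - 1]. In terms of characters, an
    eigenvalue is the proportion of roots in [F] of a polynomial of degree below [m]; the
    projections give the same bound over the rationals. *)
Lemma moment_expander f : (0 < m)%N -> \sum_w f w = 0 ->
  nrm (fun w => avg (fun d => f (moment_step d w))) <= (m%:R / #|F|%:R) ^+ 2 * nrm f.
Proof.
move=> m0 f0.
have -> : (fun w => avg (fun d => f (moment_step d w))) =
    fun w => #|F|%:R^-1 * psum line (enum F) f w.
  apply: funext => w; rewrite /psum big_enum /= /line /avg -mulr_suml card_prod natrM invfM.
  rewrite mulrA [RHS]mulrC; congr (_ / _ / _).
  by rewrite (pair_bigA _ (fun x y => f (w + y *: gam x))).
rewrite nrmZ exprMn (mulrC (m%:R ^+ 2)) -[leRHS]mulrA ler_pM2l; last first.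
  by rewrite exprn_gt0 // invr_gt0 lt0r F0 ler0n.
have [_ h] := psum_bound lineD lineZ line_idem line_sym lineC (n := m.-1) (enum_uniq F)
   (fun t ut _ zt => pprod_line0 (f := f) ut (etrans zt (prednK m0)) f0).
apply: le_trans h _; rewrite ler_wpM2r ?nrm_ge0 // lerXn2r ?nnegrE ?ler0n //.
by rewrite ler_nat leq_pred.
Qed.

End MomentCurve.

Lemma sum_bij (X Y : finType) (h : X -> Y) (f : Y -> rat) : bijective h ->
  \sum_x f (h x) = \sum_y f y.
Proof. by move=> [h' hK h'K]; rewrite [RHS](reindex h) //; exists h' => ? _. Qed.

Lemma card_bij (X Y : finType) : #|X| = #|Y| -> exists (h : X -> Y) (h' : Y -> X),
  cancel h h' /\ cancel h' h.
Proof.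
move=> e; exists (fun x => enum_val (cast_ord e (enum_rank x))).
exists (fun y => enum_val (cast_ord (esym e) (enum_rank y))).
by split=> z; rewrite enum_valK ?cast_ordK ?cast_ordKV enum_rankK.
Qed.

(** With [D] the pairs of elements of a prime field [F], [q]-tuples of [D] are as numerous as
    vectors of [F^(2q)], so the expander is transported to tuples of its own labels. A prime above
    [2q / lam] gives the bound; [2 < #|D|] later leaves a label for each of the three moves. *)
Lemma expander_exists (q : nat) (lam : rat) : (0 < q)%N -> 0 < lam ->
  exists (D : finType) (g : D -> q.-tuple D -> q.-tuple D),
  [/\ (2 < #|D|)%N, forall d, injective (g d) &
   forall f : q.-tuple D -> rat, \sum_a f a = 0 ->
     nrm (fun a => avg (fun d => f (g d a))) <= lam ^+ 2 * nrm f].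
Proof.
move=> q0 l0.
have [p hp prp] := prime_above (Num.bound ((2 * q)%:R / lam) + 2).
pose F : finFieldType := 'F_p; have cF : #|F| = p := card_Fp prp.
pose D : finType := (F * F)%type.
have [h [h' [hK h'K]]] : exists (h : q.-tuple D -> 'rV[F]_(2 * q)) h', cancel h h' /\ cancel h' h.
  by apply: card_bij; rewrite card_tuple card_prod card_mx cF mul1n expnM mulnn.
exists D, (fun d a => h' (moment_step d (h a))); split.
- rewrite card_prod cF; apply: leq_trans (leq_pmulr _ (prime_gt0 prp)).
  by apply: leq_ltn_trans hp; rewrite leq_addl.
- by move=> d a a' /(can_inj h'K)/addIr/(can_inj hK).
move=> f f0.
have bh : bijective h by exists h'.
have bh' : bijective h' by exists h.
have := @moment_expander F (2 * q) (fun w => f (h' w)).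
rewrite (sum_bij f bh') muln_gt0 q0 => /(_ isT f0).
rewrite /nrm /dot -(sum_bij _ bh) (sum_bij (fun a => f a * f a) bh') => /le_trans; apply.
rewrite ler_wpM2r ?nrm_ge0 // lerXn2r ?nnegrE ?divr_ge0 ?ler0n ?(ltW l0) //.
have p0 : 0 < (#|F|%:R : rat) by rewrite ltr0n cF prime_gt0.
rewrite ler_pdivrMr // mulrC -ler_pdivrMr // ltW //.
apply: lt_trans (archi_boundP _) _; first by rewrite divr_ge0 ?ler0n ?ltW.
by rewrite ltr_nat cF; apply: leq_ltn_trans hp; rewrite leq_addr.
Qed.

(** * Averages and contractions *)

Section Averages.
Variables (I X : finType).
Hypothesis I0 : (0 < #|I|)%N.

Let n0 : #|I|%:R != 0 :> rat.
Proof. by rewrite pnatr_eq0 -lt0n. Qed.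

Lemma sum_const (c : rat) : \sum_(i : I) c = #|I|%:R * c.
Proof. by rewrite sumr_const mulr_natl. Qed.

Lemma avg_const (c : rat) : avg (fun _ : I => c) = c.
Proof. by rewrite /avg sumr_const -(mulr_natr c) mulfK. Qed.

Lemma avgD (F G : I -> rat) : avg (fun i => F i + G i) = avg F + avg G.
Proof. by rewrite /avg big_split mulrDl. Qed.

Lemma avgZ (c : rat) (F : I -> rat) : avg (fun i => c * F i) = c * avg F.
Proof. by rewrite /avg -mulr_sumr mulrA. Qed.

Lemma avg_mul (F : I -> rat) : \sum_i F i = #|I|%:R * avg F.
Proof. by rewrite mulrC divfK. Qed.

Lemma sum_avg_mul (F : I -> rat) : \sum_i avg F * F i = \sum_(i : I) avg F * avg F.
Proof.
rewrite sum_const -[LHS]mulr_sumr avg_mul; ring.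
Qed.

Lemma avg_sqr (F : I -> rat) : avg F ^+ 2 <= avg (fun i => F i ^+ 2).
Proof.
rewrite -subr_ge0 (_ : _ - _ = avg (fun i => (F i - avg F) ^+ 2)).
  by rewrite divr_ge0 ?ler0n // sumr_ge0 // => i _; exact: sqr_ge0.
rewrite (_ : (fun i => (F i - avg F) ^+ 2) =
    fun i => (F i ^+ 2 + (- 2 * avg F) * F i) + avg F ^+ 2).
  by rewrite !avgD avgZ avg_const; ring.
by apply: funext => i; ring.
Qed.

Lemma nrm_avg (S : I -> X -> X) (f : X -> rat) : (forall i, injective (S i)) ->
  nrm (fun x => avg (fun i => f (S i x))) <= nrm f.
Proof.
move=> injS; apply: le_trans (_ : \sum_x avg (fun i => f (S i x) ^+ 2) <= _).
  by apply: ler_sum => x _; rewrite -expr2 avg_sqr.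
rewrite -mulr_suml exchange_big ler_pdivrMr ?ltr0n // (eq_bigr (fun=> nrm f)).
  by rewrite sumr_const mulr_natr.
move=> i _; rewrite /nrm /dot [RHS](reindex_inj (injS i)).
by apply: eq_bigr => x _; rewrite expr2.
Qed.

End Averages.

Lemma nrm_convex (X : finType) (t : rat) (u v : X -> rat) : 0 <= t <= 1 ->
  nrm (fun x => (1 - t) * u x + t * v x) <= (1 - t) * nrm u + t * nrm v.
Proof.
move=> /andP[t0 t1]; rewrite /nrm /dot !mulr_sumr -big_split.
apply: ler_sum => x _ /=; rewrite -subr_ge0.
have -> : (1 - t) * (u x * u x) + t * (v x * v x) -
  ((1 - t) * u x + t * v x) * ((1 - t) * u x + t * v x) = t * (1 - t) * (u x - v x) ^+ 2.
  by ring.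
by rewrite mulr_ge0 ?sqr_ge0 // mulr_ge0 ?subr_ge0.
Qed.

(** Orthogonality to the indicator of each fibre of [cmp], the functions that a walk preserving
    [cmp] leaves fixed. *)
Definition balanced (X : finType) (T : eqType) (cmp : X -> T) (f : X -> rat) :=
  forall c, \sum_(x | cmp x == c) f x = 0.

(* [mu] bounds the square of the second singular value of the random walk. *)
Definition has_gap (X K : finType) (T : eqType) (cmp : X -> T) (P : K -> X -> X) (mu : rat) :=
  forall f, balanced cmp f -> nrm (fun x => avg (fun b => f (P b x))) <= mu * nrm f.

(** * One level of derandomized powering *)

Section Step.
Variables (D X : finType) (T : eqType) (p : nat) (cmp : X -> T).
Notation K := (p.+1.-tuple D).
Variables (g : D -> K -> K) (P : K -> X -> X) (lam mu : rat).
Hypothesis D0 : (0 < #|D|)%N.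
Hypothesis injg : forall d, injective (g d).
Hypothesis expg : forall f : K -> rat, \sum_a f a = 0 ->
  nrm (fun a => avg (fun d => f (g d a))) <= lam ^+ 2 * nrm f.
Hypothesis lam01 : 0 < lam < 1.
Hypothesis injP : forall a, injective (P a).
Hypothesis cmpP : forall a x, cmp (P a x) = cmp x.
Hypothesis mu01 : 0 <= mu <= 1.
Hypothesis gapP : has_gap cmp P mu.

Definition zstep (z : X * K) (d : D) : X * K := (P z.2 z.1, g d z.2).
Definition walk (b : seq D) (z : X * K) : X * K := foldl zstep z b.

Let K0 : (0 < #|{: K}|)%N.
Proof. by rewrite card_tuple expn_gt0 D0. Qed.

Implicit Types f : X * K -> rat.
(** [B] changes the label by the expander, [A] moves the vertex along its label, [J] averages the
    label out, and a step of the walk is [U f = A (B f)]. [C] is what remains of [B] once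
    [(1 - lam) * J] is removed and the rest is divided by [lam]. *)
Let B f z := avg (fun d => f (z.1, g d z.2)).
Let A f (z : X * K) := f (P z.2 z.1, z.2).
Let J f (z : X * K) := avg (fun a : K => f (z.1, a)).
Let U f z := avg (fun d => f (zstep z d)).
Let C f z := J f z + lam^-1 * B (fun w => f w + (-1) * J f w) z.

Let bal f := balanced (fun z : X * K => cmp z.1) f.

Let injzstep d : injective (zstep^~ d).
Proof. by move=> [x a] [x' a'] [/= e /injg ea]; move: e; rewrite ea => /injP ->. Qed.

Let nrmA f : nrm (A f) = nrm f.
Proof.
rewrite /nrm /dot [RHS](reindex_inj (h := fun z : X * K => (P z.2 z.1, z.2))) //.
by move=> [x a] [x' a'] [/= e ea]; move: e; rewrite ea => /injP ->.
Qed.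

Let nrmU p' f : nrm (iter p' U f) <= nrm f.
Proof.
elim: p' => [|p' IH] //=; apply: le_trans IH.
exact: (@nrm_avg _ _ D0 (fun d z => zstep z d) (iter p' U f) injzstep).
Qed.

Let sum_pair f : \sum_z f z = \sum_x \sum_a f (x, a).
Proof. by rewrite (pair_bigA _ (fun x a => f (x, a))); apply: eq_bigr => -[]. Qed.

Let nrmJ f : nrm f = nrm (J f) + nrm (fun z => f z + (-1) * J f z).
Proof.
rewrite nrmD nrmZ sqrrN expr1n mul1r dotC dotZl.
have -> : dot (J f) f = nrm (J f).
  rewrite /nrm /dot !sum_pair; apply: eq_bigr => x _.
  exact: (sum_avg_mul K0 (fun a => f (x, a))).
by rewrite mulr2n; ring.
Qed.

Let sum_compl f x : \sum_a (f (x, a) + (-1) * J f (x, a)) = 0.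
Proof.
pose F (a : K) := f (x, a).
suff : \sum_a (F a + (-1) * avg F) = 0 by [].
have e : \sum_(a : K) -1 * avg F = #|{: K}|%:R * (-1 * avg F) by exact: sum_const.
rewrite big_split /= e (avg_mul K0); ring.
Qed.

(** [J f] is kept, and on its orthogonal complement [B] contracts by [lam], which the factor
    [lam^-1] exactly undoes. *)
Let nrmC f : nrm (C f) <= nrm f.
Proof.
rewrite /C nrmD nrmZ; set h := fun w => f w + _.
have -> : dot (J f) (fun z => lam^-1 * B h z) = 0.
  rewrite dotC dotZl dotC /dot sum_pair big1 ?mulr0 // => x _.
  rewrite -[LHS]/(\sum_a avg (fun a' => f (x, a')) * B h (x, a)) -[LHS]mulr_sumr.
  have -> : \sum_a B h (x, a) = 0; last by rewrite mulr0.
  rewrite /B -[LHS]mulr_suml exchange_big /= big1 ?mul0r // => d _.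
  by rewrite -[RHS](sum_compl f x) [RHS](reindex_inj (@injg d)).
rewrite mul0rn addr0 [leRHS]nrmJ lerD2l exprVn ler_pdivrMl ?exprn_gt0 //; last first.
  by case/andP: lam01.
rewrite /nrm /dot !sum_pair mulr_sumr; apply: ler_sum => x _.
exact: (expg (sum_compl f x)).
Qed.

(* Derandomized squaring: the expander step is a convex combination of the full
   average over labels and of a contraction. *)
Let B_split f : B f = fun z => (1 - lam) * J f z + lam * C f z.
Proof.
apply: funext => z; rewrite /C /B avgD avgZ.
have -> : avg (fun d => J f (z.1, g d z.2)) = J f z by exact: (avg_const D0 (J f z)).
have l0 : lam != 0 by case/andP: lam01 => /lt0r_neq0.
by rewrite mulrDr mulVKf //; ring.
Qed.

Let iterU_comb p' (s t : rat) f1 f2 :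
  iter p' U (A (fun z => s * f1 z + t * f2 z)) =
  fun z => s * iter p' U (A f1) z + t * iter p' U (A f2) z.
Proof.
by elim: p' => //= p' ->; apply: funext => z; rewrite /U avgD !avgZ.
Qed.

(** A closed form dominating the recursion with value 1 at 0 and successor
    [(1 - lam) * mu * r + lam]: a step gains the factor [mu], except on the part of weight [lam] on
    which only contraction is known. *)
Let r p' := 1 - (1 - lam) ^+ p' * (1 - mu ^+ p').

Let r_rec p' : (1 - lam) * (r p' * mu) + lam <= r p'.+1.
Proof.
rewrite /r !exprS -subr_ge0.
case/andP: lam01 => l0 l1; case/andP: mu01 => m0 m1.
have a0 : 0 <= (1 - lam) ^+ p' by rewrite exprn_ge0 // subr_ge0 ltW.
have a1 : (1 - lam) ^+ p' <= 1 by rewrite exprn_ile1 //; lra.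
move: ((1 - lam) ^+ p') (mu ^+ p') a0 a1 => a m a0 a1.
have -> : 1 - (1 - lam) * a * (1 - mu * m) - ((1 - lam) * ((1 - a * (1 - m)) * mu) + lam)
  = (1 - lam) * (1 - mu) * (1 - a) by ring.
by rewrite !mulr_ge0 // subr_ge0 // ltW.
Qed.

Let r_ge0 p' : 0 <= r p'.
Proof.
case/andP: lam01 => l0 l1; case/andP: mu01 => m0 m1.
have a0 : 0 <= (1 - lam) ^+ p' by rewrite exprn_ge0 // subr_ge0 ltW.
have a1 : (1 - lam) ^+ p' <= 1 by rewrite exprn_ile1 //; lra.
have b0 : 0 <= mu ^+ p' by exact: exprn_ge0.
have b1 : mu ^+ p' <= 1 by exact: exprn_ile1.
by rewrite /r subr_ge0 mulr_ile1 //; lra.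
Qed.

Let lam_le1 : 0 <= 1 - lam.
Proof. by case/andP: lam01 => _ /ltW; rewrite subr_ge0. Qed.

Let nrm_step p' f : nrm (iter p' U (A (B f))) <=
  (1 - lam) * nrm (iter p' U (A (J f))) + lam * nrm f.
Proof.
case/andP: lam01 => l0 l1.
rewrite B_split iterU_comb; apply: le_trans (nrm_convex _ _ _) _; first by rewrite !ltW.
rewrite lerD2l ler_wpM2l ?(ltW l0) //.
by apply: (le_trans (nrmU p' (A (C f)))); rewrite nrmA nrmC.
Qed.

(** The last step is peeled off. As [f] ignores the label, averaging the label of that step gives
    again a function of the vertex alone, and [gapP] yields a factor [mu]. In the base case a single
    step with a given label remains: it is a permutation and gains nothing. *)
Let nrm_iter p' f (phi : X -> rat) : balanced cmp phi -> f = (fun z => phi z.1) ->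
  nrm (iter p' U (A f)) <= r p' * nrm f.
Proof.
elim: p' f phi => [|p' IH] f phi hb ef.
  by rewrite /r !expr0 subrr mulr0 subr0 mul1r /= nrmA.
rewrite iterSr -[U (A f)]/(A (B (A f))); apply: le_trans (nrm_step _ _) _.
pose psi x := avg (fun a : K => phi (P a x)).
have eJ : J (A f) = fun z => psi z.1 by rewrite ef.
have nK (h : X -> rat) : nrm (fun z : X * K => h z.1) = #|{: K}|%:R * nrm h.
  rewrite /nrm /dot sum_pair mulr_sumr; apply: eq_bigr => x _.
  exact: (sum_const _ (h x * h x)).
have hpsi : balanced cmp psi.
  move=> c; rewrite /psi /avg -mulr_suml exchange_big big1 ?mul0r // => a _ /=.
  rewrite -[RHS](hb c) [RHS](reindex_inj (@injP a)); apply: eq_bigl => x.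
  by rewrite cmpP.
have h1 := IH _ _ hpsi eJ.
have h2 : nrm (J (A f)) <= mu * nrm f.
  by rewrite eJ ef !nK mulrCA ler_wpM2l ?ler0n // gapP.
rewrite nrmA; apply: le_trans (_ : ((1 - lam) * (r p' * mu) + lam) * nrm f <= _).
  rewrite [leRHS]mulrDl lerD2r -mulrA ler_wpM2l ?lam_le1 //.
  by apply: le_trans h1 _; rewrite -mulrA ler_wpM2l ?r_ge0.
by rewrite ler_wpM2r ?nrm_ge0 ?r_rec.
Qed.

Lemma avg_cons n (F : n.+1.-tuple D -> rat) :
  avg F = avg (fun d => avg (fun t : n.-tuple D => F [tuple of d :: t])).
Proof.
rewrite /avg -[X in _ = X / _]mulr_suml !card_tuple expnS natrM invfM (mulrC #|D|%:R^-1).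
rewrite mulrA; congr (_ / _ / _).
rewrite (pair_bigA _ (fun d (t : n.-tuple D) => F [tuple of d :: t])) /=.
rewrite (reindex (fun z : D * n.-tuple D => [tuple of z.1 :: z.2])) //=.
exists (fun t : n.+1.-tuple D => (thead t, [tuple of behead t])) => [[d t] _|t _] /=.
  by congr (_, _); apply: val_inj.
by rewrite -tuple_eta.
Qed.

Lemma avg_foldl n f z : avg (fun b : n.-tuple D => f (foldl zstep z b)) = iter n U f z.
Proof.
elim: n z => [|n IH] z /=.
  rewrite (_ : (fun b : 0.-tuple D => _) = fun=> f z) ?avg_const ?card_tuple //.
  by apply: funext => b; rewrite tuple0.
rewrite avg_cons; congr (_ / _); apply: eq_bigr => d _.
by rewrite -IH.
Qed.

(** A function of the label too must first be averaged by the last expander move. So [B] is split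
    [p.+1] times, while only [p] of the [p.+1] vertex moves gain [mu]: this explains the two
    exponents. *)
Lemma gap_step : has_gap (fun z : X * K => cmp z.1) (fun (b : K) z => walk b z)
  (1 - (1 - lam) ^+ p.+1 * (1 - mu ^+ p)).
Proof.
move=> f hf; rewrite (_ : (fun x => _) = iter p.+1 U f); last first.
  by apply: funext => z; exact: avg_foldl.
rewrite iterSr -[U f]/(A (B f)); apply: le_trans (nrm_step _ _) _.
have hJ : balanced cmp (fun x => avg (fun a : K => f (x, a))).
  move=> c; have e : \sum_(x | cmp x == c) \sum_(a : K) f (x, a) = 0.
    rewrite -[RHS](hf c).
    rewrite (pair_big_dep (fun x => cmp x == c) (fun _ _ => true) (fun x a => f (x, a))).
    by apply: eq_big => [[x a]|[x a]] //=; rewrite andbT.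
  by rewrite /avg -mulr_suml e mul0r.
have h1 := nrm_iter p hJ (erefl : J f = _).
have h2 : nrm (J f) <= nrm f by rewrite [leRHS]nrmJ lerDl nrm_ge0.
have -> : 1 - (1 - lam) ^+ p.+1 * (1 - mu ^+ p) = (1 - lam) * r p + lam.
  by rewrite /r exprS; ring.
rewrite [leRHS]mulrDl lerD2r -mulrA ler_wpM2l ?lam_le1 //.
by apply: le_trans h1 _; rewrite ler_wpM2l.
Qed.

End Step.

Lemma has_gap_le (X K : finType) (T : eqType) (cmp : X -> T) (P : K -> X -> X) mu mu' :
  mu <= mu' -> has_gap cmp P mu -> has_gap cmp P mu'.
Proof. by move=> h H f /H/le_trans; apply; rewrite ler_wpM2r ?nrm_ge0. Qed.

Lemma sqr_diff_bound (a b A : rat) : a ^+ 2 + b ^+ 2 <= 5 * A -> (a - b) ^+ 2 <= 10 * A.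
Proof. by have := sqr_ge0 (a + b); rewrite !expr2; lra. Qed.

(** Cauchy-Schwarz along a path of [t + 1] edges, in an inductive form free of square roots. *)
Lemma sqr_sum_bound (t a c d : rat) : 0 < t -> c ^+ 2 <= t ^+ 2 * d -> a ^+ 2 <= d ->
  (a + c) ^+ 2 <= (t + 1) ^+ 2 * d.
Proof.
move=> t0 h1 h2; rewrite -(ler_pM2l t0).
have h3 : 0 <= (c - t * a) ^+ 2 by exact: sqr_ge0.
have h4 : (t + 1) * c ^+ 2 <= (t + 1) * (t ^+ 2 * d) by rewrite ler_wpM2l // addr_ge0 // ltW.
have h5 : t * (t + 1) * a ^+ 2 <= t * (t + 1) * d.
  by rewrite ler_wpM2l // mulr_ge0 ?addr_ge0 // ltW.
move: h3 h4 h5; rewrite !expr2 => h3 h4 h5.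
have -> : t * ((a + c) * (a + c)) = (t + 1) * (c * c) + t * (t + 1) * (a * a) -
  (c - t * a) * (c - t * a) by ring.
have -> : t * ((t + 1) * (t + 1) * d) = (t + 1) * (t * t * d) + t * (t + 1) * d by ring.
by lra.
Qed.

Lemma sqr_opp_bound (a b : rat) : a * b <= 0 -> a ^+ 2 <= (a - b) ^+ 2.
Proof. by have := sqr_ge0 b; rewrite !expr2; lra. Qed.

(** * Numerical constants of the amplification *)

Section Amplification.
Variables (G p : nat).
Hypothesis hp : p = (70 * G)%N.
Hypothesis G0 : (0 < G)%N.
Let lam : rat := (64 * p.+1)%:R^-1.

Lemma lam01 : 0 < lam < 1.
Proof.
rewrite /lam invr_gt0 ltr0n muln_gt0 /= invf_lt1 ?ltr0n ?muln_gt0 // ltr1n.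
by apply: leq_trans (leq_pmulr _ _).
Qed.

Lemma lam_pow : 63 / 64 <= (1 - lam) ^+ p.+1.
Proof.
have bern n : 1 - n%:R * lam <= (1 - lam) ^+ n.
  case/andP: lam01 => l0 l1.
  elim: n => [|n IH]; first by rewrite mul0r subr0 expr0.
  rewrite exprS; apply: le_trans (_ : (1 - lam) * (1 - n%:R * lam) <= _).
    have : 0 <= n%:R * (lam * lam) by rewrite mulr_ge0 ?ler0n ?mulr_ge0 // ltW.
    by rewrite -natr1; lra.
  by rewrite ler_wpM2l // subr_ge0 ltW.
apply: le_trans (bern p.+1).
have -> : p.+1%:R * lam = 64^-1.
  have : p.+1%:R != 0 :> rat by rewrite pnatr_eq0.
  by rewrite /lam natrM; move: (p.+1%:R : rat) => t t0; field.
by lra.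
Qed.

(** By Bernoulli [(1 - m)^p <= 1 / (1 + p m)]. If [p m >= 63], the right side is at least
    [(63/64)^2], above 15/16. Otherwise [1 - (1 - m)^p >= p m / 64], and [p = 70 G] suffices because
    [70 * 63 > 64^2]. *)
Lemma amplify (m : rat) : 0 < m <= 15 / 16 ->
  Num.min (15 / 16) (G%:R * m) <= (1 - lam) ^+ p.+1 * (1 - (1 - m) ^+ p).
Proof.
move=> /andP[m0 m1].
have pm0 : 0 <= p%:R * m by rewrite mulr_ge0 ?ler0n ?ltW.
have h1 : (1 - m) ^+ p * (1 + p%:R * m) <= 1.
  have bern n : 1 + n%:R * m <= (1 + m) ^+ n.
    elim: n => [|n IH]; first by rewrite mul0r addr0 expr0.
    rewrite exprS; apply: le_trans (_ : (1 + m) * (1 + n%:R * m) <= _).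
      have : 0 <= n%:R * (m * m) by rewrite mulr_ge0 ?ler0n ?mulr_ge0 // ltW.
      by rewrite -natr1; lra.
    by rewrite ler_wpM2l // addr_ge0 // ltW.
  apply: le_trans (_ : (1 - m) ^+ p * (1 + m) ^+ p <= _).
    by rewrite ler_wpM2l // exprn_ge0 // subr_ge0; lra.
  rewrite -exprMn exprn_ile1 //.
    by rewrite mulr_ge0; lra.
  have : 0 <= m * m by rewrite mulr_ge0 // ltW.
  by lra.
have m01 : 0 <= 1 - m <= 1 by move: m0 m1; lra.
have e0 : 0 <= (1 - m) ^+ p by case/andP: m01 => h _; exact: exprn_ge0.
have e1 : (1 - m) ^+ p <= 1 by case/andP: m01 => h h'; exact: exprn_ile1.
have hL := lam_pow; move: ((1 - lam) ^+ p.+1) ((1 - m) ^+ p) hL h1 e0 e1 => L e hL h1 e0 e1.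
have pG : p%:R = 70 * G%:R :> rat by rewrite hp natrM.
have g1 : 1 <= G%:R :> rat by rewrite ler1n.
have e1' : 0 <= 1 - e by rewrite subr_ge0.
apply: le_trans (ler_wpM2r e1' hL).
rewrite ge_min; have [h63|h63] := leP 63 (p%:R * m).
  by apply/orP; left; nra.
apply/orP; right.
have : p%:R * m <= 64 * (1 - e) by nra.
by rewrite pG; nra.
Qed.

End Amplification.

(** * Polynomial gap of the base graph *)

Section BaseGap.
Variables (X K : finType) (T : eqType) (cmp : X -> T) (O : finType) (o0 : O).
Variables (sg : O -> X -> X) (op : K -> O).
Hypothesis sg_inj : forall o, injective (sg o).
Hypothesis sg0 : forall x, sg o0 x = x.
Hypothesis op_count : forall o, (#|K| <= 5 * #|[pred b | op b == o]|)%N.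
Hypothesis K0 : (0 < #|K|)%N.
Hypothesis conn : forall x y, cmp x = cmp y ->
  connect (fun x y => [exists o, y == sg o x]) x y.
Let N : rat := #|X|%:R.
Let P b x := sg (op b) x.

(** Each move owns at least a fifth of the labels, so the deviations of both [v o0] and [v o] from
    the mean weigh in the variance. The constant 10 is this 5 times the 2 of
    [(a - b)^2 <= 2 (a^2 + b^2)]. *)
Lemma variance (F : K -> rat) (c : rat) (v : O -> rat) (o : O) : F =1 v \o op ->
  (v o0 - v o) ^+ 2 <= 10 * (avg (fun b => F b ^+ 2) - avg F ^+ 2).
Proof.
move=> eF; have [->|ne] := eqVneq o o0.
  by rewrite subrr expr0n mulr_ge0 // subr_ge0 avg_sqr.
set m := avg F.
have -> : avg (fun b => F b ^+ 2) - m ^+ 2 = avg (fun b => (F b - m) ^+ 2).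
  rewrite (_ : (fun i => (F i - m) ^+ 2) = fun i => (F i ^+ 2 + (- 2 * m) * F i) + m ^+ 2).
    by rewrite !avgD avgZ avg_const // -/m; ring.
  by apply: funext => i; ring.
have k0 : 0 < (#|K|%:R : rat) by rewrite ltr0n.
have h o' : (v o' - m) ^+ 2 <= 5 / #|K|%:R * \sum_(b | op b == o') (F b - m) ^+ 2.
  rewrite (eq_bigr (fun=> (v o' - m) ^+ 2)); last by move=> b /eqP <-; rewrite eF.
  rewrite sumr_const -[X in _ <= _ * X]mulr_natl mulrA ler_peMl ?sqr_ge0 //.
  rewrite mulrAC ler_pdivlMr // mul1r -natrM ler_nat; exact: op_count.
have hs : \sum_(b | op b == o0) (F b - m) ^+ 2 + \sum_(b | op b == o) (F b - m) ^+ 2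
    <= \sum_b (F b - m) ^+ 2.
  rewrite [leRHS](bigID (fun b => op b == o0)) /= lerD2l.
  rewrite [leRHS](bigID (fun b => op b == o)) /=.
  rewrite (eq_bigl (fun b => (op b != o0) && (op b == o))) ?lerDl; last first.
    by move=> b; apply/eqP/andP => [->|[_ /eqP]].
  by apply: sumr_ge0 => b _; exact: sqr_ge0.
have h1 := h o0; have h2 := h o.
have h3 : (v o0 - m) ^+ 2 + (v o - m) ^+ 2 <= 5 * avg (fun b => (F b - m) ^+ 2).
  apply: le_trans (lerD h1 h2) _; rewrite -mulrDr -mulrA ler_wpM2l //.
  by rewrite mulrC ler_wpM2r ?invr_ge0 ?ler0n.
have -> : v o0 - v o = (v o0 - m) - (v o - m) by ring.
exact: sqr_diff_bound h3.
Qed.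

(* A balanced [f] changes sign on each component, hence varies a lot along some
   edge of a path of length at most [N]. *)
Lemma base_gap : has_gap cmp P (1 - (10 * N ^+ 3)^-1).
Proof.
move=> f hf.
set del := nrm f - nrm (fun x => avg (fun b => f (P b x))).
have hdel : del = \sum_x (avg (fun b => f (P b x) ^+ 2) - avg (fun b => f (P b x)) ^+ 2).
  rewrite /del sumrB; congr (_ - _).
  rewrite -mulr_suml exchange_big /= (eq_bigr (fun=> nrm f)).
    by rewrite sumr_const -(mulr_natr (nrm f)) mulfK // pnatr_eq0 -lt0n.
  move=> b _; rewrite /nrm /dot [RHS](reindex_inj (@sg_inj (op b))).
  by apply: eq_bigr => x _; rewrite expr2.
(* Since [o0] stays in place, the variance at [x] compares [f x] itself with its value after any
   move. *)
have edge x o : (f x - f (sg o x)) ^+ 2 <= 10 * del.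
  have := @variance (fun b => f (P b x)) 0 (fun o => f (sg o x)) o (fun=> erefl).
  rewrite sg0 => /le_trans; apply; rewrite ler_wpM2l // hdel (bigD1 x) //= lerDl.
  by apply: sumr_ge0 => y _; rewrite subr_ge0 avg_sqr.
have del0 : 0 <= del by rewrite hdel sumr_ge0 // => x _; rewrite subr_ge0 avg_sqr.
have pathb x s : path (fun x y => [exists o, y == sg o x]) x s ->
    (f x - f (last x s)) ^+ 2 <= (size s)%:R ^+ 2 * (10 * del).
  elim: s x => [|y s IH] x /=; first by rewrite subrr expr0n mul0r.
  move=> /andP[/existsP[o /eqP ->] /IH h1]; have h2 := edge x o.
  set a := f _ - f _ in h2; set c := f _ - f _ in h1.
  have -> : f x - f (last (sg o x) s) = a + c by rewrite /a /c; ring.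
  move: h1 h2; rewrite -(natr1 (size s)); case: (size s) => [|k].
    rewrite mulr0n expr0n /= mul0r add0r expr1n mul1r => h1.
    by have -> : c = 0 by [apply/eqP; rewrite -sqrf_eq0 eq_le h1 sqr_ge0]; rewrite addr0.
  by move=> h1 h2; apply: sqr_sum_bound h1 h2; rewrite ltr0n.
have ptb x : f x ^+ 2 <= N ^+ 2 * (10 * del).
  have [y cy fy] : exists2 y, cmp y == cmp x & f x * f y <= 0.
    apply/exists_inP; rewrite -[X in is_true X]negbK negb_exists_in; apply/negP => /forall_inP h.
    have := hf (cmp x); move/(congr1 ( *%R (f x))); rewrite mulr0 mulr_sumr => /eqP.
    rewrite psumr_eq0 => [|y /h]; last by rewrite -ltNge => /ltW.
    move=> /allP /(_ x (mem_index_enum _)); rewrite eqxx /= => h0.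
    by have := h x (eqxx _); rewrite (eqP h0) lexx.
  have /connectP[s hs ly] := conn (esym (eqP cy)).
  move: (hs) ly; case/shortenP: hs => s' hs' us' _ _ ly.
  have := pathb _ _ hs'; rewrite -ly => h.
  apply: le_trans (_ : (f x - f y) ^+ 2 <= _).
    exact: sqr_opp_bound.
  apply: le_trans h _; rewrite ler_wpM2r ?mulr_ge0 //.
  rewrite lerXn2r ?nnegrE ?ler0n // ler_nat.
  have := card_uniqP us'; rewrite /= => h; apply: ltnW; rewrite -h; exact: max_card.
(* A factor [N ^ 2] comes from the length of the paths, and one more [N] from the sum over the
   vertices. *)
have hn : nrm f <= 10 * N ^+ 3 * del.
  apply: le_trans (_ : \sum_(x : X) N ^+ 2 * (10 * del) <= _).
    by apply: ler_sum => x _; rewrite -expr2.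
  by rewrite sumr_const -[leLHS]mulr_natl -/N (_ : N * _ = 10 * N ^+ 3 * del) //; ring.
suff h : (10 * N ^+ 3)^-1 * nrm f <= del by rewrite mulrBl mul1r lerBrDr -lerBrDl.
have [N0|N0] := eqVneq N 0; first by rewrite N0 expr0n mulr0 invr0 mul0r.
by rewrite ler_pdivrMl // mulr_gt0 // exprn_gt0 // lt0r N0 ler0n.
Qed.

End BaseGap.

(** * The tower of levels and covering of components *)

Section Tower.
Variables (D X : finType) (T : eqType) (cmp : X -> T) (G p : nat).
Notation K := (p.+1.-tuple D).
Variables (g : D -> K -> K) (pi : K -> X -> X) (d0 lam th : rat).
Hypothesis G0 : (0 < G)%N.
Hypothesis lam01 : 0 < lam < 1.
Hypothesis th0 : 0 < th.
Hypothesis th1 : th <= 1.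
Hypothesis amplify : forall m, 0 < m <= th ->
  Num.min th (G%:R * m) <= (1 - lam) ^+ p.+1 * (1 - (1 - m) ^+ p).
Hypothesis D0 : (0 < #|D|)%N.
Hypothesis injg : forall d, injective (g d).
Hypothesis expg : forall f : K -> rat, \sum_a f a = 0 ->
  nrm (fun a => avg (fun d => f (g d a))) <= lam ^+ 2 * nrm f.
Hypothesis injpi : forall a, injective (pi a).
Hypothesis cmppi : forall a x, cmp (pi a x) = cmp x.
Hypothesis d0_gt0 : 0 < d0.
Hypothesis gap0 : has_gap cmp pi (1 - d0).

(** A vertex of level [i] consists of a vertex of [X] and the current labels of the [i] lower
    levels. *)
Fixpoint Vt (i : nat) : finType := if i is j.+1 then (Vt j * K)%type else X.

(* A step of level [j.+1] makes [p.+1] steps of level [j], whose label is changed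
   by the expander [g] after each of them. *)
Fixpoint Pt (i : nat) : K -> Vt i -> Vt i :=
  match i with
  | 0 => pi
  | j.+1 => fun b z => walk g (@Pt j) b z
  end.

Fixpoint base (i : nat) : Vt i -> X :=
  match i with
  | 0 => id
  | j.+1 => fun z => base z.1
  end.

Lemma Pt_inj i b : injective (@Pt i b).
Proof.
elim: i b => [|i IH] b; first exact: injpi.
rewrite /= /walk; elim: (tval b) => //= d s IHs; apply: inj_comp IHs _.
by move=> [x a] [x' a'] [/= e /injg ea]; move: e; rewrite ea => /IH ->.
Qed.

Lemma Pt_cmp i b z : cmp (base (@Pt i b z)) = cmp (base z).
Proof.
elim: i b z => [|i IH] b z; first exact: cmppi.
rewrite /= /walk; elim: (tval b) z => //= d s IHs z.
by rewrite IHs /= IH.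
Qed.

Lemma tower_gap i :
  has_gap (fun z : Vt i => cmp (base z)) (@Pt i) (1 - Num.min (th) (G%:R ^+ i * d0)).
Proof.
elim: i => [|i IH].
  by apply: has_gap_le gap0; rewrite expr0 mul1r lerD2l lerN2 ge_min lexx orbT.
set m := Num.min _ _ in IH.
have m0 : 0 < m by rewrite lt_min th0 mulr_gt0 ?exprn_gt0 ?ltr0n.
have m1 : m <= th by rewrite ge_min lexx.
have h : 0 <= 1 - m <= 1.
  by rewrite subr_ge0 gerBl (ltW m0) (le_trans m1).
have := gap_step D0 injg expg lam01 (@Pt_inj i) (@Pt_cmp i) h IH.
apply: has_gap_le; rewrite lerD2l lerN2.
apply: le_trans (amplify (m := m) _); last by rewrite m0.
rewrite le_min ge_min lexx /= /m minr_pMr ?ler0n // le_min exprS -mulrA !ge_min lexx orbT andbT.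
by apply/orP; left; rewrite ler_peMl ?ler1n // ltW.
Qed.

Lemma sum_base i (h : X -> rat) : \sum_(z : Vt i) h (base z) = #|{: K}|%:R ^+ i * \sum_x h x.
Proof.
elim: i => [|i IH]; first by rewrite expr0 mul1r.
rewrite exprS -mulrA -IH mulr_sumr.
rewrite -(pair_bigA _ (fun z (_ : K) => h (base z))) /=.
by apply: eq_bigr => z _; rewrite sum_const.
Qed.

Let M i (f : Vt i -> rat) z := avg (fun b => f (Pt b z)).

Lemma iterM_const i t (f : Vt i -> rat) z c :
  (forall bs : seq K, size bs = t -> f (foldl (fun z b => Pt b z) z bs) = c) ->
  iter t (@M i) f z = c.
Proof.
elim: t z => [|t IH] z h; first exact: (h [::]).
rewrite /= /M (_ : (fun b => _) = fun=> c); first by rewrite avg_const // card_tuple expn_gt0 D0.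
by apply: funext => b; apply: IH => bs zt; rewrite -(h (b :: bs)) /= ?zt.
Qed.

Lemma iterM_nrm i t (f : Vt i -> rat) mu : 0 <= mu ->
  has_gap (fun z : Vt i => cmp (base z)) (@Pt i) mu ->
  balanced (fun z : Vt i => cmp (base z)) f -> nrm (iter t (@M i) f) <= mu ^+ t * nrm f.
Proof.
move=> mu0 hg; elim: t f => [|t IH] f hf; first by rewrite expr0 mul1r.
rewrite iterSr exprSr -mulrA; apply: le_trans (IH _ _) _.
  move=> c; rewrite /M /avg -mulr_suml exchange_big big1 ?mul0r // => b _ /=.
  rewrite -[RHS](hf c) [RHS](reindex_inj (@Pt_inj i b)).
  by apply: eq_bigl => z; rewrite Pt_cmp.
by rewrite ler_wpM2l ?exprn_ge0 // hg.
Qed.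

(** Let [phi] be the point mass at [y] minus the uniform weight on its component, of size [c]. If no
    walk from above [x0] ended above [y], the [w]-fold average of [phi] would be [- 1/c] at all the
    [#|K| ^ w] points above [x0]. The gap bounds its squared norm by [(1 - th) ^ w * #|K| ^ w],
    which contradicts [hN] as [c <= #|X|]. *)
Lemma cover w x0 y : cmp x0 = cmp y -> th <= G%:R ^+ w * d0 ->
  #|X|%:R ^+ 2 * (1 - th) ^+ w < 1 ->
  exists z : Vt w, exists2 bs : seq K, size bs = w &
    base z = x0 /\ base (foldl (fun z b => Pt b z) z bs) = y.
Proof.
move=> exy hw hN.
case: (boolP [exists z : Vt w, exists bs : w.-tuple K,
    (base z == x0) && (base (foldl (fun z b => Pt b z) z bs) == y)]).
  move=> /existsP[z /existsP[bs /andP[/eqP h1 /eqP h2]]].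
  by exists z; exists bs; rewrite ?size_tuple.
rewrite negb_exists => /forallP hno.
have far (z : Vt w) bs : base z = x0 -> size bs = w -> base (foldl (fun z b => Pt b z) z bs) != y.
  move=> ez /eqP zb; have := hno z; rewrite negb_exists => /forallP/(_ (Tuple zb)).
  by rewrite ez eqxx.
pose c : rat := #|[pred v | cmp v == cmp y]|%:R.
have c0 : 0 < c by rewrite ltr0n; apply/card_gt0P; exists y; rewrite inE eqxx.
pose phi v : rat := (v == y)%:R - (cmp v == cmp y)%:R / c.
have bphi : balanced cmp phi.
  move=> t; rewrite sumrB -mulr_suml.
  have [et|ne] := eqVneq t (cmp y).
    rewrite et (bigD1 y) //= eqxx big1 ?addr0 => [|v /andP[_ /negPf ->] //].
    rewrite (eq_bigr (fun=> 1)); last by move=> v ->.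
    by rewrite sumr_const divff ?subrr // gt_eqF.
  rewrite !big1 ?mul0r ?subr0 // => v /eqP ev.
    by rewrite ev (negPf ne).
  by case: eqP => // evy; rewrite -ev evy eqxx in ne.
have bal : balanced (fun z : Vt w => cmp (base z)) (fun z => phi (base z)).
  move=> t; rewrite big_mkcond (sum_base w (fun v => if cmp v == t then phi v else 0)).
  by rewrite -big_mkcond bphi mulr0.
have nphi : nrm phi <= 1.
  pose u v : rat := (cmp v == cmp y)%:R / c.
  (* [phi] is orthogonal to the uniform weight [u], and their sum is the point mass at [y], of norm
     1. *)
  have e1 : nrm (fun v => phi v + u v) = 1.
    rewrite /nrm /dot (bigD1 y) //= big1 => [|v /negPf ne]; rewrite /phi /u subrK ?eqxx ?ne.
      by rewrite mulr1 addr0.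
    by rewrite mulr0.
  rewrite -e1 nrmD (_ : dot phi u = 0) ?mul0rn ?addr0 ?lerDl ?nrm_ge0 //.
  rewrite /dot /u (eq_bigr (fun v => (if cmp v == cmp y then phi v else 0) * c^-1)).
    by rewrite -mulr_suml -big_mkcond bphi mul0r.
  by move=> v _; case: eqP => _; rewrite ?mul1r // !mul0r mulr0.
have gth : has_gap (fun z : Vt w => cmp (base z)) (@Pt w) (1 - th).
  by apply: has_gap_le (@tower_gap w); rewrite lerD2l lerN2 le_min lexx hw.
have th1' : 0 <= 1 - th by rewrite subr_ge0.
have hM := iterM_nrm w th1' gth bal.
have k0 : 0 < (#|{: K}|%:R ^+ w : rat) by rewrite exprn_gt0 // ltr0n card_tuple expn_gt0 D0.
have hlow (z : Vt w) : base z = x0 -> iter w (@M w) (fun z => phi (base z)) z = - c^-1.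
  move=> ez; apply: iterM_const => bs zb; rewrite /phi (negPf (far _ _ ez zb)) sub0r.
  suff -> : cmp (base (foldl (fun z b => Pt b z) z bs)) = cmp y by rewrite eqxx mul1r.
  rewrite -exy -ez; elim: bs z {zb ez} => //= b bs IH z.
  by rewrite IH Pt_cmp.
have h1 : #|{: K}|%:R ^+ w * (c^-1) ^+ 2 <= nrm (iter w (@M w) (fun z => phi (base z))).
  apply: le_trans (_ : \sum_(z : Vt w) (if base z == x0 then (c^-1) ^+ 2 else 0) <= _).
    rewrite (sum_base w (fun v => if v == x0 then (c^-1) ^+ 2 else 0)) -big_mkcond /=.
    by rewrite big_pred1_eq.
  apply: ler_sum => z _; case: eqP => [ez|_]; last by rewrite -expr2 sqr_ge0.
  by rewrite hlow // mulrNN expr2.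
have h2 : nrm (fun z : Vt w => phi (base z)) <= #|{: K}|%:R ^+ w.
  by rewrite /nrm /dot (sum_base w (fun v => phi v * phi v)) ger_pMr.
have : #|{: K}|%:R ^+ w * (c^-1) ^+ 2 <= (1 - th) ^+ w * #|{: K}|%:R ^+ w.
  by apply: le_trans h1 (le_trans hM _); rewrite ler_wpM2l // exprn_ge0.
rewrite mulrC ler_pM2r // exprVn.
move=> h3; have : 1 <= c ^+ 2 * (1 - th) ^+ w.
  have c2 : 0 < c ^+ 2 by exact: exprn_gt0.
  by rewrite -[leLHS](divff (lt0r_neq0 c2)) (ler_pM2l c2).
rewrite leNgt => /negP; case; apply: le_lt_trans hN; rewrite ler_wpM2r ?exprn_ge0 //.
by rewrite lerXn2r ?nnegrE ?ler0n ?(ltW c0) // ler_nat max_card.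
Qed.

End Tower.

End SpectralGap.

(** * Exploring a graph with an odometer *)

Section Odometer.
Variables (D X : finType) (p : nat).
Notation K := (p.+1.-tuple D).
Variables (d0 : D) (g : D -> K -> K) (pi : K -> X -> X).

(* A cell [(a, c)] holds the label [a] of a level and the number [c] of steps made
   since the label of the next level last changed; [lab] and [carry] read and
   update whatever drives the last level. *)
Definition label R (lab : R -> K) (l : seq (K * nat)) (r : R) : K :=
  if l is (a, _) :: _ then a else lab r.

(** The entry of rank [c] in the label one level up selects the expander edge followed by [a]. It is
    read before the carry modifies that label, so the entry of rank [p] still comes from the old
    one. *)
Fixpoint odo R (lab : R -> K) (carry : R -> R) (l : seq (K * nat)) (r : R) :
    seq (K * nat) * R :=
  if l is (a, c) :: l' then
    let a' := g (nth d0 (label lab l' r) c) a in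
    if c < p then ((a', c.+1) :: l', r)
    else let: (l2, r2) := odo lab carry l' r in ((a', 0) :: l2, r2)
  else ([::], carry r).

Definition ostep R (lab : R -> K) (carry : R -> R) (s : X * (seq (K * nat) * R)) :=
  (pi (label lab s.2.1 s.2.2) s.1, odo lab carry s.2.1 s.2.2).

Notation Vt := (Vt D X p).

Fixpoint digits (i : nat) : Vt i -> seq K :=
  match i with
  | 0 => fun _ => [::]
  | j.+1 => fun z => rcons (digits z.1) z.2
  end.

Definition reset (s : seq K) : seq (K * nat) := [seq (a, 0) | a <- s].

Section Push.
Variables (R : Type) (lab : R -> K) (carry : R -> R).
(** The top cell is absorbed into the driver of the cells below it. This is why [R], [lab] and
    [carry] are arbitrary: an induction on the number of levels changes the driver. *)
Definition plab (s : K * nat * R) : K := s.1.1.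
Definition pcarry (s : K * nat * R) : K * nat * R :=
  let: (a, c, r) := s in
  let a' := g (nth d0 (lab r) c) a in
  if c < p then (a', c.+1, r) else (a', 0, carry r).

Lemma label_rcons l c r : label lab (rcons l c) r = label plab l (c, r).
Proof. by case: l c => [|[? ?] ?] []. Qed.

Lemma odo_rcons l c r : odo lab carry (rcons l c) r =
  let: (l', (c', r')) := odo plab pcarry l (c, r) in (rcons l' c', r').
Proof.
elim: l c r => [|[a n] l IH] [a' c] r /=; first by case: ifP.
by rewrite label_rcons IH; case: ifP => // _; case: odo => l' [? ?].
Qed.

Lemma iter_ostep_rcons m x l c r : iter m (ostep lab carry) (x, (rcons l c, r)) =
  let: (x', (l', (c', r'))) := iter m (ostep plab pcarry) (x, (l, (c, r))) in
  (x', (rcons l' c', r')).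
Proof.
elim: m => //= m ->; case: (iter m (ostep plab _) _) => x' [l' [c' r']].
by rewrite /ostep /= label_rcons odo_rcons; case: odo => ? [].
Qed.

End Push.

(** A step of level [i.+1] is [p.+1] steps of level [i] driven by the absorbed top cell. The counter
    of that cell returns to 0 at the last of them, when the outer driver is carried, so the cells
    are again in reset form. *)
Lemma odo_run i (z : Vt i) R (lab : R -> K) (carry : R -> R) r :
  let z' := @Pt _ _ _ g pi i (lab r) z in
  iter (p.+1 ^ i) (ostep lab carry) (base z, (reset (digits z), r)) =
  (base z', (reset (digits z'), carry r)).
Proof.
elim: i z R lab carry r => [|i IH] z R lab carry r //.
case: z => z a /=.
pose b := lab r.
pose zz j := foldl (zstep g (@Pt _ _ _ g pi i)) (z, a) (take j b).
have es j : j <= p.+1 -> iter (p.+1 ^ i * j) (ostep (@plab R) (pcarry lab carry))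
    (base z, (reset (digits z), (a, 0, r))) =
    (base (zz j).1, (reset (digits (zz j).1),
       if j <= p then ((zz j).2, j, r) else ((zz j).2, 0, carry r))).
  elim: j => [|j IHj] hj; first by rewrite muln0 /zz take0.
  rewrite mulnS iterD IHj ?(ltnW hj) // (_ : j <= p) //.
  have eb : zz j.+1 = zstep g (@Pt _ _ _ g pi i) (zz j) (nth d0 b j).
    by rewrite /zz (take_nth d0) ?size_tuple // -cats1 foldl_cat.
  rewrite IH eb /zstep /=; congr (_, (_, _)).
rewrite /reset map_rcons -/(reset _) iter_ostep_rcons expnSr es // ltnn.
have -> : walk g (@Pt _ _ _ g pi i) b (z, a) = zz p.+1 by rewrite /zz take_oversize // size_tuple.
by rewrite /reset map_rcons.
Qed.

Lemma odo_runs i (z : Vt i) R (lab : R -> K) (carry : R -> R) r m :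
  let z' := foldl (fun z b => @Pt _ _ _ g pi i b z) z [seq lab (iter j carry r) | j <- iota 0 m] in
  iter (m * p.+1 ^ i) (ostep lab carry) (base z, (reset (digits z), r)) =
  (base z', (reset (digits z'), iter m carry r)).
Proof.
elim: m => [|m IH]; first by [].
move=> z0; rewrite /z0 {z0}.
have -> : iota 0 m.+1 = rcons (iota 0 m) m by rewrite -cats1 -addn1 iotaD.
by rewrite mulSn iterD IH odo_run map_rcons -cats1 foldl_cat.
Qed.

End Odometer.

From mathcomp Require Import zify.

Section Covering.
Import Order.TTheory GRing.Theory Num.Theory.

(** * The rotation graph on pairs of vertices *)

Section RotationGraph.
Variables (n : nat) (E : rel 'I_n).
Hypothesis symE : symmetric E.
Notation X := ('I_n * 'I_n)%type.

(* The second component points to a candidate neighbour of the first one, so that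
   the moves are permutations of constant number whatever the degrees. *)
Definition turn (o : 'I_3) (x : X) : X :=
  if val o == 0 then x else if val o == 1 then (x.1, ordS x.2)
  else if E x.1 x.2 then (x.2, x.1) else x.

Lemma turn_inj o : injective (turn o).
Proof.
move=> [u v] [u' v']; rewrite /turn; do 2?case: ifP => _ //=.
  by move=> e; have /= -> := congr1 fst e; have /ordS_inj /= -> := congr1 snd e.
case: ifP => e; case: ifP => e' // [e1 e2]; subst => //.
  by rewrite symE e in e'.
by rewrite symE e' in e.
Qed.

Definition component (x : X) : 'I_n := fingraph.root E x.1.

Lemma component_turn o x : component (turn o x) = component x.
Proof.
rewrite /turn; do 2?case: ifP => _ //; case: ifP => // e.
apply/eqP; rewrite root_connect; last exact: sym_connect_sym.
by apply: connect1; rewrite symE.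
Qed.

Let R (x y : X) := [exists o, y == turn o x].

(** Rotations bring the pointer onto the next vertex of a path, and a flip then crosses that
    edge. *)
Lemma turn_conn x y : component x = component y -> connect R x y.
Proof.
have row u v v' : connect R (u, v) (u, v').
  suff H k : connect R (u, v) (u, iter k (@ordS n) v).
    have -> : v' = iter (n - v + v') (@ordS n) v.
      have h k : iter k (@ordS n) v = (v + k) %% n :> nat.
        elim: k => [|k IH]; first by rewrite addn0 modn_small.
        by rewrite iterS /= IH -addn1 modnDml addn1 addnS.
      by apply: val_inj; rewrite /= h addnA subnKC ?modnDl ?modn_small // ltnW.
    exact: H.
  elim: k => [|k IH]; first exact: connect0.
  by apply: connect_trans IH (connect1 _); apply/existsP; exists (inord 1); rewrite /turn /= inordK.
case: x y => [u v] [u' v'] /= /eqP; rewrite /component root_connect; last exact: sym_connect_sym.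
move=> /connectP[s]; elim: s u v => [|u1 s IH] u v /=; first by move=> _ ->.
move=> /andP[e hs] ly; apply: connect_trans (row u v u1) _.
apply: connect_trans (IH _ _ hs ly).
by apply: connect1; apply/existsP; exists (inord 2); rewrite /turn /= inordK //= e.
Qed.

End RotationGraph.

(** Each residue class has at least [N %/ 3] members; the worst case is [N = 5], hence the factor
    5. *)
Lemma card_modn3 (N : nat) (o : 'I_3) : 2 < N ->
  N <= 5 * #|[pred i : 'I_N | (i %% 3)%N == o :> nat]|.
Proof.
move=> hN; have h (j : 'I_(N %/ 3)) : 3 * j + o < N.
  by have := ltn_ord j; have := ltn_ord o; lia.
have inj : injective (fun j => Ordinal (h j)).
  by move=> j j' /(congr1 val) /= e; apply: val_inj => /=; lia.
have : #|'I_(N %/ 3)| <= #|[pred i : 'I_N | (i %% 3)%N == o :> nat]|.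
  rewrite -(card_image inj); apply: subset_leq_card; apply/subsetP => i /imageP[j _ ->].
  by rewrite inE /= mulnC modnMDl modn_small.
by rewrite card_ord; lia.
Qed.

Local Open Scope ring_scope.

(** [G = 10 * 4 ^ 3] makes [G ^ w] at least [10 * (4 ^ w) ^ 3], which exceeds the inverse of the
    base gap, and [1 - th = 4 ^ -2] gives the second bound. [N] will be the number of pairs of
    vertices. *)
Lemma pow_bounds (th : rat) (N w G : nat) : 0 < th -> th <= 1 -> 1 - th = 16%:R^-1 ->
  (0 < w)%N -> (0 < N)%N -> (N < 4 ^ w)%N -> G = 640 ->
  th <= G%:R ^+ w * (10 * N%:R ^+ 3)^-1 /\ N%:R ^+ 2 * (1 - th) ^+ w < 1.
Proof.
move=> t0 t1 et w0 N0 hN eG; split.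
  have -> : 10 * N%:R ^+ 3 = (10 * N ^ 3)%:R :> rat by rewrite natrM natrX.
  have [c ec] : exists c, c = (10 * N ^ 3)%N by exists (10 * N ^ 3)%N.
  have c0 : (0 < c)%N by rewrite ec muln_gt0 expn_gt0 N0.
  rewrite -ec ler_pdivlMr ?ltr0n //; apply: le_trans (_ : c%:R <= _).
    exact: ler_piMl (ler0n _ _) t1.
  rewrite -natrX ler_nat ec.
  have {}eG : G = (10 * 4 ^ 3)%N by rewrite eG.
  rewrite eG expnMn leq_mul //.
    by rewrite -{1}(expn1 10) leq_exp2l.
  by rewrite -expnM mulnC expnM leq_exp2r // ltnW.
rewrite et exprVn -!natrX ltr_pdivrMr ?ltr0n ?expn_gt0 // mul1r ltr_nat.
by rewrite (_ : 16 = 4 ^ 2)%N // -expnM mulnC expnM ltn_exp2r.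
Qed.

Lemma digits_size (D X : finType) p i (z : Vt D X p i) : size (digits z) = i.
Proof. by elim: i z => //= i IH [z a]; rewrite size_rcons IH. Qed.

(** The label type, the expander and [op] are fixed before the graph: only the number [w] of levels
    grows. The driver is quantified after the labels [bs], so any device that produces them in turn
    may be used, such as a register shifted digit by digit. *)
Theorem explore : exists (D : finType) (d0 : D) (p : nat)
    (g : D -> p.+1.-tuple D -> p.+1.-tuple D) (op : p.+1.-tuple D -> 'I_3),
  forall n (E : rel 'I_n) w, symmetric E -> (0 < w)%N -> (n ^ 2 < 4 ^ w)%N ->
  forall u y v0, connect E u y ->
  exists s bs : seq (p.+1.-tuple D), [/\ size s = w, size bs = w &
    forall R lab carry (r : R), [seq lab (iter j carry r) | j <- iota 0 w] = bs ->
    (iter (w * p.+1 ^ w) (ostep d0 g (fun b => turn E (op b)) lab carry)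
      ((u, v0), (reset s, r))).1.1 = y].
Proof.
have [G eG] : exists G, G = 640%N by exists 640%N.
have [p ep] : exists p, p = (70 * G)%N by exists (70 * G)%N.
have G0 : (0 < G)%N by rewrite eG.
have := lam01 p; set lam : rat := _^-1 => l01.
have l0 : 0 < lam by case/andP: l01.
have [D [g [D2 injg expg]]] := @expander_exists p.+1 lam (ltn0Sn p) l0.
have D0 : (0 < #|D|)%N by exact: leq_trans D2.
have [d0 _] : exists d0 : D, d0 \in D by apply/card_gt0P.
pose K := p.+1.-tuple D.
have K2 : (2 < #|{: K}|)%N.
  rewrite card_tuple; apply: (leq_trans D2); rewrite -{1}(expn1 #|D|) leq_exp2l //.
  exact: leq_trans D2.
pose op (b : K) : 'I_3 := Ordinal (ltn_pmod (enum_rank b) (isT : (0 < 3)%N)).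
exists D, d0, p, g, op => n E w symE w0 hn u y v0 cuy.
have n0 : (0 < n)%N by case: (n) u {y v0 cuy} hn => // -[].
pose X : finType := ('I_n * 'I_n)%type.
have cX : #|X| = (n ^ 2)%N by rewrite card_prod card_ord mulnn.
have hop o : (#|{: K}| <= 5 * #|[pred b | op b == o]|)%N.
  have -> : #|[pred b | op b == o]| = #|[pred i : 'I_#|{: K}| | (i %% 3)%N == o :> nat]|.
    rewrite -(card_image (@enum_val_inj _ {: K})); apply: eq_card => b.
    apply/idP/imageP => [h|[i h ->]].
      by exists (enum_rank b); rewrite ?enum_rankK.
    by rewrite !inE -val_eqE /= enum_valK.
  exact: card_modn3.
pose c0 := Ordinal (isT : (0 < 3)%N).
have gap : has_gap (@component n E) (fun b => turn E (op b)) (1 - (10 * #|X|%:R ^+ 3)^-1).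
  apply: (@base_gap X K _ (@component n E) _ c0 (turn E) op (@turn_inj _ _ symE)) => //.
    exact: leq_trans K2.
  exact: turn_conn.
have [th [t0 t1 et amp]] : exists th : rat, [/\ 0 < th, th <= 1, 1 - th = 16%:R^-1 &
    forall m, 0 < m <= th ->
    Num.min th (G%:R * m) <= (1 - lam) ^+ p.+1 * (1 - (1 - m) ^+ p)].
  by exists (15 / 16); split; [lra|lra|lra|exact: amplify ep G0].
have [|hw1 hw2] := @pow_bounds th (n ^ 2) w G t0 t1 et w0 _ hn eG.
  by rewrite expn_gt0 n0.
rewrite -cX in hw1 hw2.
have e0 : 0 < (10 * #|X|%:R ^+ 3 : rat)^-1.
  by rewrite invr_gt0 -natrX -natrM ltr0n muln_gt0 expn_gt0 cX expn_gt0 n0.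
have hc : component E (u, v0) = component E (y, v0).
  by apply/eqP; rewrite /component root_connect //; exact: sym_connect_sym.
have [z [bs zb [ez ey]]] := @cover D X _ (@component n E) G p g (fun b => turn E (op b)) _ lam th
  G0 l01 t0 t1 amp D0 injg expg (fun b => @turn_inj _ _ symE (op b))
  (fun b => component_turn symE (op b)) e0 gap w (u, v0) (y, v0) hc hw1 hw2.
exists (digits z), bs; split=> //; first exact: digits_size.
move=> R lab carry r er.
by rewrite -ez odo_runs er /= ey.
Qed.

End Covering.

(** * A structured language for Turing machines *)

Section Machine.
Variables (Mem Cell : finType) (c0 : Cell).

(* An atom is either a sweep of the work head to the end of the used tape and back,
   which may append a cell, or one access to the input. *)
Inductive atom :=
| Swp of (Mem -> Mem) & (Mem -> Cell -> Mem * Cell) & (Mem -> bool)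
       & (Mem -> Cell -> Mem * Cell)
| Inp of (Mem -> option isym -> Mem) & dir.

Fixpoint sweepr (f : Mem -> Cell -> Mem * Cell) m l :=
  if l is c :: l' then
    let: (m1, c1) := f m c in
    let: (m2, l2) := sweepr f m1 l' in (m2, c1 :: l2)
  else (m, [::]).

Fixpoint sweepl (g : Mem -> Cell -> Mem * Cell) m l :=
  if l is c :: l' then
    let: (m1, l1) := sweepl g m l' in
    let: (m2, c2) := g m1 c in (m2, c2 :: l1)
  else (m, [::]).

Record st := St { mem : Mem; hd : nat; tp : seq Cell }.

Definition aexec x (a : atom) (s : st) : st :=
  match a with
  | Swp pre f e g =>
      let: (m1, l1) := sweepr f (pre (mem s)) (tp s) in
      let: (m2, l2) := sweepl g m1 (if e m1 then rcons l1 c0 else l1) in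
      St m2 (hd s) l2
  | Inp f d => St (f (mem s) (read_input x (hd s)))
                  (minn (move d (hd s)) (size x).+1) (tp s)
  end.

Inductive com :=
| Atom of atom
| Cseq of com & com
| Ite of (Mem -> bool) & com & com
| Whl of (Mem -> bool) & com.

(** A derivation certifies at once that the run terminates and that the tape never exceeds [W]
    cells. *)
Inductive big x (W : nat) : com -> st -> st -> Prop :=
| BAtom a s : size (tp (aexec x a s)) <= W -> big x W (Atom a) s (aexec x a s)
| BSeq a b s1 s2 s3 : big x W a s1 s2 -> big x W b s2 s3 -> big x W (Cseq a b) s1 s3
| BIteT (t : Mem -> bool) a b s s' : t (mem s) -> big x W a s s' -> big x W (Ite t a b) s s'
| BIteF (t : Mem -> bool) a b s s' : ~~ t (mem s) -> big x W b s s' -> big x W (Ite t a b) s s'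
| BWhlF (t : Mem -> bool) a s : ~~ t (mem s) -> big x W (Whl t a) s s
| BWhlT (t : Mem -> bool) a s1 s2 s3 : t (mem s1) -> big x W a s1 s2 -> big x W (Whl t a) s2 s3 ->
    big x W (Whl t a) s1 s3.

(** Control points become the states of the machine. The additional [None] in [Ite] and [Whl] is the
    point where the test is evaluated, after a dummy instruction. *)
Fixpoint pc (c : com) : finType :=
  match c with
  | Atom _ => unit
  | Cseq a b => (pc a + pc b)%type
  | Ite _ a b => option (pc a + pc b)
  | Whl _ a => option (pc a)
  end.

Fixpoint entry (c : com) : pc c :=
  match c return pc c with
  | Atom _ => tt
  | Cseq a b => inl (entry a)
  | Ite _ _ _ => None
  | Whl _ _ => None
  end.

Definition nop := Inp (fun m _ => m) DS.

Fixpoint instr (c : com) : pc c -> atom :=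
  match c return pc c -> atom with
  | Atom a => fun _ => a
  | Cseq a b => fun p => match p with inl p => instr p | inr p => instr p end
  | Ite _ a b => fun p => match p with
      None => nop | Some (inl p) => instr p | Some (inr p) => instr p end
  | Whl _ a => fun p => if p is Some p then instr p else nop
  end.

Fixpoint next (c : com) : pc c -> Mem -> option (pc c) :=
  match c return pc c -> Mem -> option (pc c) with
  | Atom a => fun _ _ => None
  | Cseq a b => fun p m => match p with
      | inl p => Some (if next p m is Some p' then inl p' else inr (entry b))
      | inr p => omap inr (next p m) end
  | Ite t a b => fun p m => match p with
      | None => Some (Some (if t m then inl (entry a) else inr (entry b)))
      | Some (inl p) => omap (fun p => Some (inl p)) (next p m)
      | Some (inr p) => omap (fun p => Some (inr p)) (next p m) end
  | Whl t a => fun p m => match p with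
      | None => if t m then Some (Some (entry a)) else None
      | Some p => Some (next p m) end
  end.

Inductive flat x W (c : com) : option (pc c) -> st -> option (pc c) -> st -> Prop :=
| FRefl p s : flat x W p s p s
| FStep p s p' s' : size (tp (aexec x (instr p) s)) <= W ->
    flat x W (next p (mem (aexec x (instr p) s))) (aexec x (instr p) s) p' s' ->
    flat x W (Some p) s p' s'.

Lemma flat_trans x W c p s p1 s1 p2 s2 :
  @flat x W c p s p1 s1 -> flat x W p1 s1 p2 s2 -> flat x W p s p2 s2.
Proof. by elim=> // p3 s3 p4 s4 hs _ IH /IH; exact: FStep. Qed.

(* A simulation of the code of [c] inside that of a larger command, whose exit
   is redirected to [ex]. *)
Lemma flat_embed x W c c' (f : pc c -> pc c') (ex : Mem -> option (pc c')) p s s' :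
  (forall p, instr (f p) = instr p) ->
  (forall p m, next (f p) m = if next p m is Some p' then Some (f p') else ex m) ->
  @flat x W c (Some p) s None s' ->
  flat x W (Some (f p)) s (ex (mem s')) s'.
Proof.
move=> hi hn H.
have gen : forall p1 s1 p2 s2, @flat x W c p1 s1 p2 s2 -> p2 = None ->
    flat x W (if p1 is Some p1 then Some (f p1) else ex (mem s1)) s1 (ex (mem s2)) s2.
  move=> p1 s1 p2 s2; elim=> [p3 s3 ->|p3 s3 p4 s4 hs _ IH /IH h]; first exact: FRefl.
  by apply: FStep; rewrite hi // hn; case: next h.
exact: (gen _ _ _ _ H).
Qed.

Lemma aexec_nop x s : hd s <= (size x).+1 -> aexec x nop s = s.
Proof. by case: s => m h l /= hh; rewrite (minn_idPl hh). Qed.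

Lemma aexec_hd x a s : hd s <= (size x).+1 -> hd (aexec x a s) <= (size x).+1.
Proof.
case: a s => [pre f e g|f d] [m h l] //= hh; last exact: geq_minr.
by case: sweepr => m1 l1; case: sweepl.
Qed.

Lemma size_sweepr f m l : size (sweepr f m l).2 = size l.
Proof.
elim: l m => //= c l IH m; case: (f m c) => m1 c1.
by have := IH m1; case: sweepr => m2 l2 /= ->.
Qed.

Lemma size_sweepl f m l : size (sweepl f m l).2 = size l.
Proof.
elim: l m => //= c l IH m; have := IH m; case: sweepl => m1 l1 /= <-.
by case: (f m1 c).
Qed.

Lemma aexec_size x a s : size (tp s) <= size (tp (aexec x a s)).
Proof.
case: a s => [pre f e g|f d] [m h l] //=.
have := size_sweepr f (pre m) l; case: sweepr => m1 l1 /= <-.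
have := size_sweepl g m1 (if e m1 then rcons l1 c0 else l1).
by case: sweepl => m2 l2 /= ->; case: ifP; rewrite ?size_rcons.
Qed.

Lemma big_flat x W c s s' : big x W c s s' -> hd s <= (size x).+1 -> size (tp s) <= W ->
  [/\ flat x W (Some (entry c)) s None s', hd s' <= (size x).+1 & size (tp s') <= W].
Proof.
elim=> {c s s'}
  [a s h hh _|a b s1 s2 s3 _ IH1 _ IH2 hh hW|t a b s s' ht _ IH hh hW
  |t a b s s' ht _ IH hh hW|t a s ht hh hW|t a s1 s2 s3 ht _ IH1 _ IH2 hh hW].
- by split=> //; [apply: FStep => //; exact: FRefl|exact: aexec_hd].
- have [f1 hh2 hW2] := IH1 hh hW; have [f2 hh3 hW3] := IH2 hh2 hW2; split=> //.
  have /= H1 := @flat_embed x W a (Cseq a b) inl (fun _ => Some (inr (entry b))) _ _ _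
    (fun _ => erefl) (fun p m => _) f1.
  have /= H2 := @flat_embed x W b (Cseq a b) inr (fun _ => None) _ _ _
    (fun _ => erefl) (fun p m => _) f2.
  by apply: flat_trans (H1 _) (H2 _) => p m /=; case: next.
- have [f1 hh2 hW2] := IH hh hW; split=> //.
  have /= H1 := @flat_embed x W a (Ite t a b) (fun p => Some (inl p)) (fun _ => None) _ _ _
    (fun _ => erefl) (fun p m => _) f1.
  apply: FStep; rewrite [aexec _ _ _](aexec_nop hh) //= ht.
  by apply: H1 => p m; case: next.
- have [f1 hh2 hW2] := IH hh hW; split=> //.
  have /= H1 := @flat_embed x W b (Ite t a b) (fun p => Some (inr p)) (fun _ => None) _ _ _
    (fun _ => erefl) (fun p m => _) f1.
  apply: FStep; rewrite [aexec _ _ _](aexec_nop hh) //= (negPf ht).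
  by apply: H1 => p m; case: next.
- split=> //; apply: FStep; rewrite [aexec _ _ _](aexec_nop hh) //= (negPf ht).
  exact: FRefl.
- have [f1 hh2 hW2] := IH1 hh hW; have [f2 hh3 hW3] := IH2 hh2 hW2; split=> //.
  have /= H1 := @flat_embed x W a (Whl t a) Some (fun _ => Some None) _ _ _
    (fun _ => erefl) (fun p m => _) f1.
  apply: FStep; rewrite [aexec _ _ _](aexec_nop hh) //= ht.
  apply: flat_trans f2.
  by apply: H1 => p m; case: next.
Qed.

Lemma sweepl_rcons g m l c : sweepl g m (rcons l c) =
  let: (m1, c1) := g m c in let: (m2, l2) := sweepl g m1 l in (m2, rcons l2 c1).
Proof.
elim: l => [|c' l IH] /=; first by case: (g m c).
rewrite IH; case: (g m c) => m1 c1; case: (sweepl g m1 l) => m2 l2.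
by case: (g m2 c').
Qed.

(** * Compilation to a Turing machine *)

Section TuringMachine.
Variables (c : com) (m0 : Mem) (acc : pred Mem).

(* Phases: [None] initialises the tape, [Some None] starts an instruction,
   [Some (Some b)] is a sweep, to the right if [b] and to the left otherwise. *)
Let Q : finType := (option (pc c) * Mem * option (option bool))%type.
Let G : finType := option (bool * Cell).

Definition tm_step (q : Q) (sym : option isym) (g : G) : Q * G * dir * dir :=
  let: (op, m, ph) := q in
  if op isn't Some p then (q, g, DS, DS) else
  match ph with
  | None => ((op, m, Some None), Some (true, c0), DS, DS)
  | Some None =>
      match instr p with
      | Inp f d => let m' := f m sym in ((next p m', m', Some None), g, d, DS)
      | Swp pre _ _ _ => ((op, pre m, Some (Some true)), g, DS, DS)
      end
  | Some (Some true) =>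
      if instr p is Swp _ f e _ then
        if g is Some (b, y) then
          let: (m', y') := f m y in ((op, m', ph), Some (b, y'), DS, DR)
        else ((op, m, Some (Some false)), (if e m then Some (false, c0) else None),
              DS, if e m then DS else DL)
      else (q, g, DS, DS)
  | Some (Some false) =>
      if instr p is Swp _ _ _ f then
        if g is Some (b, y) then
          let: (m', y') := f m y in
          if b then ((next p m', m', Some None), Some (b, y'), DS, DS)
          else ((op, m', ph), Some (b, y'), DS, DL)
        else (q, g, DS, DS)
      else (q, g, DS, DS)
  end.

Definition machine : TM :=
  @Build_TM Q G None (Some (entry c), m0, None)
    (fun q => q.1.1 == None) (fun q => acc q.1.2) tm_step.

(** The Boolean marks the leftmost cell, where a leftward sweep must stop; the blank [None] stops a
    rightward one. *)
Definition tape (l : seq Cell) (i : nat) : G :=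
  if i < size l then Some (i == 0, nth c0 l i) else None.

Definition cfg ph p m h l pos : config machine :=
  @Config machine (p, m, ph) h (tape l) pos.

Definition reach x W (s s' : config machine) :=
  exists2 k, iter k (@step machine x) s = s' &
    forall j, j <= k -> c_whead (iter j (@step machine x) s) <= W.

Lemma reach_refl x W s : c_whead s <= W -> reach x W s s.
Proof. by move=> h; exists 0 => // -[]. Qed.

Lemma reach_trans x W s1 s2 s3 : reach x W s1 s2 -> reach x W s2 s3 -> reach x W s1 s3.
Proof.
move=> [k e h] [k' e' h']; exists (k' + k); first by rewrite iterD e.
move=> j hj; case: (leqP j k) => [/h //|hk].
by rewrite -(subnK (ltnW hk)) iterD e h' // leq_subLR addnC.
Qed.

Lemma reach_step x W s s' : c_whead s <= W -> reach x W (@step machine x s) s' -> reach x W s s'.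
Proof.
move=> hs [k e h]; exists k.+1; first by rewrite iterSr.
by case=> // j hj; rewrite iterSr h.
Qed.

Lemma tape_set l1 y y' l2 :
  (fun i => if i == size l1 then Some (size l1 == 0, y') else tape (l1 ++ y :: l2) i) =
  tape (l1 ++ y' :: l2).
Proof.
apply: functional_extensionality => i; rewrite /tape !size_cat /= !nth_cat.
case: eqP => [->|/eqP ne]; first by rewrite ltnn subnn /= addnS ltnS leq_addr.
case: ltnP => // _; case: ltnP => // h.
by rewrite -[i - size l1]prednK // subn_gt0 ltn_neqAle eq_sym ne.
Qed.

Lemma tape_same l pos : (fun i => if i == pos then tape l pos else tape l i) = tape l.
Proof. by apply: functional_extensionality => i; case: eqP => // ->. Qed.

Lemma tape_rcons l : 0 < size l ->
  (fun i => if i == size l then Some (false, c0) else tape l i) = tape (rcons l c0).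
Proof.
move=> l0; apply: functional_extensionality => i; rewrite /tape size_rcons nth_rcons ltnS.
case: eqVneq => [->|ne]; first by rewrite leqnn ltnn gtn_eqF.
by rewrite [in RHS]leq_eqVlt (negPf ne) /=; case: ltnP.
Qed.

Lemma reach_right x W p pre f e g (h : instr p = Swp pre f e g) l1 l2 m hd :
  size (l1 ++ l2) <= W -> hd <= (size x).+1 ->
  reach x W (cfg (Some (Some true)) (Some p) m hd (l1 ++ l2) (size l1))
    (let: (m', l') := sweepr f m l2 in
     cfg (Some (Some true)) (Some p) m' hd (l1 ++ l') (size (l1 ++ l2))).
Proof.
elim: l2 l1 m => [|y l2 IH] l1 m hW hh.
  by rewrite /= !cats0 in hW *; apply: reach_refl.
apply: reach_step => /=; first by apply: leq_trans hW; rewrite size_cat leq_addr.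
rewrite /step /= h /= {1}/tape size_cat /= addnS ltnS leq_addr nth_cat ltnn subnn /=.
case: (f m y) => m' y'; rewrite /= (minn_idPl hh) tape_set -cat_rcons.
have es : size (rcons l1 y' ++ l2) = size (l1 ++ y :: l2).
  by rewrite !size_cat size_rcons addSnnS.
have := IH (rcons l1 y') m'; rewrite es => /(_ hW hh).
rewrite size_rcons size_cat /= addnS.
by case: (sweepr f m' l2) => m2 l3; rewrite !cat_rcons.
Qed.

Lemma reach_left x W p pre f e g (h : instr p = Swp pre f e g) y l1 l2 m hd :
  size (y :: l1 ++ l2) <= W -> hd <= (size x).+1 ->
  reach x W (cfg (Some (Some false)) (Some p) m hd (y :: l1 ++ l2) (size l1))
    (let: (m', l') := sweepl g m (y :: l1) in
     cfg (Some None) (next p m') m' hd (l' ++ l2) 0).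
Proof.
elim/last_ind: l1 l2 m => [|l1 z IH] l2 m hW hh.
  apply: reach_step; rewrite //= /step /= h /=.
  case: (g m y) => m' y'; rewrite /= (minn_idPl hh) (@tape_set [::]).
  by apply: reach_refl.
have hW2 : (size l1).+2 <= W.
  by apply: leq_trans hW; rewrite /= size_cat size_rcons ltnS leq_addr.
apply: reach_step; first by rewrite /= size_rcons ltnW.
have -> : sweepl g m (y :: rcons l1 z) = sweepl g m (rcons (y :: l1) z) by [].
rewrite sweepl_rcons.
rewrite /step /= h /= {1}/tape /= size_cat size_rcons !ltnS leq_addr cat_rcons.
rewrite /= nth_cat ltnn subnn /=.
case: (g m z) => m' z'; rewrite /= (minn_idPl hh).
rewrite (@tape_set (y :: l1)) /=.
have := IH (z' :: l2) m' _ hh => /=; rewrite size_cat /= addnS.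
move: hW; rewrite /= size_cat size_rcons addSn => hW /(_ hW).
case: sweepl => m2 l3; case: (g m2 y) => m3 y3 /=.
by rewrite cat_rcons.
Qed.

Lemma reach_atom x W p s : 0 < size (tp s) -> hd s <= (size x).+1 ->
  size (tp (aexec x (instr p) s)) <= W ->
  let s' := aexec x (instr p) s in
  reach x W (cfg (Some None) (Some p) (mem s) (hd s) (tp s) 0)
    (cfg (Some None) (next p (mem s')) (mem s') (hd s') (tp s') 0).
Proof.
case: s => m h l /= l0 hh hW.
have hlW := leq_trans (aexec_size x (instr p) (St m h l)) hW.
apply: reach_step => //; rewrite /step /= .
case ei : (instr p) hW hlW => [pre f e g|f d] /= hW hlW; last first.
  rewrite tape_same; exact: reach_refl.
rewrite (minn_idPl hh) tape_same.
have := size_sweepr f (pre m) l.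
have := @reach_right x W p _ _ _ _ ei [::] l (pre m) h hlW hh.
case: sweepr hW => m1 l1 /= hW hr hs; apply: reach_trans hr _.
have hl1 : 0 < size l1 by rewrite hs.
apply: reach_step => //; rewrite /step /= ei /= {1}/tape hs ltnn (minn_idPl hh).
(* The head is on the first blank. It either writes a new cell there and stays, or steps back; in
   both cases it ends on the last cell of [l2]. *)
have [l2 el2 [-> ->]] : exists2 l2, l2 = (if e m1 then rcons l1 c0 else l1) &
    (fun i => if i == size l then (if e m1 then Some (false, c0) else None) else tape l1 i)
      = tape l2 /\ move (if e m1 then DS else DL) (size l) = (size l2).-1.
  exists (if e m1 then rcons l1 c0 else l1) => //; case: (e m1).
    by rewrite size_rcons hs -{1}hs tape_rcons.
  split; last by rewrite hs.
  by rewrite -[RHS](tape_same _ (size l)); apply: functional_extensionality => i;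
     rewrite {2}/tape hs ltnn.
rewrite -el2 in hW *; have : 0 < size l2 by rewrite el2; case: ifP => //; rewrite size_rcons.
move=> hl2.
have {}hW : size l2 <= W by move: hW; case: sweepl (size_sweepl g m1 l2) => m2 l3 /= ->.
have hl l3 : l2 = l3 -> reach x W
    (cfg (Some (Some false)) (Some p) m1 h l3 (size l3).-1)
    (let: (m', l') := sweepl g m1 l3 in cfg (Some None) (next p m') m' h l' 0).
  case: l3 => [e2|y l3 e3]; first by rewrite e2 in hl2.
  have := @reach_left x W p _ _ _ _ ei y l3 [::] m1 h.
  rewrite cats0; rewrite e3 in hW => /(_ hW hh).
  by case: (sweepl g m1 (y :: l3)) => m2 l4; rewrite cats0.
by case: sweepl (hl _ erefl) => m2 l3.
Qed.

Lemma reach_flat x W p s p' s' : flat x W p s p' s' -> 0 < size (tp s) ->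
  size (tp s) <= W -> hd s <= (size x).+1 ->
  reach x W (cfg (Some None) p (mem s) (hd s) (tp s) 0)
            (cfg (Some None) p' (mem s') (hd s') (tp s') 0).
Proof.
elim=> {p s p' s'} [p s|p s p' s' hs _ IH] h0 hW hh; first exact: reach_refl.
apply: reach_trans (reach_atom h0 hh hs) _; apply: IH => //.
  exact: leq_trans h0 (aexec_size _ _ _).
exact: aexec_hd.
Qed.

Theorem machine_big x W s' : 0 < W -> big x W c (St m0 0 [:: c0]) s' ->
  exists k, [/\ tm_halt (c_state (run machine x k)),
    forall k', tm_halt (c_state (run machine x k')) ->
      @tm_acc machine (c_state (run machine x k')) = acc (mem s') &
    forall k', c_whead (run machine x k') <= W].
Proof.
move=> W0 /big_flat /(_ isT W0) [hf _ _].
have [k ek hk] : reach x W (init_config machine)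
    (cfg (Some None) None (mem s') (hd s') (tp s') 0).
  apply: reach_step => //.
  rewrite /step /=.
  have -> : (fun i => if i == 0 then Some (true, c0) else None) = tape [:: c0].
    by apply: functional_extensionality => -[].
  exact: (reach_flat hf).
have hlt j : run machine x (j + k) = cfg (Some None) None (mem s') (hd s') (tp s') 0.
  by rewrite /run iterD ek; elim: j => //= j ->.
exists k; rewrite -[k in run machine x k]add0n hlt; split=> // k'.
  (* Halted configurations are fixed by [step], so all halting times show the same configuration. *)
  move=> hh; suff <- : run machine x (k' + k) = run machine x k' by rewrite hlt.
  rewrite addnC; elim: (k) => //= j; rewrite /run iterD in hh * => ->.
  by rewrite [step _ _]/step hh.
case: (leqP k' k) => [/hk //|/ltnW/subnK <-]; by rewrite hlt.
Qed.

End TuringMachine.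
End Machine.

(** * Arithmetic on registers stored as tracks of the tape *)

Section Registers.
#[local] Arguments aexec : simpl never.
Variables (k b : nat).
Notation digit := 'I_b.+2.
Notation rg := 'I_k.

(** Each tape cell holds one digit of every register, so all registers are as wide as the tape and
    are processed in parallel. The base [b.+2] guarantees the digits 0 and 1. *)
Definition cell : finType := {ffun rg -> digit}.
Definition cell0 : cell := [ffun=> ord0].
Definition upd (y : cell) (r : rg) (d : digit) : cell :=
  [ffun i => if i == r then d else y i].

Lemma updE y r d i : upd y r d i = if i == r then d else y i.
Proof. by rewrite ffunE. Qed.

(* Test flag, carry, current digit, and answer. *)
Definition memory : finType := (bool * bool * digit * option bool)%type.
Definition fl (m : memory) := m.1.1.1.
Definition cy (m : memory) := m.1.1.2.
Definition dg (m : memory) := m.1.2.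
Definition ans (m : memory) := m.2.
Definition set_fl (m : memory) v : memory := (v, cy m, dg m, ans m).
Definition set_cy (m : memory) v : memory := (fl m, v, dg m, ans m).
Definition set_dg (m : memory) v : memory := (fl m, cy m, v, ans m).
Definition set_ans (m : memory) v : memory := (fl m, cy m, dg m, v).

Notation state := (st memory cell).
Notation atom := (atom memory cell).
Notation exec := (aexec cell0).

Definition reg r (s : state) : seq digit := [seq y r | y : cell <- tp s].

(** The least significant digit comes first, so that carries travel with the rightward sweep. *)
Definition num (l : seq digit) : nat := foldr (fun (d : digit) n => d + b.+2 * n) 0 l.
Definition rval r s := num (reg r s).
Definition cap (s : state) := b.+2 ^ size (tp s).

Lemma num_lt l : num l < b.+2 ^ size l.
Proof.
elim: l => //= d l IH; rewrite expnS.
have := ltn_ord d; have : b.+2 * (num l).+1 <= b.+2 * b.+2 ^ size l by rewrite leq_mul2l IH orbT.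
rewrite mulnS; lia.
Qed.

Lemma num_inj l l' : size l = size l' -> num l = num l' -> l = l'.
Proof.
elim: l l' => [|d l IH] [|d' l'] //= [/IH {}IH] e.
have ed : d = d'.
  apply: val_inj; have := congr1 (fun n => n %% b.+2) e.
  by rewrite ![_ + b.+2 * _]addnC ![b.+2 * _]mulnC !modnMDl !modn_small.
by move: e; rewrite ed => /addnI/eqP; rewrite eqn_mul2l /= => /eqP/IH ->.
Qed.

Lemma num_nseq0 n : num (nseq n ord0) = 0.
Proof. by elim: n => //= n ->; rewrite muln0. Qed.

Lemma size_reg r s : size (reg r s) = size (tp s).
Proof. by rewrite size_map. Qed.

Lemma val_lt r s : rval r s < cap s.
Proof. rewrite /rval /cap -(size_reg r s); exact: num_lt. Qed.

(** Frame properties are packed with each instruction, so that for whole programs non-interference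
    reduces to computing [writes] and [quiet]. *)
Record operation := Op {
  op_atom :> atom;
  op_w : seq rg;
  op_size : forall x s, size (tp (exec x op_atom s)) = size (tp s);
  op_frame : forall x s r, r \notin op_w -> reg r (exec x op_atom s) = reg r s;
  op_quiet : bool;
  op_ans : op_quiet -> forall x s, ans (mem (exec x op_atom s)) = ans (mem s)
}.

Definition no_ext (m : memory) := false.

Lemma swp_size pre f g x s : size (tp (exec x (Swp pre f no_ext g) s)) = size (tp s).
Proof.
rewrite /aexec; case: sweepr (size_sweepr f (pre (mem s)) (tp s)) => m1 l1 /= <-.
by case: sweepl (size_sweepl g m1 l1).
Qed.

Lemma swp_frame pre (f g : memory -> cell -> memory * cell) (w : seq rg) x s r :
  (forall m (y : cell) i, i \notin w -> (f m y).2 i = y i) ->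
  (forall m (y : cell) i, i \notin w -> (g m y).2 i = y i) ->
  r \notin w -> reg r (exec x (Swp pre f no_ext g) s) = reg r s.
Proof.
move=> hf hg hr; rewrite /reg /aexec.
have -> : [seq y r | y : cell <- tp s] = [seq y r | y : cell <- (sweepr f (pre (mem s)) (tp s)).2].
  elim: (tp s) (pre (mem s)) => //= y l IH m.
  have := hf m y r hr; case: (f m y) => m1 y1 /=.
  by have := IH m1; case: sweepr => m2 l2 /= -> ->.
case: sweepr => m1 l1 /=.
suff : [seq y r | y : cell <- (sweepl g m1 l1).2] = [seq y r | y : cell <- l1] by case: sweepl.
elim: l1 => //= y l; case: sweepl => m2 l2 /= <-.
by have := hg m2 y r hr; case: (g m2 y) => m3 y3 /= ->.
Qed.

Lemma swp_ans pre (f g : memory -> cell -> memory * cell) x s :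
  (forall m, ans (pre m) = ans m) -> (forall m y, ans (f m y).1 = ans m) ->
  (forall m y, ans (g m y).1 = ans m) ->
  ans (mem (exec x (Swp pre f no_ext g) s)) = ans (mem s).
Proof.
move=> hp hf hg; rewrite /aexec -[RHS]hp /no_ext.
have <- : ans (sweepr f (pre (mem s)) (tp s)).1 = ans (pre (mem s)).
  elim: (tp s) (pre (mem s)) => //= y l IH m.
  have := hf m y; case: (f m y) => m1 y1 /= <-.
  by have := IH m1; case: sweepr => m2 l2 /= ->.
case: sweepr => m1 l1 /=.
suff : ans (sweepl g m1 l1).1 = ans m1 by case: sweepl.
elim: l1 => //= y l; case: sweepl => m2 l2 /= <-.
by have := hg m2 y; case: (g m2 y).
Qed.

Definition swp pre (f g : memory -> cell -> memory * cell) w hf hg hp hf' hg' : operation :=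
  @Op (Swp pre f no_ext g) w (fun x s => swp_size pre f g x s)
      (fun x s r => @swp_frame pre f g w x s r hf hg)
      true (fun _ x s => @swp_ans pre f g x s hp hf' hg').

Definition inp (f : memory -> option isym -> memory) d (hf : forall m o, ans (f m o) = ans m) :
    operation :=
  @Op (@Inp memory cell f d) [::] (fun x s => erefl) (fun x s r _ => erefl)
      true (fun _ x s => hf _ _).

Lemma keep_frame (w : seq rg) (h : memory -> cell -> memory) (m : memory) (y : cell) i :
  i \notin w -> (h m y, y).2 i = y i.
Proof. by []. Qed.

Lemma upd_frame r (h : memory -> cell -> memory) (d : memory -> cell -> digit) m (y : cell) i :
  i \notin [:: r] -> (h m y, upd y r (d m y)).2 i = y i.
Proof. by rewrite inE updE => /negPf ->. Qed.

Lemma upd2_frame r r' (h : memory -> cell -> memory) (d d' : memory -> cell -> digit) m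
    (y : cell) i :
  i \notin [:: r; r'] -> (h m y, upd (upd y r (d m y)) r' (d' m y)).2 i = y i.
Proof. by rewrite !inE !updE negb_or => /andP[/negPf -> /negPf ->]. Qed.

Definition keep (m : memory) (y : cell) := (m, y).
(** The final carry, known only at the right end, is turned into the flag that ends loops. *)
Definition flush (m : memory) (y : cell) := (set_fl m (cy m), y).

Definition zero r : operation :=
  @swp (set_fl^~ false) (fun m y => (m, upd y r ord0)) keep [:: r]
    (upd_frame (fun m _ => m) (fun _ _ => ord0)) (@keep_frame _ (fun m _ => m))
    (fun _ => erefl) (fun _ _ => erefl) (fun _ _ => erefl).

Definition inc r : operation :=
  @swp (set_cy^~ true)
    (fun m y => (set_cy m (cy m && (y r == ord_max)),
                 upd y r (if cy m then inord ((y r).+1 %% b.+2) else y r)))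
    flush [:: r]
    (@upd_frame r (fun m y => set_cy m (cy m && (y r == ord_max)))
       (fun m y => if cy m then inord ((y r).+1 %% b.+2) else y r))
    (@keep_frame _ (fun m _ => set_fl m (cy m)))
    (fun _ => erefl) (fun _ _ => erefl) (fun _ _ => erefl).

Definition cpy r r' : operation :=
  @swp id (fun m y => (m, upd y r (y r'))) keep [:: r]
    (upd_frame (fun m _ => m) (fun _ y => y r')) (@keep_frame _ (fun m _ => m))
    (fun _ => erefl) (fun _ _ => erefl) (fun _ _ => erefl).

Definition add r r' : operation :=
  @swp (set_cy^~ false)
    (fun m y => (set_cy m (b.+2 <= y r + y r' + cy m),
                 upd y r (inord ((y r + y r' + cy m) %% b.+2))))
    keep [:: r]
    (@upd_frame r (fun m y => set_cy m (b.+2 <= y r + y r' + cy m))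
       (fun m y => inord ((y r + y r' + cy m) %% b.+2)))
    (@keep_frame _ (fun m _ => m))
    (fun _ => erefl) (fun _ _ => erefl) (fun _ _ => erefl).

Definition swap r r' : operation :=
  @swp id (fun m y => (m, upd (upd y r (y r')) r' (y r))) keep [:: r; r']
    (@upd2_frame r r' (fun m _ => m) (fun _ y => y r') (fun _ y => y r))
    (@keep_frame _ (fun m _ => m))
    (fun _ => erefl) (fun _ _ => erefl) (fun _ _ => erefl).

Definition less r r' : operation :=
  @swp (set_fl^~ false)
    (fun m y => (set_fl m ((y r < y r') || (y r == y r') && fl m), y)) keep [::]
    (@keep_frame _ (fun m y => set_fl m ((y r < y r') || (y r == y r') && fl m)))
    (@keep_frame _ (fun m _ => m))
    (fun _ => erefl) (fun _ _ => erefl) (fun _ _ => erefl).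

Definition same r r' : operation :=
  @swp (set_fl^~ true) (fun m y => (set_fl m (fl m && (y r == y r')), y)) keep [::]
    (@keep_frame _ (fun m y => set_fl m (fl m && (y r == y r'))))
    (@keep_frame _ (fun m _ => m))
    (fun _ => erefl) (fun _ _ => erefl) (fun _ _ => erefl).

Definition get r : operation :=
  @swp id keep (fun m y => (set_dg m (y r), y)) [::]
    (@keep_frame _ (fun m _ => m)) (@keep_frame _ (fun m y => set_dg m (y r)))
    (fun _ => erefl) (fun _ _ => erefl) (fun _ _ => erefl).

(** Division by the base: on the way left each cell receives the old digit of its right neighbour,
    and the dropped digit ends up in [dg]. *)
Definition shift r : operation :=
  @swp (set_dg^~ ord0) keep (fun m y => (set_dg m (y r), upd y r (dg m))) [:: r]
    (@keep_frame _ (fun m _ => m))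
    (@upd_frame r (fun m y => set_dg m (y r)) (fun m _ => dg m))
    (fun _ => erefl) (fun _ _ => erefl) (fun _ _ => erefl).

Definition hmove d : operation := @inp (fun m _ => m) d (fun _ _ => erefl).
Definition look (t : option isym -> bool) : operation :=
  @inp (fun m s => set_fl m (t s)) DS (fun _ _ => erefl).
Definition answer v : operation :=
  @Op (@Inp memory cell (fun m _ => set_ans m v) DS) [::] (fun x s => erefl)
      (fun x s r _ => erefl) false (fun h x s => False_ind _ (notF h)).

(** The only loop goes through all the values of a register. Well-formed programs therefore
    terminate on every input, even one that encodes nothing. *)
Inductive prog :=
| POp of operation
| PSeq of prog & prog
| PIf of (memory -> bool) & prog & prog
| PFor of rg & prog.

Fixpoint den x (p : prog) (s : state) : state :=
  match p with
  | POp o => exec x o s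
  | PSeq p1 p2 => den x p2 (den x p1 s)
  | PIf t p1 p2 => if t (mem s) then den x p1 s else den x p2 s
  | PFor r p1 => iter (cap s) (fun s => exec x (inc r) (den x p1 s)) (exec x (zero r) s)
  end.

(** The loop test sees only flags set by the counter: [zero r] clears the flag, and [inc r],
    executed last in each round, raises it when [r] wraps around to 0. *)
Fixpoint code (p : prog) : com memory cell :=
  match p with
  | POp o => Atom (op_atom o)
  | PSeq p1 p2 => Cseq (code p1) (code p2)
  | PIf t p1 p2 => Ite t (code p1) (code p2)
  | PFor r p1 => Cseq (Atom (zero r))
      (Whl (fun m => ~~ fl m) (Cseq (code p1) (Atom (inc r))))
  end.

Fixpoint writes (p : prog) : seq rg :=
  match p with
  | POp o => op_w o
  | PSeq p1 p2 | PIf _ p1 p2 => writes p1 ++ writes p2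
  | PFor r p1 => r :: writes p1
  end.

Fixpoint wf (p : prog) : bool :=
  match p with
  | POp _ => true
  | PSeq p1 p2 | PIf _ p1 p2 => wf p1 && wf p2
  | PFor r p1 => (r \notin writes p1) && wf p1
  end.

Lemma den_size x p s : size (tp (den x p s)) = size (tp s).
Proof.
elim: p s => [o|p1 IH1 p2 IH2|t p1 IH1 p2 IH2|r p IH] s /=.
- exact: op_size.
- by rewrite IH2.
- by case: ifP.
- elim: (cap s) => [|n IHn]; first exact: (op_size (zero r)).
  by rewrite iterS /= (op_size (inc r)) IH.
Qed.

Lemma den_frame x p s r : r \notin writes p -> reg r (den x p s) = reg r s.
Proof.
elim: p s => [o|p1 IH1 p2 IH2|t p1 IH1 p2 IH2|r' p IH] s /=.
- exact: op_frame.
- by rewrite mem_cat negb_or => /andP[h1 h2]; rewrite IH2 // IH1.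
- by rewrite mem_cat negb_or => /andP[h1 h2]; case: ifP; rewrite ?IH1 ?IH2.
- rewrite inE negb_or => /andP[h1 h2].
  elim: (cap s) => [|n IHn]; first by rewrite (op_frame (o := zero r')) ?inE.
  by rewrite iterS /= (op_frame (o := inc r')) ?inE // IH.
Qed.


Fixpoint quiet (p : prog) : bool :=
  match p with
  | POp o => op_quiet o
  | PSeq p1 p2 | PIf _ p1 p2 => quiet p1 && quiet p2
  | PFor _ p1 => quiet p1
  end.

Lemma den_ans x p s : quiet p -> ans (mem (den x p s)) = ans (mem s).
Proof.
elim: p s => [o|p1 IH1 p2 IH2|t p1 IH1 p2 IH2|r' p IH] s /=.
- by move=> h; exact: op_ans.
- by move=> /andP[h1 h2]; rewrite IH2 // IH1.
- by move=> /andP[h1 h2]; case: ifP; rewrite ?IH1 ?IH2.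
- move=> h; elim: (cap s) => [|n IHn]; first by rewrite (op_ans (o := zero r')).
  by rewrite iterS /= (op_ans (o := inc r')) ?IH.
Qed.

Lemma den_hd x p s : hd s <= (size x).+1 -> hd (den x p s) <= (size x).+1.
Proof.
elim: p s => [o|p1 IH1 p2 IH2|t p1 IH1 p2 IH2|r p IH] s /= hs.
- exact: aexec_hd.
- exact/IH2/IH1.
- by case: ifP => _; [exact: IH1|exact: IH2].
- elim: (cap s) => [|n IHn]; first exact: aexec_hd.
  by rewrite iterS; exact/aexec_hd/IH.
Qed.

Definition rdig r (l : seq cell) : seq digit := [seq y r | y : cell <- l].

Lemma sweepl_keep m l : sweepl keep m l = (m, l).
Proof. by elim: l => //= y l ->. Qed.

Lemma sweepr_keep m l : sweepr keep m l = (m, l).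
Proof. by elim: l => //= y l ->. Qed.

Lemma sweepl_flush m y l : sweepl flush m (y :: l) = (set_fl m (cy m), y :: l).
Proof. by elim: l y => //= y l IH y'; rewrite IH. Qed.

Lemma exec_keep pre f x s : exec x (Swp pre f no_ext keep) s =
  St (sweepr f (pre (mem s)) (tp s)).1 (hd s) (sweepr f (pre (mem s)) (tp s)).2.
Proof. by rewrite /aexec; case: sweepr => m l; rewrite sweepl_keep. Qed.

Lemma exec_back pre g x s : exec x (Swp pre keep no_ext g) s =
  St (sweepl g (pre (mem s)) (tp s)).1 (hd s) (sweepl g (pre (mem s)) (tp s)).2.
Proof. by rewrite /aexec sweepr_keep /no_ext; case: sweepl. Qed.

Lemma reg_zero x r s : reg r (exec x (zero r) s) = nseq (size (tp s)) ord0.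
Proof.
rewrite /= exec_keep /reg /=; elim: (tp s) (set_fl _ _) => //= y l IH m.
by move: (IH m); case: sweepr => m1 l1 /= ->; rewrite updE eqxx.
Qed.

Lemma val_zero x r s : rval r (exec x (zero r) s) = 0.
Proof. by rewrite /rval reg_zero num_nseq0. Qed.

Lemma fl_zero x r s : fl (mem (exec x (zero r) s)) = false.
Proof.
rewrite /= exec_keep /=; have : fl (set_fl (mem s) false) = false by [].
elim: (tp s) (set_fl _ _) => //= y l IH m /IH.
by case: sweepr.
Qed.

Lemma reg_cpy x r r' s : reg r (exec x (cpy r r') s) = reg r' s.
Proof.
rewrite /= exec_keep /reg /=; elim: (tp s) (mem s) => //= y l IH m.
by move: (IH m); case: sweepr => m1 l1 /= ->; rewrite updE eqxx.
Qed.

Lemma reg_swap x r r' s :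
  reg r (exec x (swap r r') s) = reg r' s /\ reg r' (exec x (swap r r') s) = reg r s.
Proof.
rewrite /= exec_keep /reg /=; elim: (tp s) (mem s) => //= y l IH m.
move: (IH m); case: sweepr => m1 l1 /= [-> ->]; rewrite !updE !eqxx.
by case: eqP => [->|].
Qed.

Lemma carry_digit (n : nat) : n < b.+2 * 2 ->
  (inord (n %% b.+2) : digit) + b.+2 * (b.+2 <= n) = n :> nat.
Proof.
move=> h; rewrite inordK ?ltn_pmod //.
case: (ltnP n b.+2) => hn; first by rewrite modn_small ?muln0 ?addn0.
have -> : n = n - b.+2 + b.+2 by rewrite subnK.
by rewrite modnDr modn_small ?muln1 //; lia.
Qed.

Lemma num_inc x r s : let s' := exec x (inc r) s in 0 < size (tp s) ->
  rval r s' + fl (mem s') * cap s = (rval r s).+1.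
Proof.
case: s => m h l /=; rewrite /aexec /rval /reg /cap /= => h0.
set f := fun (m : memory) (y : cell) => _.
have : num (rdig r (sweepr f (set_cy m true) l).2) +
    cy (sweepr f (set_cy m true) l).1 * b.+2 ^ size l = num (rdig r l) + true.
  have -> : num (rdig r l) + true = num (rdig r l) + cy (set_cy m true) by [].
  elim: l (set_cy m true) {h0} => [|y l IH] m' /=.
    by rewrite muln1.
  move: (IH (f m' y).1); rewrite [f m' y]/f.
  case: sweepr => m1 l1 /=; rewrite updE eqxx expnS => e.
  have : (if cy m' then inord ((y r).+1 %% b.+2) else y r : digit) +
      b.+2 * (cy m' && (y r == ord_max)) = y r + cy m' :> nat.
    case: (cy m') => /=; last by rewrite muln0.
    rewrite -val_eqE /= addn1 -[RHS]carry_digit; first by rewrite eqn_leq -ltnS ltn_ord.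
    by apply: (leq_ltn_trans (ltn_ord (y r))); rewrite muln2 -addnn -[X in X < _]addn0 ltn_add2l.
  move: e; rewrite [cy (_, _).1]/=.
  move: (nat_of_ord (if _ then _ else _)) (num _) (num _) (nat_of_bool (_ && _)) => d A A' c e.
  by rewrite (mulnCA (cy m1)) -addnA -mulnDr e mulnDr addnCA => ->; rewrite addnA (addnC (_ * A)).
rewrite addn1; have := size_sweepr f (set_cy m true) l; case: sweepr => m1 l1 /= hs.
by case: l1 hs => [e|y1 l1 _] <-; [rewrite -e in h0|rewrite sweepl_flush].
Qed.

Lemma val_inc x r s : let s' := exec x (inc r) s in 0 < size (tp s) ->
  rval r s' = (if (rval r s).+1 == cap s then 0 else (rval r s).+1) /\
  fl (mem s') = ((rval r s).+1 == cap s).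
Proof.
move=> s' h0; have e := num_inc x r h0; rewrite -/s' in e.
have h1 := val_lt r s'; have h2 := val_lt r s.
have hc : cap s' = cap s by rewrite /cap (op_size (inc r)).
rewrite hc in h1; move: e; case: (fl _); rewrite ?mul1n ?mul0n => e; case: eqP => //; lia.
Qed.

Lemma num_add x r r' s : let s' := exec x (add r r') s in
  exists c, rval r s' + c * cap s = rval r s + rval r' s.
Proof.
case: s => m h l /=; rewrite exec_keep /rval /reg /cap /=.
set f := fun (m : memory) (y : cell) => _.
exists (cy (sweepr f (set_cy m false) l).1).
rewrite -[RHS]addn0 -[X in _ = _ + X]/(nat_of_bool (cy (set_cy m false))).
elim: l (set_cy m false) => [|y l IH] m' /=.
  by rewrite muln1.
move: (IH (f m' y).1); rewrite [f m' y]/f.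
case: sweepr => m1 l1 /=; rewrite updE eqxx expnS => e.
have hd : y r + y r' + cy m' < b.+2 * 2.
  rewrite muln2 -addnn -addnA -addSn leq_add ?ltn_ord //.
  by case: (cy m'); rewrite ?addn1 ?addn0 // ltnW.
have := carry_digit hd.
move: e; rewrite [cy (_, _).1]/=.
move: (nat_of_ord (inord _)) (num _) (num _) (num _) (nat_of_bool (_ <= _)) => d A A1 A2 c e.
move=> e2; rewrite (mulnCA (cy m1)) -(addnA d) -mulnDr e.
have -> : d + b.+2 * (A1 + A + c) = d + b.+2 * c + b.+2 * (A1 + A) by rewrite !mulnDr; lia.
rewrite e2 mulnDr.
move: (nat_of_ord (y r)) (nat_of_ord (y r')) (b.+2 * A1) (b.+2 * A) (nat_of_bool _).
by clear=> *; lia.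
Qed.

Lemma val_add x r r' s : rval r s + rval r' s < cap s ->
  rval r (exec x (add r r') s) = rval r s + rval r' s.
Proof.
move=> h; have [c e] := num_add x r r' s.
by case: c e => [|c]; nia.
Qed.

Lemma fl_less x r r' s : fl (mem (exec x (less r r') s)) = (rval r s < rval r' s).
Proof.
case: s => m h l /=; rewrite exec_keep /rval /reg /=.
set f := fun (m : memory) (y : cell) => _.
(* The sweep meets the more significant digits later: a strict comparison overrides the flag,
   equality keeps it. The induction thus needs an arbitrary initial flag. *)
have -> : num (rdig r l) < num (rdig r' l) = (num (rdig r l) < num (rdig r' l)) ||
    (num (rdig r l) == num (rdig r' l)) && fl (set_fl m false) by rewrite andbF orbF.
elim: l (set_fl m false) => [|y l IH] m' //=.
move: (IH (f m' y).1); rewrite [f m' y]/f.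
case: sweepr => m1 l1 /= ->; rewrite [fl (set_fl _ _)]/=.
have := ltn_ord (y r); have := ltn_ord (y r'); rewrite -(inj_eq val_inj) /=.
move: (nat_of_ord (y r)) (nat_of_ord (y r')) (num _) (num _) => d d' A' A.
case: (ltngtP A A') => hA h1 h2 /=.
- have h3 : b.+2 * A.+1 <= b.+2 * A' by rewrite leq_mul2l hA orbT.
  suff -> : d + b.+2 * A < d' + b.+2 * A' by [].
  by move: h3 h2; rewrite mulnS; clear; lia.
- have h3 : b.+2 * A'.+1 <= b.+2 * A by rewrite leq_mul2l hA orbT.
  suff h4 : d' + b.+2 * A' < d + b.+2 * A by rewrite ltnNge (ltnW h4) gtn_eqF.
  by move: h3 h1; rewrite mulnS; clear; lia.
- by rewrite hA ltn_add2r eqn_add2r.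
Qed.

Lemma fl_same x r r' s : fl (mem (exec x (same r r') s)) = (rval r s == rval r' s).
Proof.
case: s => m h l /=; rewrite exec_keep /rval /reg /=.
set f := fun (m : memory) (y : cell) => _.
have -> : (num (rdig r l) == num (rdig r' l)) =
    fl (set_fl m true) && (rdig r l == rdig r' l).
  by apply/eqP/eqP => [|-> //]; apply: num_inj; rewrite !size_map.
elim: l (set_fl m true) => [|y l IH] m' /=; first by rewrite andbT.
move: (IH (f m' y).1); rewrite [f m' y]/f.
by case: sweepr => m1 l1 /= ->; rewrite eqseq_cons andbA.
Qed.

Lemma sweepl_get r m l :
  sweepl (fun m (y : cell) => (set_dg m (y r), y)) m l = (set_dg m (head (dg m) (rdig r l)), l).
Proof. by elim: l m => [|y l IH] [[[? ?] ?] ?] //=; rewrite IH. Qed.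

Lemma dg_get x r s : 0 < size (tp s) ->
  dg (mem (exec x (get r) s)) = head ord0 (reg r s).
Proof.
by case: s => m h l h0; rewrite /= exec_back sweepl_get /=; case: l h0.
Qed.

Lemma sweepl_shift r m l :
  let: (m', l') := sweepl (fun m (y : cell) => (set_dg m (y r), upd y r (dg m))) m l in
  dg m' = head (dg m) (rdig r l) /\ rdig r l' = behead (rcons (rdig r l) (dg m)).
Proof.
elim: l m => [|y l IH] m //=; case: sweepl (IH m) => m' l' [e1 e2] /=.
rewrite updE eqxx /= e1 e2; split=> //.
by case: l {IH e1 e2}.
Qed.

Lemma shift_spec x r s : let s' := exec x (shift r) s in
  dg (mem s') = head ord0 (reg r s) /\ reg r s' = behead (rcons (reg r s) ord0).
Proof.
case: s => m h l; rewrite /= exec_back /=.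
by have := sweepl_shift r (set_dg m ord0) l; case: sweepl.
Qed.

Section Loop.
Variables (x : seq isym) (r : rg) (p : prog) (s : state).
Hypotheses (hr : r \notin writes p) (h0 : 0 < size (tp s)).
Let s_ j := iter j (fun s => exec x (inc r) (den x p s)) (exec x (zero r) s).

Let size_ j : size (tp (s_ j)) = size (tp s).
Proof.
by elim: j => [|j IH]; rewrite ?(op_size (zero r)) // /s_ iterS (op_size (inc r)) den_size.
Qed.

Let val_ j : j <= cap s ->
  rval r (s_ j) = (if j == cap s then 0 else j) /\ fl (mem (s_ j)) = (j == cap s).
Proof.
elim: j => [_|j IH hj].
  by rewrite [s_ 0]/= val_zero fl_zero eq_sym expn_eq0.
have [e _] := IH (ltnW hj); rewrite ltn_eqF // in e.
have hs : size (tp (den x p (s_ j))) = size (tp s) by rewrite den_size.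
have hv : rval r (den x p (s_ j)) = j by rewrite /rval den_frame.
have := @val_inc x r (den x p (s_ j)); rewrite hs => /(_ h0).
by rewrite hv /cap hs.
Qed.

Lemma for_ind (Inv : nat -> state -> Prop) :
  Inv 0 (exec x (zero r) s) ->
  (forall j s', j < cap s -> size (tp s') = size (tp s) -> rval r s' = j -> Inv j s' ->
     Inv j.+1 (exec x (inc r) (den x p s'))) ->
  Inv (cap s) (den x (PFor r p) s).
Proof.
move=> i0 iS; rewrite [den _ _ _]/=.
suff H j : j <= cap s -> Inv j (s_ j) by exact: (H _ (leqnn _)).
elim: j => [_|j IH hj]; first exact: i0.
apply: iS => //; last exact/IH/ltnW.
by have [-> _] := val_ (ltnW hj); rewrite ltn_eqF.
Qed.

Lemma big_for W : size (tp s) <= W ->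
  (forall s', size (tp s') = size (tp s) -> big cell0 x W (code p) s' (den x p s')) ->
  big cell0 x W (code (PFor r p)) s (den x (PFor r p) s).
Proof.
move=> hW hp; rewrite [den _ _ _]/= [code _]/=.
apply: (@BSeq _ _ _ _ _ _ _ _ (s_ 0)); first by apply: BAtom; rewrite (op_size (zero r)).
rewrite -/(s_ (cap s)); set w := Whl _ _.
suff H n : n <= cap s -> big cell0 x W w (s_ (cap s - n)) (s_ (cap s)).
  by have := H _ (leqnn _); rewrite subnn.
elim: n => [|n IH] hn.
  rewrite subn0; apply: BWhlF; rewrite negbK.
  by have [_ ->] := val_ (leqnn _); rewrite eqxx.
have hlt : cap s - n.+1 < cap s by rewrite ltn_subrL /= expn_gt0.
apply: (@BWhlT _ _ _ _ _ _ _ _ (s_ (cap s - n))).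
- by have [_ ->] := val_ (ltnW hlt); rewrite ltn_eqF.
- have -> : s_ (cap s - n) = exec x (inc r) (den x p (s_ (cap s - n.+1))).
    by rewrite -subSS subSn.
  apply: BSeq (hp _ (size_ _)) _.
  by apply: BAtom; rewrite (op_size (inc r)) den_size size_.
- exact/IH/ltnW.
Qed.

End Loop.

Lemma den_big x W p s : wf p -> 0 < size (tp s) -> size (tp s) <= W ->
  big cell0 x W (code p) s (den x p s).
Proof.
move=> + h0 hW; elim: p s h0 hW => [o|p1 IH1 p2 IH2|t p1 IH1 p2 IH2|r p IH] s h0 hW.
- by move=> _; apply: BAtom; rewrite op_size.
- move=> /= /andP[w1 w2]; apply: BSeq (IH1 _ h0 hW w1) _.
  by apply: IH2; rewrite ?den_size.
- move=> /= /andP[w1 w2]; case: ifP => ht; first by apply: BIteT => //; exact: IH1.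
  by apply: BIteF; rewrite ?ht //; exact: IH2.
- move=> /andP[hr w]; apply: big_for => // s' e.
  by apply: IH; rewrite ?e.
Qed.

End Registers.

Arguments set_fl {b}. Arguments set_cy {b}. Arguments set_dg {b}. Arguments set_ans {b}.
Arguments zero {k b}. Arguments inc {k b}. Arguments cpy {k b}. Arguments add {k b}.
Arguments swap {k b}. Arguments less {k b}. Arguments same {k b}. Arguments get {k b}.
Arguments shift {k b}. Arguments hmove {k b}. Arguments look {k b}. Arguments answer {k b}.

(** * Marking out a tape of logarithmic width *)

Section Counting.
Variables (k b : nat).
Notation digit := 'I_b.+2.
Notation rg := 'I_k.
Notation memory := (memory b).
Notation cell := (cell k b).
Notation cell0 := (cell0 k b).
Notation state := (st memory cell).
#[local] Arguments aexec : simpl never.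

(* A binary counter which, when it overflows, is reset with one more cell. *)
Definition tick_cell (r : rg) (m : memory) (y : cell) : memory * cell :=
  if cy m then
    if y r == ord0 then (set_cy m false, upd y r (inord 1)) else (m, upd y r ord0)
  else (m, y).

Definition tick (r : rg) : atom memory cell :=
  Swp (set_cy^~ true) (tick_cell r) (@cy b) (@keep k b).

Definition count_loop (t : option isym -> bool) (r : rg) : com memory cell :=
  Whl (@fl b) (Cseq (Atom (tick r)) (Cseq (Atom (hmove DR)) (Atom (look t)))).

Definition count (t : option isym -> bool) (r : rg) : com memory cell :=
  Cseq (Atom (hmove DR)) (Cseq (Atom (look t)) (count_loop t r)).

Definition bnum (r : rg) (l : seq cell) := foldr (fun (y : cell) n => (y r != ord0) + 2 * n) 0 l.

Lemma bnum_lt r l : bnum r l < 2 ^ size l.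
Proof. by elim: l => //= y l IH; rewrite expnS; case: (_ != _) => /=; lia. Qed.

Lemma bnum_rcons r l : bnum r (rcons l cell0) = bnum r l.
Proof. by elim: l => //= [|y l ->] //; rewrite ffunE eqxx. Qed.

Lemma tick_sweep r m l : let: (m', l') := sweepr (tick_cell r) m l in
  bnum r l' + cy m' * 2 ^ size l = bnum r l + cy m.
Proof.
elim: l m => [|y l IH] m /=; first by rewrite muln1.
rewrite /tick_cell; case em : (cy m); last first.
  move: (IH m); case: sweepr => m' l' /=; rewrite em expnS; nia.
case: eqVneq => /= [e|ne].
  move: (IH (set_cy m false)); case: sweepr => m' l' /=.
  rewrite updE eqxx -val_eqE /= inordK //= expnS; nia.
move: (IH m); case: sweepr => m' l' /=.
by rewrite updE !eqxx em expnS /=; nia.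
Qed.

Lemma tick_ans r m l : ans (sweepr (tick_cell r) m l).1 = ans m.
Proof.
elim: l m => //= y l IH m.
have : ans (tick_cell r m y).1 = ans m by rewrite /tick_cell; do 2?case: ifP.
by case: (tick_cell r m y) => m1 y1 /= <-; move: (IH m1); case: sweepr.
Qed.

(** [2 ^ size + bnum] reads the counter with an implicit leading 1. An overflow clears all the
    digits and appends a zero cell, which is again an increment by one. *)
Lemma tick_spec x r s n : 2 ^ size (tp s) + bnum r (tp s) = n ->
  let s' := aexec cell0 x (tick r) s in
  [/\ 2 ^ size (tp s') + bnum r (tp s') = n.+1, hd s' = hd s & ans (mem s') = ans (mem s)].
Proof.
case: s => m h l /= <-; rewrite /aexec /=.
have := tick_sweep r (set_cy m true) l; have := tick_ans r (set_cy m true) l.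
have := size_sweepr (tick_cell r) (set_cy m true) l.
case: sweepr => m1 l1 /= <- ha; rewrite sweepl_keep /= ha addn1.
case: (cy m1) => /= e; split=> //; last by lia.
by rewrite size_rcons bnum_rcons expnS; have := bnum_lt r l; have := bnum_lt r l1; lia.
Qed.

(* On an encoded graph the count stops at the first separator, so the width of the
   tape depends on the number of vertices only. *)
Lemma count_big x (t : option isym -> bool) q r m W :
  (forall w, 2 ^ w <= q + 2 -> w <= W) -> q <= size x ->
  (forall i, i < q -> t (read_input x i.+1)) -> ~~ t (read_input x q.+1) ->
  exists s', [/\ big cell0 x W (count t r) (St m 0 [:: cell0]) s', ans (mem s') = ans m,
    hd s' <= (size x).+1 & 2 ^ size (tp s') <= q + 2 < 2 ^ (size (tp s')).+1].
Proof.
move=> hW hq ht hnt.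
(* [j] symbols remain to be counted. The single initial zero cell already reads 2, hence the
   [+ 2]. *)
suff H j s : j <= q -> hd s = (q - j).+1 -> fl (mem s) = (0 < j) ->
    2 ^ size (tp s) + bnum r (tp s) = (q - j) + 2 ->
    exists s', [/\ big cell0 x W (count_loop t r) s s', ans (mem s') = ans (mem s),
    hd s' <= (size x).+1 & 2 ^ size (tp s') + bnum r (tp s') = q + 2].
  have h1 : 1 <= W by apply: hW; rewrite addn2.
  pose s1 := aexec cell0 x (hmove DR) (St m 0 [:: cell0]).
  pose s2 := aexec cell0 x (look t) s1.
  have [||||s' [hb ha hh hs]] := H q s2 => //.
  - by rewrite /s2 /s1 /aexec /= !minnSS !min0n subnn.
  - rewrite /s2 /s1 /aexec /= minnSS min0n; case: (posnP q) => q0; last exact: ht.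
    by rewrite q0 in hnt; exact: negPf.
  - by rewrite subnn /s2 /s1 /aexec /= ffunE.
  exists s'; split=> //; last by have := bnum_lt r (tp s'); rewrite expnS; lia.
  by apply: BSeq; [exact: BAtom|apply: BSeq hb; exact: BAtom].
elim: j s => [|j IH] s hj hh hf hs.
  by exists s; rewrite hh subn0; split=> //; [apply: BWhlF; rewrite hf|rewrite hs subn0].
have [h1 h2 h3] := tick_spec x hs; set s1 := aexec _ _ _ _ in h1 h2 h3.
pose s2 := aexec cell0 x (hmove DR) s1.
have h1W : size (tp s1) <= W by apply: hW; lia.
have b1 : big cell0 x W (Atom (tick r)) s s1 by exact: BAtom.
have b2 : big cell0 x W (Atom (hmove DR)) s1 s2 by exact: BAtom.
have t2 : tp s2 = tp s1 by [].
have a2 : ans (mem s2) = ans (mem s1) by [].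
have e2 : hd s2 = (q - j).+1 by rewrite /s2 /aexec /= h2 hh minnSS; lia.
move: s2 b2 t2 a2 e2 => s2 b2 t2 a2 e2.
have [||||s' [hb ha hh' hs']] := IH (aexec cell0 x (look t) s2); first exact: ltnW.
- by rewrite /aexec /= e2; lia.
- rewrite /aexec [fl _]/= e2; case: (posnP j) => j0; last by apply: ht; lia.
  by rewrite j0 subn0; exact: negPf.
- by rewrite /aexec /= t2 h1; lia.
exists s'; split=> //; last by rewrite ha -h3 -a2.
apply: BWhlT hb; first by rewrite hf.
apply: BSeq b1 _; apply: BSeq b2 _; apply: BAtom.
by rewrite /aexec /= t2.
Qed.

End Counting.

(** * The program *)

Notation "p1 ;; p2" := (PSeq p1 p2) (at level 61, right associativity).

Section Program.
Variables (D : finType) (d0 : D) (p : nat) (b : nat).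
Notation K := (p.+1.-tuple D).
Notation digit := 'I_b.+2.
Notation memory := (memory b).
Notation k := 16.
Notation cell := (cell k b).
Notation cell0 := (cell0 k b).
Notation state := (st memory cell).
Notation prog := (prog k b).
Variables (g : D -> K -> K) (op : K -> 'I_3) (dec : digit -> K) (enc : K -> digit).
Hypothesis encK : cancel enc dec.
Hypothesis hb : 2 * p.+1 <= b.+2.
#[local] Arguments aexec : simpl never.

(* [rN], [rX], [rY] hold the input; [rU], [rV] the current state of the walk, [rS]
   its starting vertex, [rA0] the initial labels of all levels, [rB] the labels
   fed to the last level; [rA], [rP], [rC] the odometer. *)
Definition rN : 'I_k := @Ordinal 16 0 isT.
Definition rU : 'I_k := @Ordinal 16 1 isT.
Definition rV : 'I_k := @Ordinal 16 2 isT.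
Definition rX : 'I_k := @Ordinal 16 3 isT.
Definition rY : 'I_k := @Ordinal 16 4 isT.
Definition rS : 'I_k := @Ordinal 16 5 isT.
Definition rA0 : 'I_k := @Ordinal 16 6 isT.
Definition rB : 'I_k := @Ordinal 16 7 isT.
Definition rA : 'I_k := @Ordinal 16 8 isT.
Definition rP : 'I_k := @Ordinal 16 9 isT.
Definition rT : 'I_k := @Ordinal 16 10 isT.
Definition rC : 'I_k := @Ordinal 16 11 isT.
Definition rI : 'I_k := @Ordinal 16 12 isT.
Definition rJ : 'I_k := @Ordinal 16 13 isT.
Definition rH : 'I_k := @Ordinal 16 14 isT.
Definition rW : 'I_k := @Ordinal 16 15 isT.

Definition mark_cell (m : memory) (y : cell) : memory * cell :=
  (set_cy m (cy m && (p <= y rP)), upd y rT (if cy m then inord 1 else ord0)).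

Definition odo_cell (m : memory) (y : cell) : memory * cell :=
  (set_dg m (y rA),
   upd (upd y rA (if y rT != ord0 then enc (g (nth d0 (dec (dg m)) (y rP)) (dec (y rA))) else y rA))
     rP (if y rT != ord0 then (if y rP < p then inord (y rP).+1 else ord0) else y rP)).

Lemma mark_frame m (y : cell) i : i \notin [:: rA; rP; rT] -> (mark_cell m y).2 i = y i.
Proof. by rewrite !inE !negb_or updE => /and3P[_ _ /negPf ->]. Qed.

Lemma odo_frame m (y : cell) i : i \notin [:: rA; rP; rT] -> (odo_cell m y).2 i = y i.
Proof. by rewrite !inE !negb_or !updE => /and3P[/negPf -> /negPf -> _]. Qed.

(* The first sweep marks the cells reached by the carry; the second one updates
   them, each cell needing the old label stored in the next one. *)
Definition odometer : operation k b :=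
  @swp k b (set_cy^~ true) mark_cell odo_cell [:: rA; rP; rT] mark_frame odo_frame
    (fun _ => erefl) (fun _ _ => erefl) (fun _ _ => erefl).

Definition cells (l : seq cell) : seq (K * nat) :=
  [seq (dec (y rA), nat_of_ord (y rP)) | y : cell <- l].

(** Both sweeps are followed in one induction. When the leftward sweep comes back to a cell, [dg]
    holds the old label of the cell on its right, which is the label that [odo] consults there; at
    the right end [dg] plays the part of [lab]. *)
Lemma odo_sweep R (lab : R -> K) (carry : R -> R) (r : R) (m : memory) l : lab r = dec (dg m) ->
  let: (m1, l1) := sweepr mark_cell m l in
  let: (m2, l2) := sweepl odo_cell m1 l1 in
  [/\ cy m2 = cy m1, dg m1 = dg m, dec (dg m2) = label lab (cells l) r,
      cells l2 = (if cy m then (odo d0 g lab carry (cells l) r).1 else cells l) &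
      if cy m then (odo d0 g lab carry (cells l) r).2 = (if cy m1 then carry r else r)
      else cy m1 = false].
Proof.
move=> hl; elim: l m hl => [|y l IH] m hl /=; first by split=> //; case: (cy m).
set c := cy m; have := IH (set_cy m (c && (p <= y rP))) hl.
case: sweepr => m1 l1 /=.
have [m2 [l2 e]] : exists m2 l2, sweepl odo_cell m1 l1 = (m2, l2).
  by case: sweepl => m2 l2; exists m2, l2.
rewrite !e => -[h1 h2 h3 h4 h5] /=.
rewrite !updE !eqxx /= h3 h4 /=.
case: c h2 h5 {h4} => /= h2; last by rewrite ?eqxx => h5; split.
rewrite -val_eqE /= inordK // leqNgt; have hp := ltn_ord (y rP).
case: ltnP => /= hy h5.
  rewrite encK inordK; first by split=> //; rewrite h5.
  by apply: (leq_trans (_ : _ <= p.+1)) => //; apply: leq_trans hb; rewrite leq_pmull.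
move: h5; case: odo => l3 r3 /= ->.
by rewrite encK.
Qed.

Definition skip : prog := POp (hmove DS).
Definition step_odo : prog :=
  POp (get rC) ;; POp odometer ;; PIf (@cy b) (POp (shift rC)) skip.

Lemma cells_reg (s : state) :
  cells (tp s) = [seq (dec z.1, nat_of_ord z.2) | z <- zip (reg rA s) (reg rP s)].
Proof. by rewrite /reg /cells; elim: (tp s) => //= y l ->. Qed.

(** The driver of the last level: a register whose digits are its successive labels. *)
Definition rlab (r : seq digit) : K := dec (head ord0 r).
Definition rcarry (r : seq digit) : seq digit := behead (rcons r ord0).

Lemma aexec_swp_hd x pre f e g' (s : state) : hd (aexec cell0 x (Swp pre f e g') s) = hd s.
Proof. by rewrite /aexec; case: sweepr => m1 l1; case: sweepl. Qed.

Lemma tp_get x r (s : state) : tp (aexec cell0 x (get r) s) = tp s.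
Proof. by case: s => m h l; rewrite /= exec_back sweepl_get. Qed.

Lemma reg_tp r (s s' : state) : tp s = tp s' -> reg r s = reg r s'.
Proof. by rewrite /reg => ->. Qed.

Lemma odo_spec x (s : state) : 0 < size (tp s) ->
  let s' := den x step_odo s in
  (cells (tp s'), reg rC s') = odo d0 g rlab rcarry (cells (tp s)) (reg rC s).
Proof.
move=> h0; rewrite /=; set s1 := aexec cell0 x (get rC) s.
have ed : dg (mem s1) = head ord0 (reg rC s) by exact: dg_get.
have et : tp s1 = tp s by exact: tp_get.
rewrite -(reg_tp rC et) -et in ed *.
move: s1 ed {et} => [m h l] /= ed.
have [hc hC] : cells (tp (aexec cell0 x odometer (St m h l))) =
      (odo d0 g rlab rcarry (cells l) (reg rC (St m h l))).1 /\
    (odo d0 g rlab rcarry (cells l) (reg rC (St m h l))).2 =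
      (if cy (mem (aexec cell0 x odometer (St m h l))) then rcarry (reg rC (St m h l))
       else reg rC (St m h l)).
  have := @odo_sweep _ rlab rcarry (reg rC (St m h l)) (set_cy m true) l (congr1 dec (esym ed)).
  rewrite /aexec /= /no_ext; case: sweepr => m1 l1.
  by case: sweepl => m2 l2 /= [-> _ _ -> ->].
have fr : reg rC (aexec cell0 x odometer (St m h l)) = reg rC (St m h l).
  exact: (@op_frame _ _ odometer x (St m h l) rC isT).
move: (aexec _ _ _ _) hc hC fr => s2 hc hC fr.
rewrite [odo _ _ _ _ _ _]surjective_pairing -hc hC -fr.
case: (cy (mem s2)); last by [].
have [_ e2] := shift_spec x rC s2; congr (_, _); last exact: e2.
by rewrite !cells_reg !(op_frame (o := shift rC)).
Qed.

Lemma fl_look x t (s : state) : fl (mem (aexec cell0 x (look t) s)) = t (read_input x (hd s)).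
Proof. by []. Qed.

Lemma hd_look x t (s : state) : hd s <= (size x).+1 -> hd (aexec cell0 x (look t) s) = hd s.
Proof. exact: minn_idPl. Qed.

Lemma hd_right x (s : state) : hd s <= size x -> hd (aexec cell0 x (hmove DR) s) = (hd s).+1.
Proof. by move=> h; apply/minn_idPl. Qed.

Lemma hd_stay x (s : state) : hd s <= (size x).+1 -> hd (aexec cell0 x (hmove DS) s) = hd s.
Proof. exact: minn_idPl. Qed.

Lemma skip_id x (s : state) : hd s <= (size x).+1 -> den x skip s = s.
Proof. by case: s => m h l hh; rewrite /= /aexec /= (minn_idPl hh). Qed.

Lemma cap_size (s s' : state) : size (tp s') = size (tp s) -> cap s' = cap s.
Proof. by rewrite /cap => ->. Qed.

Definition home : prog := PFor rJ (POp (hmove DL)).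
(** A loop always makes [cap] rounds; the comparison leaves idle all but the first [rval c] of
    them. *)
Definition upto r c body : prog := PFor r (POp (less r c) ;; PIf (@fl b) body skip).
(** Access to row [a], column [d] of a matrix with [c] columns. The last move is due to the left
    marker: the input symbol of index [i] lies at position [i + 1]. *)
Definition goto a c d : prog :=
  home ;; upto rJ a (upto rH c (POp (hmove DR))) ;; upto rJ d (POp (hmove DR)) ;; POp (hmove DR).

Lemma home_hd x (s : state) : 0 < size (tp s) -> hd s <= cap s -> hd s <= (size x).+1 ->
  hd (den x home s) = 0.
Proof.
move=> h0 hs hx; have : hd (den x home s) = hd s - cap s; last by move=> ->; apply/eqP.
apply: (@for_ind k b x rJ (POp (hmove DL)) s isT h0 (fun j s' => hd s' = hd s - j)).
  by rewrite aexec_swp_hd subn0.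
move=> j s' _ _ _ e; rewrite aexec_swp_hd /= /aexec /= e subnS.
by apply/minn_idPl; apply: leq_trans (leq_pred _) _; apply: leq_trans (leq_subr _ _) _.
Qed.

Lemma upto_hd x r c body w (s : state) : 0 < size (tp s) -> r \notin c :: writes body ->
  c \notin writes body ->
  (forall s', (forall r', r' \notin r :: writes body -> reg r' s' = reg r' s) ->
     size (tp s') = size (tp s) -> hd s' + w <= (size x).+1 -> hd (den x body s') = hd s' + w) ->
  hd s + rval c s * w <= (size x).+1 ->
  hd (den x (upto r c body) s) = hd s + rval c s * w.
Proof.
move=> h0; rewrite inE negb_or => /andP[nrc nr] nc hbody hx.
have frb : r \notin writes (POp (less r c) ;; PIf (@fl b) body skip) by rewrite /= cats0.
pose Inv j (s' : state) := (forall r', r' \notin r :: writes body -> reg r' s' = reg r' s) /\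
  hd s' = hd s + minn j (rval c s) * w.
suff [_ ->] : Inv (cap s) (den x (upto r c body) s).
  by rewrite (minn_idPr (ltnW (val_lt c s))).
apply: for_ind => //.
  split; last by rewrite aexec_swp_hd min0n mul0n addn0.
  move=> r'; rewrite inE negb_or => /andP[ne _].
  by rewrite (op_frame (o := zero r)) // inE.
move=> j s' hj hs hv [hr hh]; set s1 := aexec cell0 x (less r c) s'.
have fr1 r' : reg r' s1 = reg r' s' by exact: (op_frame (o := less r c)).
have hs1 : size (tp s1) = size (tp s') by exact: (op_size (less r c)).
have hh1 : hd s1 = hd s' by exact: aexec_swp_hd.
have hc : rval c s' = rval c s by rewrite /rval hr // inE negb_or eq_sym nrc.
have hf : fl (mem s1) = (j < rval c s) by rewrite /s1 fl_less hv hc.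
rewrite /= -/s1 hf /Inv aexec_swp_hd; split.
  move=> r' nr'; rewrite (op_frame (o := inc r)); last first.
    by move: nr'; rewrite /= !inE negb_or => /andP[].
  move: nr'; rewrite inE negb_or => /andP[ne nb].
  case: ifP => _; first by rewrite den_frame // fr1 hr // inE negb_or ne.
  by rewrite (op_frame (o := hmove DS)) // fr1 hr // inE negb_or ne.
case: ltnP => hjc; last first.
  have hle : hd s1 <= (size x).+1 by rewrite hh1 hh (minn_idPr hjc).
  by rewrite hd_stay // hh1 hh (minn_idPr hjc) (minn_idPr (leqW hjc)).
have e1 : minn j (rval c s) = j by apply/minn_idPl/ltnW.
have e2 : minn j.+1 (rval c s) = j.+1 by apply/minn_idPl.
rewrite e2 mulSn addnCA addnC hbody ?hh1 ?hh ?e1 //.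
- by move=> r' nr'; rewrite fr1 hr.
- by rewrite hs1.
- rewrite -addnA; apply: leq_trans hx; rewrite leq_add2l addnC -mulSn leq_mul2r hjc orbT //.
Qed.

Lemma goto_hd x a c d (s : state) : 0 < size (tp s) -> (size x).+1 <= cap s ->
  hd s <= (size x).+1 -> all (fun r => r \notin [:: rJ; rH]) [:: a; c; d] ->
  rval a s * rval c s + rval d s <= size x ->
  hd (den x (goto a c d) s) = (rval a s * rval c s + rval d s).+1.
Proof.
move=> h0 hcap hs /= /and4P[na nc nd _] hx.
set s1 := den x home s; have hs1 : size (tp s1) = size (tp s) by rewrite /s1 den_size.
have r1 r : r != rJ -> rval r s1 = rval r s.
  by move=> ne; rewrite /rval den_frame //= inE.
have hd1 : hd s1 = 0 by apply: home_hd => //; apply: leq_trans hs hcap.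
rewrite !inE !negb_or in na nc nd.
case/andP: na => na na'; case/andP: nc => nc nc'; case/andP: nd => nd nd'.
have hd2 : hd (den x (upto rJ a (upto rH c (POp (hmove DR)))) s1) = rval a s * rval c s.
  rewrite (@upto_hd x rJ a _ (rval c s)) ?hd1 ?add0n ?r1 ?hs1 //.
  - by rewrite /= !inE eq_sym negb_or na.
  - by rewrite /= inE.
  - move=> s' fr hs' hh.
    have ec : rval c s' = rval c s by rewrite /rval fr -/(rval _ _) ?r1 // !inE negb_or nc.
    rewrite (@upto_hd x rH c _ 1) ?muln1 ?ec ?hs' ?hs1 //=.
      by rewrite inE eq_sym nc'.
    by move=> s2 _ _; rewrite addn1 => h2; exact: hd_right.
  - by apply: leq_trans (leq_addr _ _) (leqW hx).
set s2 := den x (upto rJ a _) s1 in hd2.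
have hs2 : size (tp s2) = size (tp s) by rewrite /s2 den_size.
have ed : rval d s2 = rval d s.
  by rewrite /rval den_frame -/(rval d s1) ?r1 //= !inE negb_or nd nd'.
have hd3 : hd (den x (upto rJ d (POp (hmove DR))) s2) = rval a s * rval c s + rval d s.
  rewrite (@upto_hd x rJ d _ 1) ?muln1 ?ed ?hd2 ?hs2 //=.
  - by rewrite inE eq_sym nd.
  - by move=> s3 _ _; rewrite addn1 => h2; exact: hd_right.
  - exact: leqW.
change (hd (aexec cell0 x (hmove DR) (den x (upto rJ d (POp (hmove DR))) s2)) =
  (rval a s * rval c s + rval d s).+1).
by rewrite hd_right hd3.
Qed.

End Program.

(** * Decoding the input *)

Section Setup.
Variable b : nat.
Notation memory := (memory b).
Notation cell := (cell 16 b).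
Notation cell0 := (cell0 16 b).
Notation state := (st memory cell).
Notation prog := (prog 16 b).
Notation skip := (skip b).
#[local] Arguments aexec : simpl never.
#[local] Arguments den : simpl never.

Definition is_sep (o : option isym) := if o is Some ISep then true else false.
Definition is_one (o : option isym) := if o is Some I1 then true else false.
Definition is_bit (o : option isym) := if o is Some s then ~~ is_sep o else false.

(** [n] is the least [j] such that a separator has index [j * j]. [rT] serves as the constant 0, and
    [rW] becomes 1 once [n] is found, which makes the later rounds idle. *)
Definition find_n : prog :=
  POp (zero rT) ;; POp (zero rW) ;;
  PFor rI (POp (less rT rW) ;;
    PIf (@fl b) skip
      (POp (cpy rN rI) ;; goto b rN rN rT ;; POp (look is_sep) ;;
       PIf (@fl b) (POp (inc rW)) skip)).

(** The first move leaves the separator. [rW] runs through the powers of 2, the binary code having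
    its low bit first; at the first symbol that is not a bit the head stays for all remaining
    rounds. *)
Definition load r : prog :=
  POp (hmove DR) ;; POp (zero r) ;; POp (zero rW) ;; POp (inc rW) ;;
  PFor rJ (POp (look is_bit) ;;
    PIf (@fl b)
      (POp (look is_one) ;; PIf (@fl b) (POp (add r rW)) skip ;;
       POp (add rW rW) ;; POp (hmove DR))
      skip).

Definition setup : prog := find_n ;; goto b rN rN rT ;; load rX ;; load rY.

Lemma den_op x (o : operation 16 b) s : den x (POp o) s = aexec cell0 x o s.
Proof. by []. Qed.

Lemma den_seq x (p q : prog) s : den x (p ;; q) s = den x q (den x p s).
Proof. by []. Qed.

Lemma den_if x t (p q : prog) s :
  den x (PIf t p q) s = if t (mem s) then den x p s else den x q s.
Proof. by []. Qed.

Lemma rval_frame x (q : prog) s r : r \notin writes q -> rval r (den x q s) = rval r s.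
Proof. by move=> h; rewrite /rval den_frame. Qed.

Lemma find_n_spec x (s : state) n : 0 < size (tp s) -> (size x).+1 < cap s ->
  hd s <= (size x).+1 -> n * n < size x ->
  (forall i, i < n -> ~~ is_sep (read_input x (i * i).+1)) -> is_sep (read_input x (n * n).+1) ->
  rval rN (den x find_n s) = n /\ rval rT (den x find_n s) = 0.
Proof.
move=> h0 hcap hh hn hlt hsep.
pose s1 := aexec cell0 x (zero rW) (aexec cell0 x (zero rT) s).
have t1 : rval rT s1 = 0 by rewrite /rval (op_frame (o := zero rW)) // -/(rval _ _) val_zero.
have z1 : size (tp s1) = size (tp s) by rewrite (op_size (zero rW)) (op_size (zero rT)).
have w1 : rval rW s1 = 0 by rewrite val_zero.
have hh1 : hd s1 = hd s by rewrite /s1 !aexec_swp_hd.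
rewrite /find_n; set body := POp (less rT rW) ;; _.
suff [h1 h2 h3] : [/\ rval rT (den x (PFor rI body) s1) = 0,
    hd (den x (PFor rI body) s1) <= (size x).+1 &
    if cap s1 <= n then rval rW (den x (PFor rI body) s1) = 0
    else rval rW (den x (PFor rI body) s1) = 1 /\ rval rN (den x (PFor rI body) s1) = n].
  move: h3; rewrite leqNgt (cap_size z1) ifN ?negbK; first by case.
  by apply: leq_trans hcap; nia.
apply: (@for_ind 16 b x rI body s1 isT _ (fun j s' => [/\ rval rT s' = 0, hd s' <= (size x).+1 &
    if j <= n then rval rW s' = 0 else rval rW s' = 1 /\ rval rN s' = n])).
- by rewrite z1.
- split; last by rewrite leq0n /rval (op_frame (o := zero rI)).
    by rewrite /rval (op_frame (o := zero rI)).
  by rewrite aexec_swp_hd hh1.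
move=> j s' hj hz hv [ht hhs hw].
have frinc r s2 : r != rI -> rval r (aexec cell0 x (inc rI) s2) = rval r s2.
  by move=> ne; rewrite /rval (op_frame (o := inc rI)) // inE.
rewrite !frinc // aexec_swp_hd /body den_seq den_op den_if; set s2 := aexec cell0 x (less rT rW) s'.
have fr2 r : rval r s2 = rval r s' by rewrite /rval (op_frame (o := less rT rW)).
have hh2 : hd s2 = hd s' by exact: aexec_swp_hd.
have f2 : fl (mem s2) = (0 < rval rW s') by rewrite fl_less ht.
have z2 : size (tp s2) = size (tp s) by rewrite (op_size (less rT rW)) hz.
case: (leqP j n) hw => hjn hw; last first.
  have [hw1 hn1] := hw; rewrite f2 hw1 ltn0Sn.
  rewrite skip_id ?hh2 //.
  by rewrite ltnNge (ltnW hjn) !fr2; split.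
rewrite f2 hw ltnn !(den_seq, den_op); set s3 := aexec cell0 x (cpy rN rI) s2.
have n3 : rval rN s3 = j by rewrite /rval reg_cpy -/(rval rI s2) fr2.
have t3 : rval rT s3 = 0 by rewrite /rval (op_frame (o := cpy rN rI)) // -/(rval rT s2) fr2.
have z3 : size (tp s3) = size (tp s) by rewrite (op_size (cpy rN rI)).
have w3 : rval rW s3 = 0 by rewrite /rval (op_frame (o := cpy rN rI)) // -/(rval rW s2) fr2.
have hh3 : hd s3 = hd s' by rewrite /s3 aexec_swp_hd.
set s4 := den x (goto b rN rN rT) s3.
have h4 : hd s4 = (j * j).+1.
  rewrite /s4 goto_hd ?n3 ?t3 ?addn0 // ?z3 ?hh3 //; last by nia.
  by rewrite (cap_size z3) ltnW.
have fr4 r : r \notin [:: rJ; rH] -> rval r s4 = rval r s3.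
  by move=> h; rewrite /s4 rval_frame //; move: h; rewrite /= !inE !negb_or; do 3!case: (r == _).
have h4x : hd s4 <= (size x).+1 by rewrite h4; nia.
set s5 := aexec cell0 x (look is_sep) s4.
have f5 : fl (mem s5) = is_sep (read_input x (j * j).+1) by rewrite /s5 fl_look h4.
have fr5 r : rval r s5 = rval r s4 by [].
have h5x : hd s5 <= (size x).+1 by rewrite /s5 hd_look.
have z5 : size (tp s5) = size (tp s) by rewrite (op_size (look is_sep)) den_size.
rewrite den_if f5; move: hjn; rewrite leq_eqVlt => /orP[/eqP ej|hjn].
  rewrite ej hsep ltnn den_op aexec_swp_hd; split=> //.
    by rewrite /rval (op_frame (o := inc rW)) // -/(rval rT s5) fr5 fr4.
  split; last by rewrite /rval (op_frame (o := inc rW)) // -/(rval rN s5) fr5 fr4 // n3.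
  have h05 : 0 < size (tp s5) by rewrite z5.
  have [-> _] := val_inc x rW h05.
  by rewrite fr5 fr4 // w3 (cap_size z5) ltn_eqF //; apply: leq_ltn_trans hcap.
rewrite (negPf (hlt _ hjn)) hjn.
rewrite skip_id //.
by rewrite !fr5 !fr4.
Qed.

Definition bits_num (l : seq isym) : nat := foldr (fun s n => is_one (Some s) + 2 * n) 0 l.

Lemma bits_num_lt l : bits_num l < 2 ^ size l.
Proof.
elim: l => //= s l IH; rewrite expnS -/(bits_num l).
have : is_one (Some s) <= 1 by exact: leq_b1.
move: (nat_of_bool _) (bits_num l) (2 ^ size l) IH => u v w; clear; lia.
Qed.

Lemma bits_num_take l j : j < size l ->
  bits_num (take j.+1 l) = bits_num (take j l) + is_one (Some (nth I0 l j)) * 2 ^ j.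
Proof.
elim: l j => //= s l IH [|j] hj /=; first by rewrite take0 /=; lia.
rewrite -!/(bits_num _) IH // expnS.
by rewrite mulnDr addnA (mulnCA 2).
Qed.

Lemma load_spec x (s : state) r l : 0 < size (tp s) -> hd s <= size x ->
  r \notin [:: rJ; rW] -> hd s + size l <= size x -> 2 ^ size l < cap s ->
  (forall i, i < size l ->
     read_input x ((hd s).+1 + i) = Some (nth I0 l i) /\ nth I0 l i <> ISep) ->
  ~~ is_bit (read_input x ((hd s).+1 + size l)) ->
  rval r (den x (load r) s) = bits_num l /\ hd (den x (load r) s) = (hd s).+1 + size l.
Proof.
move=> h0 hx; rewrite !inE negb_or => /andP[nrJ nrW] hlx hcap hl hend.
set s1 := aexec cell0 x (hmove DR) s.
pose s2 := aexec cell0 x (inc rW) (aexec cell0 x (zero rW) (aexec cell0 x (zero r) s1)).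
have hd2 : hd s2 = (hd s).+1 by rewrite /s2 !aexec_swp_hd; exact: hd_right.
have z1 : size (tp (aexec cell0 x (zero rW) (aexec cell0 x (zero r) s1))) = size (tp s).
  by rewrite (op_size (zero rW)) (op_size (zero r)).
have z2 : size (tp s2) = size (tp s) by rewrite (op_size (inc rW)).
have c2 : 2 <= cap s.
  by rewrite /cap -[size _]prednK // expnS; apply: leq_trans (leq_pmulr _ _); rewrite ?expn_gt0.
have w2 : rval rW s2 = 1.
  have h01 : 0 < size (tp (aexec cell0 x (zero rW) (aexec cell0 x (zero r) s1))) by rewrite z1.
  have [-> _] := val_inc x rW h01.
  by rewrite val_zero (cap_size z1) ltn_eqF.
have r2 : rval r s2 = 0.
  rewrite /rval (op_frame (o := inc rW)) ?inE // (op_frame (o := zero rW)) ?inE //.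
  by rewrite -/(rval _ _) val_zero.
rewrite /load; set body := POp (look is_bit) ;; _.
have hsl : size l <= cap s by apply: ltnW; apply: leq_ltn_trans hcap; apply: ltnW; exact: ltn_expl.
pose Inv j (s' : state) := [/\ rval r s' = bits_num (take j l), rval rW s' = 2 ^ minn j (size l) &
  hd s' = (hd s).+1 + minn j (size l)].
have nb : rJ \notin writes body by rewrite /= !inE /= eq_sym (negPf nrJ).
suff [h1 _ h2] : Inv (cap s2) (den x (PFor rJ body) s2).
  rewrite -[den _ _ _]/(den x (PFor rJ body) s2).
  by rewrite h1 h2 (cap_size z2) take_oversize // (minn_idPr hsl).
apply: for_ind => //; first by rewrite z2.
  split; last by rewrite aexec_swp_hd hd2 min0n addn0.
    by rewrite take0 /rval (op_frame (o := zero rJ)) ?inE.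
  by rewrite min0n expn0 /rval (op_frame (o := zero rJ)).
move=> j s' hj hz hv [hr hw hh].
have frinc r' s3 : r' != rJ -> rval r' (aexec cell0 x (inc rJ) s3) = rval r' s3.
  by move=> ne; rewrite /rval (op_frame (o := inc rJ)) // inE.
rewrite /Inv !frinc // aexec_swp_hd /body den_seq den_op den_if.
set s3 := aexec cell0 x (look is_bit) s'.
have hx3 : hd s' <= (size x).+1.
  by rewrite hh addSn ltnS; apply: leq_trans hlx; rewrite leq_add2l geq_minr.
have hd3 : hd s3 = hd s' by rewrite /s3 hd_look.
have fr3 r' : rval r' s3 = rval r' s' by [].
have f3 : fl (mem s3) = is_bit (read_input x (hd s')) by [].
rewrite f3 hh; case: (ltnP j (size l)) => hjl; last first.
  rewrite (negPf hend) (minn_idPr (leqW hjl)).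
  rewrite skip_id ?hd3 //.
  by rewrite !fr3 hr hw hh (minn_idPr hjl) !take_oversize // leqW.
rewrite (minn_idPl (ltnW hjl)) in hw hh; have [e1 e2] := hl j hjl.
rewrite e1 (minn_idPl hjl) /=.
rewrite ifT; last by case: (nth _ _ _) e2.
rewrite !(den_seq, den_op, den_if).
set s4 := aexec cell0 x (look is_one) s3.
have hd4 : hd s4 = hd s' by rewrite /s4 hd_look hd3.
have f4 : fl (mem s4) = is_one (Some (nth I0 l j)) by rewrite /s4 fl_look hd3 hh e1.
have fr4 r' : rval r' s4 = rval r' s3 by [].
rewrite f4; set s5 := (if _ then _ else _).
have z4 : size (tp s4) = size (tp s).
  by rewrite (op_size (look is_one)) (op_size (look is_bit)) hz z2.
have hpow : 2 ^ j.+1 < cap s by apply: leq_ltn_trans hcap; rewrite leq_exp2l.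
have htake : bits_num (take j l) < 2 ^ j.
  by have := bits_num_lt (take j l); rewrite size_take hjl.
have [r5 w5 h5] : [/\ rval r s5 = bits_num (take j.+1 l), rval rW s5 = 2 ^ j & hd s5 = hd s'].
  rewrite /s5 bits_num_take //; case: is_one; rewrite ?mul1n ?mul0n ?addn0.
    have fa : rval rW (aexec cell0 x (add r rW) s4) = 2 ^ j.
      by rewrite /rval (op_frame (o := add r rW)) ?inE 1?eq_sym // -/(rval _ _) fr4 fr3 hw.
    rewrite aexec_swp_hd val_add; first by rewrite !fr4 !fr3 hr hw.
    rewrite (cap_size z4) !fr4 !fr3 hr hw; apply: ltn_trans hpow.
    by rewrite expnS mul2n -addnn ltn_add2r.
  have fs r' : rval r' (aexec cell0 x (hmove DS) s4) = rval r' s4 by [].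
  by rewrite !fs !fr4 !fr3 hr hw hd_stay hd4.
have z5 : size (tp s5) = size (tp s).
  by rewrite /s5; case: ifP => _; rewrite ?(op_size (add r rW)) ?(op_size (hmove DS)).
set s6 := aexec cell0 x (add rW rW) s5.
have hd6 : hd s6 = hd s' by rewrite /s6 aexec_swp_hd.
have fr7 r' : rval r' (aexec cell0 x (hmove DR) s6) = rval r' s6 by [].
rewrite !fr7 hd_right hd6; last first.
  by rewrite hh addSn; apply: leq_trans hlx; rewrite -addnS leq_add2l.
rewrite hh addnS; split=> //.
  by rewrite /rval (op_frame (o := add rW rW)) ?inE.
by rewrite val_add w5 ?(cap_size z5) addnn -mul2n -expnS.
Qed.

End Setup.

Lemma bin_auxP fuel m : m <= fuel ->
  [/\ bits_num (bin_aux fuel m) = m, 2 ^ size (bin_aux fuel m) <= (m == 0) + 2 * m &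
      forall i, i < size (bin_aux fuel m) -> nth I0 (bin_aux fuel m) i <> ISep].
Proof.
elim: fuel m => [|f IH] m hm; first by case: m hm.
case: m hm => [|m] // hm.
have hf : uphalf m <= f by move: hm; clear; lia.
have [h1 h2 h3] := IH _ hf.
have h4 : m.+1 = ~~ odd m + 2 * uphalf m by clear; lia.
have -> : bin_aux f.+1 m.+1 = (if ~~ odd m then I1 else I0) :: bin_aux f (uphalf m) by [].
move: h1 h2 h3; move: (bin_aux _ _) => l h1 h2 h3; split.
- by rewrite [LHS]/= -/(bits_num l) h1 [RHS]h4; congr (_ + _); case: (odd m).
- rewrite [size _]/= expnS; move: h2 h4; move: (uphalf m) (~~ odd m) => t o; clear.
  by case: t => [|t] /=; lia.
- by case=> [|i] //=; [case: ifP|exact: h3].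
Qed.

(** * Positions of the symbols in an encoded input *)

Section Encoding.
Variables (n : nat) (E : rel 'I_n) (v w : 'I_n).
Let x := enc_input E v w.

Lemma size_enc_graph : size (enc_graph E) = n * n.
Proof. by rewrite /enc_graph size_allpairs -cardE card_ord. Qed.

Lemma size_enc_input : size x = n * n + 2 + size (binary v) + size (binary w).
Proof. by rewrite /x /enc_input !size_cat /= size_cat /= size_enc_graph; lia. Qed.

Lemma nth_enc_graph (i j : 'I_n) : nth I0 (enc_graph E) (i * n + j) = if E i j then I1 else I0.
Proof.
have H s m : m < size s ->
    nth I0 [seq (if E a c then I1 else I0) | a <- s, c <- enum 'I_n] (m * n + j) =
    if E (nth i s m) j then I1 else I0.
  elim: s m => // a s IH [|m] hm /=.
    rewrite add0n nth_cat size_map -cardE card_ord ltn_ord (nth_map j) -?cardE ?card_ord //.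
    by rewrite nth_ord_enum.
  rewrite nth_cat size_map -cardE card_ord ltnNge mulSn -addnA leq_addr /= addKn.
  exact: IH.
by rewrite H ?nth_ord_enum // -cardE card_ord.
Qed.

Lemma read_enc_graph (i j : 'I_n) :
  read_input x (i * n + j).+1 = Some (if E i j then I1 else I0).
Proof.
have h : i * n + j < n * n.
  apply: (@leq_trans (i.+1 * n)); last by rewrite leq_mul2r ltn_ord orbT.
  by rewrite mulSnr ltn_add2l.
rewrite /read_input /= ifT; last first.
  by rewrite size_enc_input; apply: leq_trans h _; rewrite -!addnA leq_addr.
by rewrite /x /enc_input nth_cat size_enc_graph h nth_enc_graph.
Qed.

Lemma read_graph_sep m : m < n * n -> ~~ is_sep (read_input x m.+1).
Proof.
move=> hm; have n0 : 0 < n by apply: leq_ltn_trans (ltn_ord v).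
have hq : m %/ n < n by rewrite ltn_divLR.
have := read_enc_graph (Ordinal hq) (Ordinal (ltn_pmod m n0)).
by rewrite /= -divn_eq => ->; case: (E _ _).
Qed.

Lemma read_sep1 : read_input x (n * n).+1 = Some ISep.
Proof.
rewrite /read_input /= ifT; last by rewrite size_enc_input; lia.
by rewrite /x /enc_input nth_cat size_enc_graph ltnn subnn.
Qed.

Lemma read_v i : i < size (binary v) -> read_input x ((n * n).+2 + i) = Some (nth I0 (binary v) i).
Proof.
move=> hi; rewrite /read_input /= ifT; last by rewrite size_enc_input; lia.
rewrite /x /enc_input nth_cat size_enc_graph addSnnS ltnNge leq_addr /= addKn /=.
by rewrite nth_cat hi.
Qed.

Lemma read_sep2 : read_input x ((n * n).+2 + size (binary v)) = Some ISep.
Proof.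
rewrite /read_input /= ifT; last by rewrite size_enc_input; lia.
rewrite /x /enc_input nth_cat size_enc_graph addSnnS ltnNge leq_addr /= addKn /=.
by rewrite nth_cat ltnn subnn.
Qed.

Lemma read_w i : i < size (binary w) ->
  read_input x ((n * n).+3 + size (binary v) + i) = Some (nth I0 (binary w) i).
Proof.
move=> hi; rewrite /read_input /= ifT; last by rewrite size_enc_input; lia.
rewrite /x /enc_input nth_cat size_enc_graph ltnNge (_ : n * n <= _); last by lia.
rewrite (_ : _ - n * n = (size (binary v) + i.+1).+1); last by lia.
by rewrite /= nth_cat ltnNge leq_addr addKn.
Qed.

Lemma read_end : read_input x ((n * n).+3 + size (binary v) + size (binary w)) = None.
Proof. by rewrite /read_input ifF // size_enc_input; lia. Qed.

Lemma setup_spec b (s : st (memory b) (cell 16 b)) : 0 < size (tp s) -> (size x).+2 < cap s ->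
  hd s <= (size x).+1 ->
  let s' := den x (setup b) s in
  [/\ rval rN s' = n, rval rX s' = v & rval rY s' = w].
Proof.
move=> h0 hcap hs.
have n0 : 0 < n by apply: leq_ltn_trans (ltn_ord v).
have [bv1 bv2 bv3] := bin_auxP (leqnn v); rewrite -/(binary v) in bv1 bv2 bv3.
have [bw1 bw2 bw3] := bin_auxP (leqnn w); rewrite -/(binary w) in bw1 bw2 bw3.
have hsx := size_enc_input.
have hnx : n * n < size x by rewrite hsx; lia.
set s1 := den x (find_n b) s.
have z1 : size (tp s1) = size (tp s) by rewrite den_size.
have hd1 : hd s1 <= (size x).+1 by exact: den_hd.
have [en et] : rval rN s1 = n /\ rval rT s1 = 0.
  apply: find_n_spec => //; first exact: ltnW.
    by move=> i hi; apply: read_graph_sep; rewrite ltn_mul.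
  by rewrite read_sep1.
rewrite /setup (den_seq x (find_n b)) (den_seq x (goto b rN rN rT)) (den_seq x (load b rX)) -/s1.
set s2 := den x (goto b rN rN rT) s1.
have z2 : size (tp s2) = size (tp s) by rewrite den_size.
have hd2 : hd s2 = (n * n).+1.
  rewrite /s2 goto_hd ?en ?et ?addn0 ?z1 //; last exact: ltnW.
  by rewrite (cap_size z1); apply: leq_trans hcap; rewrite !ltnS ltnW.
have [ev hd3] : rval rX (den x (load b rX) s2) = v /\
    hd (den x (load b rX) s2) = (n * n).+2 + size (binary v).
  rewrite -{1}bv1 -hd2; apply: load_spec; rewrite ?z2 ?hd2 //.
  - by rewrite hsx; lia.
  - rewrite (cap_size z2); apply: leq_ltn_trans bv2 _; apply: leq_ltn_trans hcap.
    by rewrite hsx; have := ltn_ord v; nia.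
  - by move=> i hi; split; [exact: read_v|exact: bv3].
  - by rewrite read_sep2.
set s3 := den x (load b rX) s2 in ev hd3 *.
have z3 : size (tp s3) = size (tp s) by rewrite den_size.
have [ew _] : rval rY (den x (load b rY) s3) = w /\
    hd (den x (load b rY) s3) = (hd s3).+1 + size (binary w).
  rewrite -{1}bw1; apply: load_spec; rewrite ?z3 ?hd3 //.
  - by rewrite hsx; lia.
  - by rewrite hsx; lia.
  - rewrite (cap_size z3); apply: leq_ltn_trans bw2 _; apply: leq_ltn_trans hcap.
    by rewrite hsx; have := ltn_ord w; nia.
  - move=> i hi; split; last exact: bw3.
    by rewrite -addSn; exact: read_w.
  - by rewrite -addSn read_end.
have f1 : rN \notin writes (load b rY) by [].
have f2 : rN \notin writes (load b rX) by [].
have f3 : rN \notin writes (goto b rN rN rT) by [].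
have f4 : rX \notin writes (load b rY) by [].
have g1 : rval rN (den x (load b rY) s3) = n.
  rewrite (rval_frame x s3 f1) /s3.
  rewrite (rval_frame x s2 f2) /s2.
  by rewrite (rval_frame x s1 f3) en.
have g2 : rval rX (den x (load b rY) s3) = v.
  by rewrite (rval_frame x s3 f4) ev.
exact: And3 g1 g2 ew.
Qed.

End Encoding.

Lemma iota0S j : iota 0 j.+1 = rcons (iota 0 j) j.
Proof. by rewrite -cats1 -addn1 iotaD. Qed.

(** * The program that enumerates the walks *)

Section Main.
Variables (D : finType) (d0 : D) (p : nat) (b : nat).
Notation K := (p.+1.-tuple D).
Notation digit := 'I_b.+2.
Notation memory := (memory b).
Notation cell := (cell 16 b).
Notation cell0 := (cell0 16 b).
Notation state := (st memory cell).
Notation prog := (prog 16 b).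
Variables (g : D -> K -> K) (op : K -> 'I_3) (dec : digit -> K) (enc : K -> digit).
Hypothesis encK : cancel enc dec.
Hypothesis hb : 2 * p.+1 <= b.+2.
#[local] Arguments aexec : simpl never.
#[local] Arguments den : simpl never.
Notation skip := (skip b).

(** The first of the two vertices that is met settles the answer for good. Testing [rY] first gives
    a refusal when both are the same vertex. *)
Definition check : prog :=
  PIf (fun m => ans m == None)
    (POp (same rU rY) ;; PIf (@fl b) (POp (answer (Some false)))
      (POp (same rU rX) ;; PIf (@fl b) (POp (answer (Some true))) skip))
    skip.

Definition turn_right : prog :=
  POp (inc rV) ;; POp (same rV rN) ;; PIf (@fl b) (POp (zero rV)) skip.

Definition turn_edge : prog :=
  goto b rU rN rV ;; POp (look is_one) ;; PIf (@fl b) (POp (swap rU rV)) skip.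

Definition turn_prog : prog :=
  POp (get rA) ;;
  PIf (fun m => op (dec (dg m)) == 0 :> nat) skip
    (PIf (fun m => op (dec (dg m)) == 1 :> nat) turn_right turn_edge).

Definition step_prog : prog := check ;; turn_prog ;; step_odo d0 g dec enc.

Definition start : prog :=
  POp (cpy rU rS) ;; POp (zero rV) ;; POp (cpy rA rA0) ;; POp (zero rP) ;; POp (cpy rC rB).

Definition main : prog :=
  PFor rS (POp (less rS rN) ;;
    PIf (@fl b) (PFor rA0 (PFor rB (start ;; PFor rI step_prog))) skip).

Definition verdict (tv tw : nat) (o : option bool) (u : nat) : option bool :=
  if o is Some _ then o else if u == tw then Some false else if u == tv then Some true else None.

Section Correctness.
Variables (x : seq isym) (n : nat) (E : rel 'I_n) (tv tw w : nat).
Hypothesis hmat : forall i j : 'I_n, is_one (read_input x (i * n + j).+1) = E i j.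
Hypothesis w0 : 0 < w.
Hypothesis hx : n * n <= size x.
Hypothesis hcap : (size x).+2 < b.+2 ^ w.

Record good (s : state) (u v : 'I_n) : Prop := Good {
  good_n : rval rN s = n;
  good_u : rval rU s = u;
  good_v : rval rV s = v;
  good_x : rval rX s = tv;
  good_y : rval rY s = tw;
  good_w : size (tp s) = w;
  good_h : hd s <= (size x).+1
}.

Lemma good_frame (q : prog) s u v : good s u v ->
  all (fun r => r \notin writes q) [:: rN; rU; rV; rX; rY] -> good (den x q s) u v.
Proof.
move=> [h1 h2 h3 h4 h5 h6 h7] /= /and5P[f1 f2 f3 f4 /andP[f5 _]].
split; rewrite ?rval_frame ?den_size //; exact: den_hd.
Qed.

Lemma check_spec s u v : good s u v ->
  good (den x check s) u v /\ ans (mem (den x check s)) = verdict tv tw (ans (mem s)) u.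
Proof.
move=> gs; split; first exact: good_frame.
rewrite /check /verdict den_if; case: eqP => [ea|]; last by case: (ans _).
rewrite ea.
rewrite (den_seq x (POp _)) den_op den_if.
set s1 := aexec cell0 x (same rU rY) s.
have e1 : fl (mem s1) = (nat_of_ord u == tw) by rewrite fl_same (good_u gs) (good_y gs).
rewrite e1; case: eqP => // _.
rewrite (den_seq x (POp _)) den_op den_if; set s2 := aexec cell0 x (same rU rX) s1.
have r1 r : rval r s1 = rval r s by rewrite /rval (op_frame (o := same rU rY)).
have e2 : fl (mem s2) = (nat_of_ord u == tv).
  by rewrite fl_same !r1 (good_u gs) (good_x gs).
rewrite e2; case: eqP => // _; rewrite den_op.
by rewrite (op_ans (o := hmove DS)) // (op_ans (o := same rU rX)) // (op_ans (o := same rU rY)).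
Qed.

Lemma turn_right_spec s u v : good s u v -> good (den x turn_right s) u (ordS v).
Proof.
move=> gs; have zs : 0 < size (tp s) by rewrite (good_w gs).
have hd1 : hd (den x turn_right s) <= (size x).+1 by apply: den_hd; exact: good_h gs.
have z1 : size (tp (den x turn_right s)) = w by rewrite den_size (good_w gs).
have fr r : r != rV -> rval r (den x turn_right s) = rval r s.
  by move=> h; rewrite rval_frame //= !inE !(negPf h).
have fn := fr rN isT; have fu := fr rU isT; have fx := fr rX isT; have fy := fr rY isT.
split=> //; rewrite ?fn ?fu ?fx ?fy; try by case: gs.
rewrite /turn_right (den_seq x (POp _)) (den_seq x (POp _)) !den_op den_if.
set s1 := aexec cell0 x (inc rV) s.
have hc : cap s = b.+2 ^ w by rewrite /cap (good_w gs).
have hvn : v.+1 < cap s.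
  by apply: leq_ltn_trans (ltn_ord v) _; rewrite hc; apply: leq_trans hcap; nia.
have [v1 _] := val_inc x rV zs; rewrite -/s1 (good_v gs) ltn_eqF // in v1.
set s2 := aexec cell0 x (same rV rN) s1.
have r2 r : rval r s2 = rval r s1 by rewrite /rval (op_frame (o := same rV rN)).
have n1 : rval rN s1 = n by rewrite /rval (op_frame (o := inc rV)) // -/(rval _ _) (good_n gs).
have -> : fl (mem s2) = (v.+1 == n) by rewrite fl_same v1 n1.
rewrite /=; case: eqP => [e|/eqP ne].
  by rewrite den_op val_zero e modnn.
rewrite (rval_frame x s2 (isT : rV \notin writes skip)) r2 v1 modn_small //.
by rewrite ltn_neqAle ne ltn_ord.
Qed.

Lemma turn_edge_spec s u v : good s u v ->
  good (den x turn_edge s) (if E u v then v else u) (if E u v then u else v).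
Proof.
move=> gs; have zs : 0 < size (tp s) by rewrite (good_w gs).
rewrite /turn_edge (den_seq x (goto b rU rN rV)) (den_seq x (POp _)) den_op den_if.
set s1 := den x (goto b rU rN rV) s.
have g1 : good s1 u v by exact: good_frame.
have h1 : hd s1 = (u * n + v).+1.
  rewrite /s1 goto_hd ?(good_u gs) ?(good_v gs) ?(good_n gs) //.
  - by rewrite /cap (good_w gs); apply: ltnW; apply: ltn_trans hcap; exact: ltnSn.
  - exact: good_h gs.
  - apply: leq_trans hx; apply: (@leq_trans (u.+1 * n)); last by rewrite leq_mul2r ltn_ord orbT.
    by rewrite mulSnr leq_add2l ltnW.
set s2 := aexec cell0 x (look is_one) s1.
have g2 : good s2 u v by apply: (@good_frame (POp (look is_one)) s1).
have -> : fl (mem s2) = E u v by rewrite /s2 fl_look h1 hmat.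
case: (E u v); last by apply: (@good_frame skip s2).
rewrite den_op; have [eu ev] := reg_swap x rU rV s2.
have fr r : r \notin [:: rU; rV] -> rval r (aexec cell0 x (swap rU rV) s2) = rval r s2.
  by move=> h; rewrite /rval (op_frame (o := swap rU rV)).
have fn := fr rN isT; have fx := fr rX isT; have fy := fr rY isT.
split; rewrite ?fn ?fx ?fy ?(op_size (swap rU rV)); try by case: g2.
- by rewrite /rval eu; case: g2.
- by rewrite /rval ev; case: g2.
- by rewrite aexec_swp_hd; case: g2.
Qed.

Lemma turn_spec s u v : good s u v ->
  let z := turn E (op (dec (head ord0 (reg rA s)))) (u, v) in
  good (den x turn_prog s) z.1 z.2.
Proof.
move=> gs; have zs : 0 < size (tp s) by rewrite (good_w gs).
rewrite /turn_prog (den_seq x (POp _)) den_op den_if.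
set s1 := aexec cell0 x (get rA) s.
have g1 : good s1 u v by apply: (@good_frame (POp (get rA)) s).
have -> : dg (mem s1) = head ord0 (reg rA s) by exact: dg_get.
rewrite /turn den_if; case: eqP => _; first by apply: (@good_frame skip s1).
have -> : dg (mem s1) = head ord0 (reg rA s) by exact: dg_get.
case: eqP => _; first exact: turn_right_spec.
by have := turn_edge_spec g1; case: (E u v).
Qed.

Notation ostep_ := (ostep d0 g (fun b => turn E (op b)) (@rlab D p b dec) (@rcarry b)).

Definition abs (s : state) (u v : 'I_n) := ((u, v), (cells dec (tp s), reg rC s)).

Lemma step_spec s u v : good s u v ->
  let z := ostep_ (abs s u v) in
  let s' := den x step_prog s in
  [/\ good s' z.1.1 z.1.2, abs s' z.1.1 z.1.2 = z &
      ans (mem s') = verdict tv tw (ans (mem s)) u].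
Proof.
move=> gs; have [g1 a1] := check_spec gs.
rewrite /step_prog (den_seq x check) (den_seq x turn_prog).
set s1 := den x check s in g1 a1 *.
have rA1 : reg rA s1 = reg rA s by exact: den_frame.
have rP1 : reg rP s1 = reg rP s by exact: den_frame.
have rC1 : reg rC s1 = reg rC s by exact: den_frame.
have := turn_spec g1; set s2 := den x turn_prog s1.
have rA2 : reg rA s2 = reg rA s by rewrite -rA1; exact: den_frame.
have rP2 : reg rP s2 = reg rP s by rewrite -rP1; exact: den_frame.
have rC2 : reg rC s2 = reg rC s by rewrite -rC1; exact: den_frame.
have a2 : ans (mem s2) = verdict tv tw (ans (mem s)) u by rewrite -a1; exact: den_ans.
rewrite rA1 /ostep /=.
have -> : dec (head ord0 (reg rA s)) = label (@rlab D p b dec) (cells dec (tp s)) (reg rC s).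
  by move: w0; rewrite -(good_w gs) /reg /cells; case: (tp s).
case: (turn _ _ _) => u2 v2 /= g2; split.
- exact: good_frame.
- have z2 : 0 < size (tp s2) by rewrite (good_w g2).
  have ec : cells dec (tp s2) = cells dec (tp s) by rewrite !cells_reg rA2 rP2.
  by rewrite /abs (odo_spec d0 g encK hb x z2) ec rC2.
- rewrite -a2; exact: den_ans.
Qed.

(** The inverse of [num] on words of [m] digits: looping over the values of a register amounts to
    looping over all words of labels. *)
Fixpoint dig (m j : nat) : seq digit :=
  if m is m'.+1 then inord (j %% b.+2) :: dig m' (j %/ b.+2) else [::].

Lemma size_dig m j : size (dig m j) = m.
Proof. by elim: m j => //= m IH j; rewrite IH. Qed.

Lemma num_dig m j : j < b.+2 ^ m -> num (dig m j) = j.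
Proof.
elim: m j => [|m IH] j /=; first by case: j.
rewrite expnS => hj; rewrite IH; last by rewrite ltn_divLR // mulnC.
by rewrite inordK ?ltn_pmod // addnC mulnC -divn_eq.
Qed.

Lemma dig_num d : dig (size d) (num d) = d.
Proof. by apply: num_inj; rewrite ?size_dig ?num_dig ?num_lt. Qed.

Lemma reg_dig (s : state) r j : size (tp s) = w -> rval r s = j -> reg r s = dig w j.
Proof.
move=> z <-; apply: num_inj; first by rewrite size_dig size_reg.
by rewrite num_dig // -z; exact: val_lt.
Qed.

Definition visits_from (z : 'I_n * 'I_n * (seq (K * nat) * seq digit)) m : seq nat :=
  [seq nat_of_ord (iter j ostep_ z).1.1 | j <- iota 0 m].

Lemma run_spec s u v z : good s u v -> abs s u v = z ->
  ans (mem (den x (PFor rI step_prog) s)) =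
  foldl (verdict tv tw) (ans (mem s)) (visits_from z (b.+2 ^ w)).
Proof.
move=> gs ez; have zs : 0 < size (tp s) by rewrite (good_w gs).
have <- : cap s = b.+2 ^ w by rewrite /cap (good_w gs).
pose Inv j (s' : state) := let z' := iter j ostep_ z in
  [/\ good s' z'.1.1 z'.1.2, abs s' z'.1.1 z'.1.2 = z' &
      ans (mem s') = foldl (verdict tv tw) (ans (mem s)) (visits_from z j)].
have nr : rI \notin writes step_prog by [].
suff [_ _ ->] : Inv (cap s) (den x (PFor rI step_prog) s) by [].
apply: (@for_ind 16 b x rI step_prog s nr zs Inv).
  have gz : good (aexec cell0 x (zero rI) s) u v by exact: (@good_frame (POp (zero rI)) s).
  rewrite /Inv -ez; split=> //; last by rewrite (op_ans (o := zero rI)).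
  by rewrite /abs !cells_reg !(op_frame (o := zero rI)).
move=> j s' _ _ _; rewrite /Inv; set zj := iter j ostep_ z => -[gj aj vj].
have := step_spec gj; rewrite aj -[ostep_ zj]/(iter j.+1 ostep_ z).
set z' := iter j.+1 ostep_ z; set s2 := den x step_prog s' => -[g2 a2 v2].
split; first by exact: (@good_frame (POp (inc rI)) s2).
  by rewrite -{3}a2 /abs !cells_reg !(op_frame (o := inc rI)).
rewrite (op_ans (o := inc rI)) // v2 vj /visits_from.
by rewrite iota0S map_rcons -cats1 foldl_cat.
Qed.

(* The registers [rs], and those holding the input, are as in [s0]. *)
Definition kept rs (s0 s : state) :=
  [/\ forall r, r \in [:: rN, rX, rY & rs] -> reg r s = reg r s0,
      size (tp s) = w & hd s <= (size x).+1].

Lemma kept_frame rs s0 s (q : prog) : kept rs s0 s ->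
  all (fun r => r \notin writes q) [:: rN, rX, rY & rs] -> kept rs s0 (den x q s).
Proof.
move=> [h1 h2 h3] /allP h; split; rewrite ?den_size //; last exact: den_hd.
by move=> r hr; rewrite den_frame ?h1 ?h.
Qed.

(** The answer is a left fold over the visited vertices, so a loop concatenates the visits of its
    rounds, whatever they leave in the scratch registers. Only the input and the counters of
    enclosing loops, listed in [rs], have to survive. *)
Lemma for_spec rs r body (V : nat -> seq nat) s0 s : kept rs s0 s ->
  all (fun r' => r' \notin writes (PFor r body)) [:: rN, rX, rY & rs] -> r \notin writes body ->
  (forall j s', j < b.+2 ^ w -> kept rs s0 s' -> rval r s' = j ->
     ans (mem (den x body s')) = foldl (verdict tv tw) (ans (mem s')) (V j)) ->
  ans (mem (den x (PFor r body) s)) =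
  foldl (verdict tv tw) (ans (mem s)) (flatten [seq V j | j <- iota 0 (b.+2 ^ w)]).
Proof.
move=> ks ha nr hb'; have zs : size (tp s) = w by case: ks.
have <- : cap s = b.+2 ^ w by rewrite /cap zs.
have hz : all (fun r' => r' \notin writes (POp (zero r : operation 16 b))) [:: rN, rX, rY & rs].
  by apply: sub_all ha => r' /=; rewrite !inE negb_or => /andP[].
have hbd : all (fun r' => r' \notin writes body) [:: rN, rX, rY & rs].
  by apply: sub_all ha => r' /=; rewrite !inE negb_or => /andP[].
pose Inv j (s' : state) := kept rs s0 s' /\
  ans (mem s') = foldl (verdict tv tw) (ans (mem s)) (flatten [seq V j | j <- iota 0 j]).
suff [_ ->] : Inv (cap s) (den x (PFor r body) s) by [].
apply: (@for_ind 16 b x r body s nr) => //; first by rewrite zs.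
  split; last by rewrite (op_ans (o := zero r)).
  exact: (@kept_frame rs s0 s (POp (zero r))).
move=> j s' hj hs hv [kj vj]; split.
  apply: (@kept_frame rs s0 (den x body s') (POp (inc r))) hz.
  exact: kept_frame kj hbd.
rewrite (op_ans (o := inc r)) // (hb' j) ?vj //; last by move: hj; rewrite /cap zs.
by rewrite iota0S map_rcons flatten_rcons foldl_cat.
Qed.

Definition visits_start (u v : 'I_n) (sA sB : seq digit) : seq nat :=
  visits_from ((u, v), (reset [seq dec a | a <- sA], sB)) (b.+2 ^ w).

Definition visits_vertex (u v : 'I_n) : seq nat :=
  flatten [seq flatten [seq visits_start u v (dig w i) (dig w j) | j <- iota 0 (b.+2 ^ w)]
          | i <- iota 0 (b.+2 ^ w)].

Definition visits (v : 'I_n) : seq nat :=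
  flatten [seq oapp (visits_vertex^~ v) [::] (insub i) | i <- iota 0 (b.+2 ^ w)].

Lemma start_spec rs s0 s (u v : 'I_n) : kept rs s0 s -> v = 0 :> nat ->
  rval rN s = n -> rval rX s = tv -> rval rY s = tw -> rval rS s = u ->
  good (den x start s) u v /\
  abs (den x start s) u v = ((u, v), (reset [seq dec a | a <- reg rA0 s], reg rB s)).
Proof.
move=> [_ zs hs] v0 en ex ey eu; set s' := den x start s.
have z' : size (tp s') = w by rewrite den_size.
have r_ r : r \notin writes start -> reg r s' = reg r s by exact: den_frame.
have eU : reg rU s' = reg rS s.
  rewrite /s' /start !(den_seq, den_op) !(op_frame (o := cpy _ _)) //.
  rewrite (op_frame (o := zero _)) // (op_frame (o := cpy _ _)) //.
  by rewrite (op_frame (o := zero _)) // reg_cpy.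
have eV : rval rV s' = 0.
  rewrite /rval /s' /start !(den_seq, den_op) !(op_frame (o := cpy _ _)) //.
  rewrite (op_frame (o := zero _)) // (op_frame (o := cpy _ _)) //.
  by rewrite -/(rval _ _) val_zero.
have eP : reg rP s' = nseq w ord0.
  rewrite /s' /start !(den_seq, den_op) (op_frame (o := cpy _ _)) // reg_zero.
  by rewrite (op_size (cpy _ _)) (op_size (zero _)) (op_size (cpy _ _)) zs.
have eA : reg rA s' = reg rA0 s.
  rewrite /s' /start !(den_seq, den_op) (op_frame (o := cpy _ _)) //.
  rewrite (op_frame (o := zero _)) // reg_cpy (op_frame (o := zero _)) //.
  by rewrite (op_frame (o := cpy _ _)).
have eC : reg rC s' = reg rB s.
  rewrite /s' /start !(den_seq, den_op) reg_cpy.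
  by rewrite !(op_frame (o := zero _), op_frame (o := cpy _ _)).
split.
  apply: Good => //.
  - by rewrite /rval r_.
  - by rewrite /rval eU.
  - by rewrite eV v0.
  - by rewrite /rval r_.
  - by rewrite /rval r_.
  - exact: den_hd.
rewrite /abs cells_reg eA eP eC; congr (_, (_, _)).
have : size (reg rA0 s) = w by rewrite size_reg.
by rewrite /reset; elim: (reg rA0 s) w => [|a l IH] [|w'] //= [/IH ->].
Qed.

Lemma main_spec s (v : 'I_n) : v = 0 :> nat -> size (tp s) = w -> hd s <= (size x).+1 ->
  rval rN s = n -> rval rX s = tv -> rval rY s = tw ->
  ans (mem (den x main s)) = foldl (verdict tv tw) (ans (mem s)) (visits v).
Proof.
move=> v0 zs hs en ex ey.
have k0 : kept [::] s s by [].
apply: (for_spec k0) => // i s1 hi k1 ei.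
have [f1 z1 h1] := k1; rewrite (den_seq x (POp _)) den_op den_if.
set s2 := aexec cell0 x (less rS rN) s1.
have r2 r : reg r s2 = reg r s1 by exact: (op_frame (o := less rS rN)).
have -> : fl (mem s2) = (i < n) by rewrite fl_less ei /rval f1 // -/(rval _ _) en.
have a2 : ans (mem s2) = ans (mem s1) by exact: (op_ans (o := less rS rN)).
case: insubP => [u hu eu|hu]; last first.
  by rewrite (negPf hu) /= -a2; exact: (den_ans x s2 (isT : quiet skip)).
rewrite hu -a2 /=.
have k2 : kept [:: rS] s2 s2.
  split=> //; first by rewrite (op_size (less rS rN)).
  by rewrite aexec_swp_hd.
apply: (for_spec k2) => // j s3 hj k3 ej.
have k3' : kept [:: rS; rA0] s3 s3 by case: k3.
apply: (for_spec k3') => // l s4 hl k4 el.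
have [f3 z3 _] := k3; have [f4 z4 _] := k4.
rewrite den_seq.
have e r : r \in [:: rN; rX; rY] -> rval r s4 = rval r s.
  move=> hr; rewrite /rval f4 ?f3 ?r2 ?f1 //;
      by move: hr; rewrite !inE => /or3P[] /eqP ->; rewrite ?eqxx ?orbT.
have eN : rval rN s4 = n by rewrite e.
have eX : rval rX s4 = tv by rewrite e.
have eY : rval rY s4 = tw by rewrite e.
have eS : rval rS s4 = u.
  by rewrite /rval f4 // f3 // r2 -/(rval _ _) ei.
have [gz az] := start_spec k4 v0 eN eX eY eS.
rewrite (run_spec gz az) /visits_start.
rewrite (den_ans x s4 (isT : quiet start)) (reg_dig z4 el).
have -> : reg rA0 s4 = dig w j by rewrite f4 //; exact: reg_dig.
by [].
Qed.

End Correctness.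
End Main.

(** * The order of first visits *)

Section Exploration.
Variables (n m : nat) (E : rel 'I_n) (V : 'I_n -> seq 'I_n).
Hypothesis hm : n <= m.
Hypothesis V_head : forall u, exists l, V u = u :: l.
Hypothesis V_connect : forall u y, y \in V u = connect E u y.
Hypothesis V_walk : forall u l1 y l2, V u = l1 ++ y :: l2 ->
  [\/ y = u, y \in l1 | exists2 x, x \in l1 & E x y].

Definition all_visits : seq 'I_n := flatten [seq oapp V [::] (insub i) | i <- iota 0 m].
Let L := all_visits.

Lemma mem_all_visits v : v \in L.
Proof.
apply/flattenP; exists (V v); last by rewrite V_connect connect0.
apply/mapP; exists (val v); last by rewrite valK.
by rewrite mem_iota add0n (leq_trans (ltn_ord v)).
Qed.

Lemma index_order : strict_linear_order (fun v w => index v L < index w L).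
Proof.
split; [|split]; first by move=> v; rewrite ltnn.
  by move=> u v w; exact: ltn_trans.
move=> v w ne; case: (ltngtP (index v L) (index w L)) => [||e]; [by left|by right|].
by case: ne; rewrite -(nth_index v (mem_all_visits v)) e nth_index ?mem_all_visits.
Qed.

Lemma index_cat_lt (T : eqType) (v z : T) (l1 l2 : seq T) : v \notin l1 ->
  (index z (l1 ++ v :: l2) < index v (l1 ++ v :: l2)) = (z \in l1).
Proof.
move=> hv; rewrite !index_cat (negPf hv) /= eqxx addn0.
by case: ifP => hz; [rewrite index_mem|rewrite ltnNge leq_addr].
Qed.

(** Take the first block containing [v]. If [v] is not its starting vertex, the walk has met a
    neighbour of [v] before. If it is, all earlier visits form whole components, so no vertex met
    before [v] has a neighbour not yet met, against the assumption. *)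
Lemma index_traversal : traversal E (fun v w => index v L < index w L).
Proof.
move=> v [u [y [uv [yv Euy]]]].
pose P i := v \in oapp V [::] (insub i).
have exP : exists i, P i by exists (val v); rewrite /P valK /= V_connect connect0.
case: (ex_minnP exP) => s Ps smin.
have [s' es hs'] : exists2 s' : 'I_n, val s' = s & v \in V s'.
  by move: Ps; rewrite /P; case: insubP => //= s' _ <- hs'; exists s'.
have sm : s < m by rewrite -es (leq_trans (ltn_ord s')).
pose Lpre := flatten [seq oapp V [::] (insub i) | i <- iota 0 s].
have vpre : v \notin Lpre.
  apply/negP => /flattenP[l /mapP[i hi ->] hv].
  by have := smin i hv; move: hi; rewrite mem_iota add0n /= ltnNge => /negPf ->.
have [Lpost eL] : exists Lpost, L = Lpre ++ V s' ++ Lpost.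
  exists (flatten [seq oapp V [::] (insub i) | i <- iota s.+1 (m - s.+1)]).
  have ei : iota 0 m = iota 0 s ++ s :: iota s.+1 (m - s.+1).
    by rewrite -{1}(subnKC (ltnW sm)) iotaD add0n -(subnSK sm).
  rewrite /L /all_visits ei map_cat flatten_cat /=.
  by rewrite -[in insub s]es valK.
have [l1 [l2 [eV vl1]]] : exists l1 l2, V s' = l1 ++ v :: l2 /\ v \notin l1.
  exists (take (index v (V s')) (V s')), (drop (index v (V s')).+1 (V s')); split.
    by rewrite -{1}(cat_take_drop (index v (V s')) (V s')) (drop_nth v) ?index_mem // nth_index.
  by rewrite in_take // ltnn.
have prec z : (index z L < index v L) = (z \in Lpre ++ l1).
  by rewrite eL eV -catA catA index_cat_lt // mem_cat negb_or vpre.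
rewrite prec in uv; rewrite prec in yv.
case: (V_walk eV) => [ev|hv|[x hx Exv]]; last first.
- by exists x; rewrite prec mem_cat hx orbT.
- by rewrite hv in vl1.
have el1 : l1 = [::].
  have [l e] := V_head s'; move: vl1 eV; rewrite e -ev.
  by case: (l1) => // a l' + [e1 _]; rewrite -e1 inE eqxx.
rewrite el1 cats0 in uv yv.
case/flattenP: uv => l /mapP[i hi el] ul.
case: yv; apply/flattenP; exists l; first by apply/mapP; exists i.
move: ul; rewrite el; case: insubP => //= i' _ _; rewrite !V_connect => h.
exact: connect_trans h (connect1 Euy).
Qed.

End Exploration.

Lemma foldl_verdict_some tv tw c l : foldl (verdict tv tw) (Some c) l = Some c.
Proof. by elim: l. Qed.

Lemma foldl_verdict tv tw l :
  (foldl (verdict tv tw) None l == Some true) = (index tv l < index tw l).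
Proof.
elim: l => //= a l IH; case: (eqVneq a tw) => [_|_]; first by rewrite foldl_verdict_some.
by case: (eqVneq a tv) => [_|_]; rewrite ?foldl_verdict_some.
Qed.

(** * Sequences with the search property *)

Section Walks.
Variables (n : nat) (E : rel 'I_n) (u : 'I_n).

(** The search property relative to the vertices [acc] already met. It is monotone in [acc], so
    walks that all restart at [u] can be concatenated. *)
Fixpoint searched (acc l : seq 'I_n) : bool :=
  if l is y :: l' then [|| y == u, y \in acc | has (E^~ y) acc] && searched (y :: acc) l' else true.

Lemma searched_sub acc acc' l : {subset acc <= acc'} -> searched acc l -> searched acc' l.
Proof.
elim: l acc acc' => //= y l IH acc acc' h /andP[h1 h2]; apply/andP; split.
  case/or3P: h1 => [->//|/h ->|/hasP[x /h hx Exy]]; rewrite ?orbT //.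
  by apply/or3P/Or33/hasP; exists x.
by apply: IH h2 => z; rewrite !inE => /orP[->//|/h ->]; rewrite orbT.
Qed.

Lemma searched_cat acc l l' : searched acc l -> searched acc l' -> searched acc (l ++ l').
Proof.
elim: l acc => //= y l IH acc /andP[-> h] h' /=; apply: IH h _.
by apply: searched_sub h' => z; rewrite inE orbC => ->.
Qed.

Lemma searched_flatten acc ls : all (searched acc) ls -> searched acc (flatten ls).
Proof. by elim: ls => //= l ls IH /andP[h /IH]; exact: searched_cat. Qed.

Lemma searched_split acc l1 y l2 : searched acc (l1 ++ y :: l2) ->
  [\/ y = u, y \in l1 ++ acc | exists2 x, x \in l1 ++ acc & E x y].
Proof.
elim: l1 acc => [|z l1 IH] acc /= /andP[h1 h2].
  case/or3P: h1 => [/eqP|h|/hasP[x hx Exy]]; [by constructor 1|by constructor 2|].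
  by constructor 3; exists x.
have mem_ t : t \in l1 ++ z :: acc -> t \in z :: l1 ++ acc by rewrite !(inE, mem_cat) orbCA.
case: (IH _ h2) => [h|/mem_ h|[x /mem_ hx Exy]]; [by constructor 1|by constructor 2|].
by constructor 3; exists x.
Qed.

Lemma searched_connect acc l : {in acc, forall y, connect E u y} -> searched acc l ->
  {in l, forall y, connect E u y}.
Proof.
elim: l acc => //= y l IH acc ha /andP[h1 h2].
have hy : connect E u y.
  case/or3P: h1 => [/eqP -> //|/ha //|/hasP[x /ha h Exy]].
  exact: connect_trans h (connect1 Exy).
move=> z; rewrite inE => /orP[/eqP -> //|]; apply: (IH (y :: acc)) => // t.
by rewrite inE => /orP[/eqP -> //|/ha].
Qed.

Lemma searched_iter (f : nat -> 'I_n) i k acc : f i \in acc \/ f i.+1 = u ->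
  (forall j, f j.+1 = f j \/ E (f j) (f j.+1)) ->
  searched acc [seq f j | j <- iota i.+1 k].
Proof.
move=> + hf; elim: k i acc => //= k IH i acc h; apply/andP; split; last first.
  by apply: IH; left; rewrite inE eqxx.
case: h => [h|->]; last by rewrite eqxx.
by case: (hf i) => [->|e]; rewrite ?h ?orbT //; apply/or3P/Or33/hasP; exists (f i).
Qed.

End Walks.

Section Blocks.
Variables (D : finType) (d0 : D) (p b : nat).
Notation K := (p.+1.-tuple D).
Notation digit := 'I_b.+2.
Variables (g : D -> K -> K) (op : K -> 'I_3) (dec : digit -> K) (enc : K -> digit).
Hypothesis encK : cancel enc dec.
Hypothesis hb : 2 * p.+1 <= b.+2.
Variables (n : nat) (E : rel 'I_n) (w : nat) (v0 : 'I_n).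
Hypothesis w0 : 0 < w.
Hypothesis explored : forall u y, connect E u y ->
  exists s bs : seq K, [/\ size s = w, size bs = w &
    forall R lab carry (r : R), [seq lab (iter j carry r) | j <- iota 0 w] = bs ->
    (iter (w * p.+1 ^ w) (ostep d0 g (fun b => turn E (op b)) lab carry)
      ((u, v0), (reset s, r))).1.1 = y].
Notation ostep_ := (ostep d0 g (fun b => turn E (op b)) (@rlab D p b dec) (@rcarry b)).

Definition block u i j : seq 'I_n :=
  [seq (iter k ostep_ ((u, v0), (reset [seq dec a | a <- dig b w i], dig b w j))).1.1
  | k <- iota 0 (b.+2 ^ w)].

Definition blocks u : seq 'I_n :=
  flatten [seq flatten [seq block u i j | j <- iota 0 (b.+2 ^ w)] | i <- iota 0 (b.+2 ^ w)].

Lemma visits_blocks : visits d0 g op dec E w v0 =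
  [seq val u | u <- all_visits (b.+2 ^ w) blocks].
Proof.
rewrite /visits /all_visits map_flatten; congr flatten; rewrite -map_comp.
apply: eq_map => i /=; case: insub => //= u; rewrite /visits_vertex /blocks map_flatten.
rewrite -map_comp; congr flatten; apply: eq_map => j /=.
rewrite map_flatten -map_comp; congr flatten; apply: eq_map => l /=.
by rewrite /visits_start /visits_from /block -map_comp.
Qed.

Lemma turn_edge_or o z : (turn E o z).1 = z.1 \/ E z.1 (turn E o z).1.
Proof. by rewrite /turn; do 2?case: ifP => _; [left|left|case: ifP => /=; [right|left]]. Qed.

Lemma block_head u i j : exists l, block u i j = u :: l.
Proof.
have : 0 < b.+2 ^ w by rewrite expn_gt0.
by rewrite /block; case: (_ ^ _) => // k _; eexists.
Qed.

Lemma block_searched u i j : searched E u [::] (block u i j).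
Proof.
rewrite /block; set z := (_, _); case: (_ ^ _) => //= k; rewrite eqxx /=.
apply: (@searched_iter _ _ _ (fun k => (iter k ostep_ z).1.1) 0 k [:: u]).
  by left; rewrite inE.
move=> l; exact: turn_edge_or.
Qed.

Lemma blocks_searched u : searched E u [::] (blocks u).
Proof.
apply: searched_flatten; apply/allP => l /mapP[i _ ->].
apply: searched_flatten; apply/allP => l' /mapP[j _ ->]; exact: block_searched.
Qed.

Lemma blocks_head u : exists l, blocks u = u :: l.
Proof.
rewrite /blocks; have : 0 < b.+2 ^ w by rewrite expn_gt0.
case: (_ ^ _) => // k _ /=; have [l ->] := block_head u 0 0; by eexists.
Qed.

Lemma rcarry_nth j (r : seq digit) : head ord0 (iter j (@rcarry b) r) = nth ord0 r j.
Proof.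
elim: j r => [|j IH] r; first by case: r.
rewrite iterSr IH /rcarry nth_behead nth_rcons.
by case: ltnP => h; rewrite ?if_same // nth_default.
Qed.

(** No block leaves the component of [u], since it is a walk. Conversely the labels provided by
    [explored], encoded digit by digit, are the register values of some round. *)
Lemma blocks_connect u y : (y \in blocks u) = connect E u y.
Proof.
apply/idP/idP => [|/explored[s [bs [zs zb h]]]].
  by move=> hy; apply: (searched_connect (acc := [::]) _ (blocks_searched u)).
have hpow : w * p.+1 ^ w < b.+2 ^ w.
  (* The factor 2 in [hb] pays for [w < 2 ^ w]: a loop of [b.+2 ^ w] rounds is long enough for [w]
     steps of the last level. *)
  apply: (@leq_trans ((2 * p.+1) ^ w)); last by rewrite leq_exp2r.
  by rewrite expnMn ltn_pmul2r ?expn_gt0 // ltn_expl.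
have hnum (l : seq K) : size l = w -> num [seq enc a | a <- l] < b.+2 ^ w.
  by move=> <-; rewrite -(size_map enc) num_lt.
have hdig (l : seq K) : size l = w -> dig b w (num [seq enc a | a <- l]) = [seq enc a | a <- l].
  by move=> <-; rewrite -(size_map enc) dig_num.
apply/flattenP; eexists.
  by apply/mapP; exists (num [seq enc a | a <- s]) => //; rewrite mem_iota hnum.
apply/flattenP; eexists.
  by apply/mapP; exists (num [seq enc a | a <- bs]) => //; rewrite mem_iota hnum.
apply/mapP; exists (w * p.+1 ^ w); first by rewrite mem_iota.
rewrite !hdig // -map_comp (eq_map (_ : dec \o enc =1 id)) ?map_id ?h //.
apply: (@eq_from_nth _ (dec ord0)); rewrite size_map size_iota // => j hj.
rewrite (nth_map 0) ?size_iota // nth_iota // add0n /rlab rcarry_nth.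
by rewrite (nth_map (dec ord0)) ?zb // encK.
Qed.

End Blocks.

(** * The decision procedure and its space bound *)

Section Decider.
Variables (b : nat) (P : prog 16 b).
Hypothesis P_wf : wf P.
Notation cell0 := (cell0 16 b).

Definition decider : TM :=
  machine cell0 (Cseq (count b is_bit rH) (code P)) (false, false, ord0, None)
    (fun m : memory b => ans m == Some true).

(** [q] is the length of the longest prefix of bits, which exists for every string. Halting and the
    space bound thus hold beyond encoded graphs; for these [q] is [n * n]. *)
Lemma decider_run x q : q <= size x -> (forall i, i < q -> is_bit (read_input x i.+1)) ->
  ~~ is_bit (read_input x q.+1) ->
  exists s : st (memory b) (cell 16 b),
    [/\ ans (mem s) = None, hd s <= (size x).+1, size (tp s) = trunc_log 2 (q + 2),
        halts decider x /\ (accepts decider x <-> ans (mem (den x P s)) = Some true) &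
        forall k, c_whead (run decider x k) <= trunc_log 2 (q + 2)].
Proof.
move=> hq h1 h2; set W := trunc_log 2 (q + 2).
have W0 : 0 < W by rewrite trunc_log_gt0 /= addn2.
have hW w : 2 ^ w <= q + 2 -> w <= W by exact: trunc_log_max.
have [s [hb ha hh hz]] := count_big rH ((false, false, ord0, None) : memory b) hW hq h1 h2.
have ez : size (tp s) = W by rewrite /W (trunc_log_eq _ hz).
have hP : big cell0 x W (code P) s (den x P s) by apply: (den_big x P_wf); rewrite ez.
have [k [hk hacc hw]] := machine_big (fun m : memory b => ans m == Some true) W0 (BSeq hb hP).
exists s; split=> //; split; first by exists k.
split=> [[k' /andP[/hacc -> /eqP]]|e] //.
by exists k; rewrite (hacc _ hk) hk e eqxx.
Qed.

Lemma decider_logspace : logspace_decider decider.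
Proof.
have D x : exists q, [/\ q <= size x, forall i, i < q -> is_bit (read_input x i.+1) &
    ~~ is_bit (read_input x q.+1)].
  exists (find (fun a => ~~ is_bit (Some a)) x); split; first exact: find_size.
    move=> i hi; have hs := leq_trans hi (find_size _ _).
    by have := before_find I0 hi; rewrite /read_input /= hs => /negbFE.
  rewrite /read_input /=; case: ltnP => // h.
  by apply: (nth_find I0 (a := fun a => ~~ is_bit (Some a))); rewrite has_find.
split=> [x|]; first by have [q [h1 h2 h3]] := D x; have [s [_ _ _ [] ]] := decider_run h1 h2 h3.
exists 1 => x k; have [q [h1 h2 h3]] := D x.
have [s [_ _ _ _ /(_ k) h]] := decider_run h1 h2 h3.
rewrite mul1n; apply: leq_trans h _.
rewrite -ltnS -(ltn_exp2l _ _ (isT : 1 < 2)); apply: leq_ltn_trans (trunc_logP _ _) _ => //.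
  by rewrite addn2.
apply: leq_ltn_trans (leq_add h1 (leqnn 2)) _.
have := trunc_log_ltn (size x) (isT : 1 < 2); rewrite [in X in _ -> X]expnS.
have : 2 ^ 1 <= 2 ^ (trunc_log 2 (size x)).+1 by rewrite leq_exp2l.
lia.
Qed.

End Decider.

Theorem theorem6 :
  exists M : TM, logspace_decider M /\
    forall (n : nat) (E : rel 'I_n), irreflexive E -> symmetric E ->
      let prec := fun v w : 'I_n => accepts M (enc_input E v w) in
      strict_linear_order prec /\ traversal E prec.
Proof.
have [D [d0 [p [g [op explored]]]]] := explore.
(* A digit must be able to encode an element of [K], and the base must be at least [2 * p.+1] and at
   least 16. *)
pose b := #|{: p.+1.-tuple D}| + 2 * p + 16.
pose enc (a : p.+1.-tuple D) : 'I_b.+2 := inord (index a (enum {: p.+1.-tuple D})).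
pose dec (z : 'I_b.+2) := nth [tuple of nseq p.+1 d0] (enum {: p.+1.-tuple D}) z.
have encK : cancel enc dec.
  move=> a; have hi : index a (enum {: p.+1.-tuple D}) < #|{: p.+1.-tuple D}|.
    by rewrite cardE index_mem mem_enum.
  by rewrite /dec inordK ?nth_index ?mem_enum //; rewrite /b; lia.
have hb : 2 * p.+1 <= b.+2 by rewrite /b; lia.
pose P := setup b ;; main d0 g op dec enc.
have P_wf : wf P by [].
exists (decider P); split; first exact: decider_logspace.
move=> n E _ Es prec.
case: (posnP n) => [n0|n0].
  have no (v : 'I_n) : False by move: (ltn_ord v); rewrite {2}n0.
  by split=> [|v]; [split; [|split]|]; [move=> v|move=> v|move=> v|]; case: (no v).
pose v0 : 'I_n := Ordinal n0.
pose w := trunc_log 2 (n * n + 2).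
have w0 : 0 < w by rewrite trunc_log_gt0 /= addn2.
have [hw1 hw2] : 2 ^ w <= n * n + 2 /\ n * n + 2 < 2 ^ w.+1.
  by apply/andP; apply: trunc_log_bounds; rewrite ?addn2.
rewrite expnS in hw2.
have h2w : 2 ^ 1 <= 2 ^ w by rewrite leq_exp2l.
have h4 : n ^ 2 < 4 ^ w.
  by rewrite (_ : 4 = 2 * 2) // expnMn -mulnn; move: (2 ^ w) hw2 h2w => t; nia.
(* As [n * n + 2 < 2 * 2 ^ w], a register can hold more than four times the size of the matrix,
   hence any position of the input. *)
have h16 : 4 * (2 * 2 ^ w) <= b.+2 ^ w.
  apply: (@leq_trans (16 ^ w)); last by rewrite leq_exp2r // /b; lia.
  rewrite (_ : 16 = 2 * 8) // expnMn.
  have : 8 ^ 1 <= 8 ^ w by rewrite leq_exp2l.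
  by move: (8 ^ w) (2 ^ w) => s t; nia.
pose L := all_visits (b.+2 ^ w) (blocks d0 g op dec E w v0).
have hm : n <= b.+2 ^ w by move: h16 hw2; move: (_ ^ w) (2 ^ w) => s t; nia.
have hexp := fun u y => explored n E w Es w0 h4 u y v0.
have V_connect := blocks_connect encK hb w0 hexp.
have hprec u v : prec u v <-> index u L < index v L.
  have hsz : (size (enc_input E u v)).+2 < b.+2 ^ w.
    have hbin (a : 'I_n) : size (binary a) <= 2 * n.
      have [_ h _] := bin_auxP (leqnn a); rewrite -/(binary a) in h.
      have := ltn_expl (size (binary a)) (isT : 1 < 2); have := ltn_ord a.
      by move: h; case: eqP => /=; lia.
    have := hbin u; have := hbin v; rewrite size_enc_input.
    by move: h16 hw2; move: (_ ^ w) (2 ^ w) => s t; nia.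
  have hx : n * n <= size (enc_input E u v) by rewrite size_enc_input; lia.
  have hbit i : i < n * n -> is_bit (read_input (enc_input E u v) i.+1).
    move=> hi; have := read_graph_sep E u v hi.
    by rewrite /read_input /= (leq_trans hi hx).
  have hsep : ~~ is_bit (read_input (enc_input E u v) (n * n).+1) by rewrite read_sep1.
  have [s [ea hh hz [_ hacc] _]] := decider_run P_wf hx hbit hsep.
  rewrite -/w in hz; apply: (iff_trans hacc).
  have s0 : 0 < size (tp s) by rewrite hz.
  have hc : (size (enc_input E u v)).+2 < cap s by rewrite /cap hz.
  have [eN eX eY] := setup_spec s0 hc hh.
  rewrite /P (den_seq _ (setup b)); set s1 := den _ (setup b) s in eN eX eY *.
  have hmat (i j : 'I_n) : is_one (read_input (enc_input E u v) (i * n + j).+1) = E i j.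
    by rewrite read_enc_graph; case: (E i j).
  have z1 : size (tp s1) = w by rewrite den_size.
  have h1 : hd s1 <= (size (enc_input E u v)).+1 by exact: den_hd.
  rewrite (main_spec d0 g op encK hb hmat w0 hx hsz (v := v0) erefl z1 h1 eN eX eY).
  have -> : ans (mem s1) = None by rewrite -ea; exact: (den_ans _ s (isT : quiet (setup b))).
  rewrite visits_blocks -/L.
  have -> : (index u L < index v L) =
      (index (val u) [seq val i | i <- L] < index (val v) [seq val i | i <- L]).
    by rewrite !(index_map val_inj).
  by rewrite -foldl_verdict; split=> /eqP.
have [o1 [o2 o3]] := index_order hm V_connect.
have V_walk u l1 y l2 : blocks d0 g op dec E w v0 u = l1 ++ y :: l2 ->
    [\/ y = u, y \in l1 | exists2 x, x \in l1 & E x y].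
  move=> e; have := blocks_searched d0 g op dec E w v0 u.
  by rewrite e => /searched_split; rewrite cats0.
have tr := index_traversal hm (blocks_head d0 g op dec E w v0) V_connect V_walk.
split; [split; [|split]|].
- by move=> v /hprec /o1.
- by move=> u v z /hprec h /hprec h'; apply/hprec; exact: o2 h h'.
- by move=> u v /o3[h|h]; [left|right]; apply/hprec.
- move=> v [u [y [/hprec h1 [h2 h3]]]].
  have [|z [hz Ez]] := @tr v; first by exists u, y; split=> //; split=> // /hprec.
  by exists z; split=> //; apply/hprec.
Qed.
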